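(* Let $\aleph$ be an infinite cardinal, $\mathbb K$ a field, and $I$ an $\aleph$-poset having a finite cofinal subset. For every $i\in I$ let $u_i$ be a primitive idempotent of $H(I,i)$, and let $[\mathbf U]=\{[u_i\mathfrak B(I)] : i\in I\}\subseteq \mathbf K_0(\mathfrak B(I))$, with the partial order induced by that of $\mathbf K_0(\mathfrak B(I))$. Then the group $\mathbf K_0(\mathfrak B(I))$ is free abelian with $[\mathbf U]$ as a basis and $$\mathbf K_0(\mathfrak B(I))^+=M([\mathbf U]).$$ Consequently the assignment $i\mapsto[u_i\mathfrak B(I)]$ induces an isomorphism $\rho(I):G(I)\to\mathbf K_0(\mathfrak B(I))$ of partially ordered abelian groups.
   Context: For a poset $P$, $G(P)$ is the free abelian group with basis $P$; for $x=\sum_{i\in P}x_i i\in G(P)$ the support is $\mathrm{Supp}(x)=\{i: x_i\ne0\}$, and $M(P)=\{x\in G(P): x_i>0\text{ for every maximal element } i\text{ of }\mathrm{Supp}(x)\}$. $G(P)$ is partially ordered with positive cone $M(P)$ (the restricted Hahn power of $\mathbb Z$ by $P$). For a unital ring $R$, $\mathbf K_0(R)$ is the Grothendieck group of finitely generated projective right $R$-modules, $[A]$ is the stable isomorphism class of $A$, and $\mathbf K_0(R)^+=\{[A]: A\text{ finitely generated projective}\}$; when $R$ is unit-regular (as is $\mathfrak B(I)$ below) this is the positive cone of a partial order. When $[\mathbf U]$ is a basis of $\mathbf K_0(\mathfrak B(I))$, $G([\mathbf U])$ is identified with $\mathbf K_0(\mathfrak B(I))$ and $M([\mathbf U])$ is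 regarded as a subset of it. The class $[u_i\mathfrak B(I)]$ does not depend on the choice of the primitive idempotent $u_i$ of $H(I,i)$ (a nonzero idempotent of $H(I,i)$ that is not a sum of two nonzero orthogonal idempotents of $H(I,i)$). Conventions. $\aleph$ is an infinite cardinal, regarded as an initial ordinal, so that $\emptyset\in\aleph$; $\mathbb K$ is a field. For a poset $P$, $\mathcal M(P)$ is the set of all maximal chains of $P$ (maximal totally ordered subsets). An $\aleph$-poset is a partially ordered set $I$ with $|I|\le\aleph$ and $|\mathcal M(I)|\le\aleph$. For $i\in I$: $\{i\le\}=\{k\in I: i\le k\}$, $\{\le i\}=\{k\in I:k\le i\}$, $\{i\not\le\}=I\setminus\{i\le\}$, with the induced orders. For a set $A$, $\aleph^{(A)}$ is the set of maps $p:A\to\aleph$ with $p(a)=\emptyset$ for all but finitely many $a\in A$. For a set $X$, $\mathrm{CFM}_X(\mathbb K)$ is the $\mathbb K$-algebra of column-finite $X\times X$ matrices over $\mathbb K$, and $\mathrm{FR}_X(\mathbb K)$ is its ideal of matrices with only finitely many nonzero rows; $a(x,y)$ denotes the entry of $a$ in row $x$, column $y$. Construction. Let $X(I)=\aleph^{(I)}\times\mathcal M(I)$ and $Q(I)=\mathrm{CFM}_{X(I)}(\mathbb K)$. For $i\in I$ let $X(i\le)=\aleph^{(\{i\le\})}\times\mathcal M(\{i\le\})$ and let $\psi_{I,i}:\mathrm{CFM}_{X(i\le)}(\mathbb K)\to Q(I)$ be the injective (not necessarily unital) $\mathbb K$-algebra homomorphism given, for $p,q\in\aleph^{(I)}$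 and $A,B\in\mathcal M(I)$, by $$\psi_{I,i}(a)((p,A),(q,B))=a\big((p|_{\{i\le\}},A\cap\{i\le\}),(q|_{\{i\le\}},B\cap\{i\le\})\big)$$ if $i\in A\cap B$, $A\cap\{\le i\}=B\cap\{\le i\}$ and $p|_{\{i\not\le\}}=q|_{\{i\not\le\}}$, and $\psi_{I,i}(a)((p,A),(q,B))=0$ otherwise. Put $H(I,i)=\psi_{I,i}(\mathrm{FR}_{X(i\le)}(\mathbb K))$ if $i$ is not a maximal element of $I$, and $H(I,i)=\mathbb K\,\psi_{I,i}(\mathbf 1)$ if $i$ is a maximal element of $I$. Put $\mathfrak B(I)=\sum_{i\in I}H(I,i)\subseteq Q(I)$; this sum is direct and, when $I$ has a finite cofinal subset, $\mathfrak B(I)$ is a unital $\mathbb K$-subalgebra of $Q(I)$. *)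

(* Defs.v *)
(* K_0 of a ring and Hahn powers of Z, followed by the ring B(I) attached to a
   poset I having a finite cofinal subset. *)
From HB Require Import structures.
From mathcomp Require Import all_boot all_order all_algebra.
From mathcomp Require Import generic_quotient.
From mathcomp Require Import freeg.
From mathcomp Require Import all_classical.

Set Implicit Arguments.
Unset Strict Implicit.
Unset Printing Implicit Defensive.

Import Order.TTheory GRing.Theory Num.Theory.

Local Open Scope classical_set_scope.
Local Open Scope ring_scope.
Local Open Scope quotient_scope.
Local Open Scope card_scope.

(* Group completion (Grothendieck group) of a commutative monoid: formal
   differences a - b, with a - b = a' - b' iff a + b' + c = a' + b + c for
   some c. *)
Section GroupCompletion.
Variable N : nmodType.
Implicit Types x y z : N * N.

Definition completion_rel x y : bool :=
  `[< exists c, x.1 + y.2 + c = y.1 + x.2 + c >].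

Lemma completion_rel_refl : reflexive completion_rel.
Proof. by move=> x; apply/asboolP; exists 0. Qed.

Lemma completion_rel_sym : symmetric completion_rel.
Proof.
by move=> x y; apply: asbool_equiv_eq; split=> -[c e]; exists c; rewrite e.
Qed.

Lemma completion_rel_trans : transitive completion_rel.
Proof.
move=> y x z /asboolP[c exy] /asboolP[c' eyz]; apply/asboolP.
exists (y.1 + y.2 + c + c').
have -> : x.1 + z.2 + (y.1 + y.2 + c + c') =
    (x.1 + y.2 + c) + (y.1 + z.2 + c').
  by rewrite [LHS](AC (2*4) ((1*4*5)*(3*2*6)))/=.
rewrite exy eyz.
by rewrite [LHS](AC (3*3) ((4*2)*(1*5*3*6)))/=.
Qed.

Canonical completion_equiv :=
  EquivRel completion_rel completion_rel_refl completion_rel_sym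
    completion_rel_trans.

Definition group_completion := {eq_quot completion_equiv}.

HB.instance Definition _ := Choice.on group_completion.
HB.instance Definition _ := EqQuotient.on group_completion.

Definition completion_class (a b : N) : group_completion :=
  \pi_group_completion (a, b).

Lemma completion_classP (a b a' b' : N) :
  completion_class a b = completion_class a' b' <->
  exists c, a + b' + c = a' + b + c.
Proof.
split=> [/eqmodP /asboolP[c /= e]|e]; first by exists c.
by apply/eqmodP/asboolP.
Qed.

Lemma completion_classE (x : group_completion) :
  exists a b, x = completion_class a b.
Proof.
exists (repr x).1, (repr x).2.
by rewrite /completion_class -surjective_pairing reprK.
Qed.

Let add (x y : group_completion) : group_completion :=
  completion_class ((repr x).1 + (repr y).1) ((repr x).2 + (repr y).2).
Let opp (x : group_completion) : group_completion :=
  completion_class (repr x).2 (repr x).1.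

Let reprP a b : exists c, a + (repr (completion_class a b)).2 + c =
  (repr (completion_class a b)).1 + b + c.
Proof.
apply/completion_classP.
by rewrite {2}/completion_class -surjective_pairing reprK.
Qed.

Let addE a b a' b' : add (completion_class a b) (completion_class a' b') =
  completion_class (a + a') (b + b').
Proof.
apply/esym/completion_classP.
have [c e] := reprP a b; have [c' e'] := reprP a' b'.
move: (repr _) e (repr _) e' => -[r s] /= e [r' s'] /= e'.
exists (c + c').
have -> : a + a' + (s + s') + (c + c') = (a + s + c) + (a' + s' + c').
  by rewrite [LHS](AC (2*2*2) ((1*3*5)*(2*4*6)))/=.
by rewrite e e' [LHS](AC (3*3) ((1*4)*(2*5)*(3*6)))/=.
Qed.

Let oppE a b : opp (completion_class a b) = completion_class b a.
Proof.
apply/completion_classP; have [c e] := reprP a b; exists c.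
by rewrite addrC [_ + a]addrC [in RHS]addrC [b + _]addrC [LHS]addrC [RHS]addrC e.
Qed.

Let addA : associative add.
Proof.
move=> x y z; have [a [b ->]] := completion_classE x.
have [a' [b' ->]] := completion_classE y.
have [a'' [b'' ->]] := completion_classE z.
by rewrite !addE !addrA.
Qed.

Let addC : commutative add.
Proof. by move=> x y; rewrite /add addrC [X in completion_class _ X]addrC. Qed.

Let add0 : left_id (completion_class 0 0) add.
Proof.
by move=> x; have [a [b ->]] := completion_classE x; rewrite addE !add0r.
Qed.

Let addN : left_inverse (completion_class 0 0) opp add.
Proof.
move=> x; have [a [b ->]] := completion_classE x; rewrite oppE addE.
by apply/completion_classP; exists 0; rewrite !addr0 !add0r addrC.
Qed.

HB.instance Definition _ :=
  GRing.isZmodule.Build group_completion addA addC add0 addN.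

Lemma completion_classD (a b a' b' : N) :
  completion_class a b + completion_class a' b' =
  completion_class (a + a') (b + b').
Proof. exact: addE. Qed.

Lemma completion_classB (a b : N) :
  completion_class a b = completion_class a 0 - completion_class b 0.
Proof.
have -> : - completion_class b 0 = completion_class 0 b by exact: oppE.
by rewrite completion_classD addr0 add0r.
Qed.

End GroupCompletion.

Section Modules.
Variable R : pzRingType.
Implicit Types M N L : lmodType R.

Definition finitely_generated M : Prop :=
  exists n (g : 'I_n -> M),
    forall x, exists c : 'I_n -> R, x = \sum_i c i *: g i.

Definition projective M : Prop :=
  forall (N L : lmodType R) (g : {linear N -> L}) (f : {linear M -> L}),
    (forall y, exists x, g x = y) ->
    exists h : {linear M -> N}, forall x, g (h x) = f x.

Definition isomorphic M N : Prop := exists f : {linear M -> N}, bijective f.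

Lemma isomorphic_refl M : isomorphic M M.
Proof. by exists idfun; exists idfun. Qed.

Lemma isomorphicI M N (f : M -> N) (g : N -> M) :
  linear f -> cancel f g -> cancel g f -> isomorphic M N.
Proof.
move=> lf fK gK.
pose fL : {linear M -> N} :=
  HB.pack f (GRing.isLinear.Build _ _ _ _ f lf).
by exists fL; exists g.
Qed.

Lemma isomorphic_sym M N : isomorphic M N -> isomorphic N M.
Proof.
move=> [f [g fK gK]]; apply: (@isomorphicI _ _ g f) => // a x y.
by apply: (can_inj fK); rewrite linearP !gK.
Qed.

Lemma isomorphic_trans M N L :
  isomorphic M N -> isomorphic N L -> isomorphic M L.
Proof.
move=> [f [f' fK f'K]] [g [g' gK g'K]].
apply: (@isomorphicI _ _ (g \o f) (f' \o g')).
- by move=> a x y /=; rewrite !linearP.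
- by move=> x /=; rewrite gK fK.
- by move=> x /=; rewrite f'K g'K.
Qed.

Lemma isomorphic_prod M M' N N' : isomorphic M M' -> isomorphic N N' ->
  isomorphic (M * N)%type (M' * N')%type.
Proof.
move=> [f [f' fK f'K]] [g [g' gK g'K]].
apply: (@isomorphicI _ _ (fun x => (f x.1, g x.2)) (fun x => (f' x.1, g' x.2))).
- by move=> a [x1 x2] [y1 y2]; rewrite /= !linearP.
- by move=> [x1 x2] /=; rewrite fK gK.
- by move=> [x1 x2] /=; rewrite f'K g'K.
Qed.

Lemma isomorphic_prodC M N : isomorphic (M * N)%type (N * M)%type.
Proof.
by apply: (@isomorphicI _ _ (fun x => (x.2, x.1)) (fun x => (x.2, x.1))) => //;
  case.
Qed.

Lemma isomorphic_prodA M N L :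
  isomorphic (M * (N * L))%type ((M * N) * L)%type.
Proof.
by apply: (@isomorphicI _ _ (fun x => ((x.1, x.2.1), x.2.2))
  (fun x => (x.1.1, (x.1.2, x.2)))) => //; [case=> ? []|case=> -[]].
Qed.

Lemma isomorphic_prod0 M : isomorphic ('rV[R]_0 * M)%type M.
Proof.
apply: (@isomorphicI _ _ snd (pair 0)) => // -[u v] /=.
by congr pair; apply/rowP => -[].
Qed.

Lemma finitely_generated_rV n : finitely_generated 'rV[R]_n.
Proof.
exists n, (fun i => delta_mx 0 i) => x; exists (x 0).
exact: row_sum_delta.
Qed.

Lemma finitely_generated_prod M N :
  finitely_generated M -> finitely_generated N ->
  finitely_generated (M * N)%type.
Proof.
move=> [m [g gP]] [n [h hP]].
exists (m + n)%N, (fun i => match fintype.split i with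
  | inl j => (g j, 0) | inr k => (0, h k) end) => -[x y].
have [c ->] := gP x; have [c' ->] := hP y.
exists (fun i => match fintype.split i with inl j => c j | inr k => c' k end).
apply/esym; rewrite big_split_ord /=.
have sl i : fintype.split (lshift n i) = inl i :> 'I_m + 'I_n.
  exact: (unsplitK (inl i)).
have sr i : fintype.split (rshift m i) = inr i :> 'I_m + 'I_n.
  exact: (unsplitK (inr i)).
under eq_bigr do rewrite sl.
under [X in _ + X]eq_bigr do rewrite sr.
have E1 (s : 'I_m -> M) : \sum_i ((s i, 0) : M * N) = (\sum_i s i, 0).
  by elim/big_rec2: _ => // i p q _ ->; congr pair; rewrite /= add0r.
have E2 (s : 'I_n -> N) : \sum_i ((0, s i) : M * N) = (0, \sum_i s i).
  by elim/big_rec2: _ => // i p q _ ->; congr pair; rewrite /= add0r.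
under eq_bigr do rewrite -[_ *: _]/(_, _) scaler0.
under [X in _ + X]eq_bigr do rewrite -[_ *: _]/(_, _) scaler0.
by rewrite E1 E2; congr pair; rewrite /= ?addr0 ?add0r.
Qed.

Lemma projective_rV0 : projective 'rV[R]_0.
Proof.
move=> N L g f _; exists \0 => x.
by rewrite /= linear0 (_ : x = 0) ?linear0 //; apply/rowP => -[].
Qed.

Lemma projective_prod M N :
  projective M -> projective N -> projective (M * N)%type.
Proof.
move=> pM pN P L g f gs.
have l1 : linear (fun x : M => f (x, 0)).
  by move=> a x y; rewrite -linearP; congr (f _); congr pair;
    rewrite /= scaler0 addr0.
have l2 : linear (fun x : N => f (0, x)).
  by move=> a x y; rewrite -linearP; congr (f _); congr pair;
    rewrite /= scaler0 addr0.
pose f1 : {linear M -> L} :=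
  HB.pack (fun x : M => f (x, 0)) (GRing.isLinear.Build _ _ _ _ _ l1).
pose f2 : {linear N -> L} :=
  HB.pack (fun x : N => f (0, x)) (GRing.isLinear.Build _ _ _ _ _ l2).
have [h1 h1P] := pM _ _ g f1 gs; have [h2 h2P] := pN _ _ g f2 gs.
have l : linear (fun x : M * N => h1 x.1 + h2 x.2).
  by move=> a [x1 x2] [y1 y2] /=; rewrite !linearP scalerDr addrACA.
pose h : {linear (M * N)%type -> P} :=
  HB.pack (fun x : M * N => h1 x.1 + h2 x.2)
    (GRing.isLinear.Build _ _ _ _ _ l).
exists h => -[x y] /=; rewrite linearD h1P h2P /= -linearD.
by congr (f _); congr pair; rewrite /= ?addr0 ?add0r.
Qed.

End Modules.

(* A right R-module is a left module over the converse ring R^c. *)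
Record fgproj (R : pzRingType) := FGProj {
  fgproj_module :> lmodType R^c;
  fgproj_fg : finitely_generated fgproj_module;
  fgproj_projective : projective fgproj_module }.

Section K0.
Variable R : pzRingType.
Implicit Types A B C : fgproj R.

Definition dsum A B : fgproj R :=
  FGProj (finitely_generated_prod (fgproj_fg A) (fgproj_fg B))
    (projective_prod (@fgproj_projective _ A) (@fgproj_projective _ B)).

Definition fgproj0 : fgproj R :=
  FGProj (finitely_generated_rV R^c 0) (@projective_rV0 R^c).

(* The modules A : fgproj R live in a universe too large for the isomorphism
   classes to be formed as sets of modules.  The class of A is encoded instead
   by the (small) set of all pairs (n, N) with N the kernel of some linear
   surjection from R^n onto A: by [VclassP] below, two finitely generated
   projective modules have the same code iff they are isomorphic. *)
Definition presentation := {n : nat & set 'rV[R^c]_n}.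

Definition presents (M : lmodType R^c) : set presentation :=
  [set c | exists f : {linear 'rV[R^c]_(tag c) -> M},
     (forall m, exists v, f v = m) /\ tagged c = [set v | f v = 0]].

Lemma presents_ex A : exists c, presents A c.
Proof.
have [n [g gP]] := fgproj_fg A.
have l : linear (fun v : 'rV[R^c]_n => \sum_i v 0 i *: g i).
  move=> a x y; rewrite scaler_sumr -big_split; apply: eq_bigr => i _ /=.
  by rewrite !mxE scalerDl scalerA.
pose f : {linear 'rV[R^c]_n -> A} := HB.pack
  (fun v : 'rV[R^c]_n => \sum_i v 0 i *: g i)
  (GRing.isLinear.Build _ _ _ _ _ l).
exists (Tagged (fun n => set 'rV[R^c]_n) [set v | f v = 0]); exists f; split=> //.
move=> m; have [c ->] := gP m; exists (\row_i c i) => /=.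
by apply: eq_bigr => i _; rewrite mxE.
Qed.

Lemma presents_iso (M N : lmodType R^c) :
  isomorphic M N -> presents M = presents N.
Proof.
suff H (M' N' : lmodType R^c) : isomorphic M' N' -> presents M' `<=` presents N'.
  by move=> MN; apply/seteqP; split; apply: H => //; exact: isomorphic_sym.
move=> [f [g fK gK]] c [h [hs hk]]; exists (f \o h); split.
  by move=> m; have [v hv] := hs (g m); exists v; rewrite /= hv gK.
rewrite hk; apply/seteqP; split=> v /=; first by move=> ->; rewrite linear0.
by move=> fh0; apply: (can_inj fK); rewrite fh0 linear0.
Qed.

Lemma presents_inj (M N : lmodType R^c) c :
  presents M c -> presents N c -> isomorphic M N.
Proof.
move=> [f [fs fk]] [g [gs gk]].
have fg v : f v = 0 <-> g v = 0.
  have : [set v | f v = 0] = [set v | g v = 0] by rewrite -fk -gk.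
  by move=> /(congr1 (fun S : set _ => S v)) /= ->.
have fge v w : f v = f w <-> g v = g w.
  split=> e; apply/eqP; rewrite -subr_eq0 -linearB; apply/eqP/fg;
  by rewrite linearB e subrr.
pose F m := g (projT1 (cid (fs m))); pose G m := f (projT1 (cid (gs m))).
have FE v : F (f v) = g v by apply/fge; case: cid.
have GE v : G (g v) = f v by apply/fge; case: cid.
apply: (@isomorphicI _ _ _ F G).
- move=> a x y; have [v <-] := fs x; have [w <-] := fs y.
  by rewrite -linearP !FE linearP.
- by move=> x; have [v <-] := fs x; rewrite FE GE.
- by move=> x; have [v <-] := gs x; rewrite GE FE.
Qed.

Definition is_iso_class (S : set presentation) : bool :=
  `[< exists A, S = presents A >].

(* The commutative monoid V(R) of isomorphism classes of finitely generated
   projective right R-modules, under direct sum; K_0(R) is its group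
   completion. *)
Definition Vmonoid := {S : set presentation | is_iso_class S}.

HB.instance Definition _ := Choice.on Vmonoid.

Definition Vclass A : Vmonoid :=
  exist is_iso_class (presents A) (asboolT (ex_intro _ A erefl)).

Lemma VclassP A B : Vclass A = Vclass B <-> isomorphic A B.
Proof.
split=> [/(congr1 val) /= e|/presents_iso e]; last exact: val_inj.
have [c cA] := presents_ex A; apply: (presents_inj cA).
by rewrite -e.
Qed.

Lemma VclassE (x : Vmonoid) : exists A, x = Vclass A.
Proof. by case: x => S h; have /asboolP[A e] := h; exists A; exact: val_inj. Qed.

Let Vrepr (x : Vmonoid) : fgproj R := projT1 (cid (VclassE x)).
Let VreprK x : Vclass (Vrepr x) = x.
Proof. by rewrite /Vrepr; case: cid. Qed.

Let Vadd (x y : Vmonoid) : Vmonoid := Vclass (dsum (Vrepr x) (Vrepr y)).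

Let VaddE A B : Vadd (Vclass A) (Vclass B) = Vclass (dsum A B).
Proof.
by apply/VclassP; apply: isomorphic_prod; apply/VclassP; rewrite VreprK.
Qed.

Let VaddA : associative Vadd.
Proof.
move=> x y z; have [A ->] := VclassE x; have [B ->] := VclassE y.
have [C ->] := VclassE z; rewrite !VaddE; apply/VclassP.
exact: isomorphic_prodA.
Qed.

Let VaddC : commutative Vadd.
Proof. by move=> x y; apply/VclassP; exact: isomorphic_prodC. Qed.

Let Vadd0 : left_id (Vclass fgproj0) Vadd.
Proof.
move=> x; have [A ->] := VclassE x; rewrite VaddE; apply/VclassP.
exact: isomorphic_prod0.
Qed.

HB.instance Definition _ := GRing.isNmodule.Build Vmonoid VaddA VaddC Vadd0.

Lemma VclassD A B : Vclass (dsum A B) = Vclass A + Vclass B.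
Proof. by rewrite -VaddE. Qed.

Definition K0 : zmodType := group_completion Vmonoid.

Definition K0class A : K0 := completion_class (Vclass A) 0.

Lemma K0classP A B :
  K0class A = K0class B <-> exists C, isomorphic (dsum A C) (dsum B C).
Proof.
split=> [/completion_classP[c]|[C /VclassP e]].
  rewrite !addr0; have [C ->] := VclassE c; rewrite -!VclassD.
  by move/VclassP; exists C.
by apply/completion_classP; exists (Vclass C); rewrite !addr0 -!VclassD.
Qed.

Lemma K0classD A B : K0class (dsum A B) = K0class A + K0class B.
Proof. by rewrite /K0class completion_classD addr0 -VclassD. Qed.

Lemma K0classB (x : K0) : exists A B, x = K0class A - K0class B.
Proof.
have [a [b ->]] := completion_classE x; have [A ->] := VclassE a.
by have [B ->] := VclassE b; exists A, B; exact: completion_classB.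
Qed.

(* Not [range K0class], for universe reasons. *)
Definition K0pos : set K0 := [set x | exists A, x = K0class A].

(* In general only a preorder; antisymmetric when R is unit-regular. *)
Definition K0le (x y : K0) : Prop := K0pos (y - x).

End K0.

Arguments K0pos R : clear implicits.

Section Idempotents.
Variable R : pzRingType.
Implicit Type S : set R.

Definition idempotent (e : R) : Prop := e * e = e.

Definition primitive_idempotent_in S (e : R) : Prop :=
  [/\ S e, idempotent e, e != 0 &
   ~ exists f g : R, [/\ S f /\ S g, idempotent f /\ idempotent g,
      f != 0 /\ g != 0, f * g = 0 /\ g * f = 0 & e = f + g]].

End Idempotents.

(* The right ideal eR = {e b : b in R}, as a submodule of the right regular
   module of R. *)
Section PrincipalRightIdeal.
Variables (R : pzRingType) (e : R).

Definition right_ideal_pred : {pred (R^c)^o} :=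
  [pred x : R | `[< exists b : R, x = e * b >]].

Lemma right_ideal_submod_closed : submod_closed right_ideal_pred.
Proof.
split=> [|a x y /asboolP[b ->] /asboolP[c ->]].
  by apply/asboolP; exists 0; rewrite mulr0.
by apply/asboolP; exists (b * a + c); rewrite mulrDr mulrA.
Qed.

HB.instance Definition _ :=
  GRing.isSubmodClosed.Build _ _ right_ideal_pred right_ideal_submod_closed.

Definition right_ideal := {x : (R^c)^o | x \in right_ideal_pred}.

HB.instance Definition _ := SubChoice.on right_ideal.
HB.instance Definition _ := [SubChoice_isSubLmodule of right_ideal by <:].

Lemma right_ideal_mem (b : R) : ((e * b : R) : (R^c)^o) \in right_ideal_pred.
Proof. by apply/asboolP; exists b. Qed.

Definition right_ideal_elt (b : R) : right_ideal :=
  exist _ ((e * b : R) : (R^c)^o) (right_ideal_mem b).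

Lemma right_ideal_fg : finitely_generated right_ideal.
Proof.
exists 1%N, (fun=> right_ideal_elt 1) => -[x xe]; have /asboolP[b xb] := xe.
exists (fun=> b); rewrite big_ord1; apply: val_inj => /=.
by rewrite xb -[RHS]/(e * 1 * b) mulr1.
Qed.

Hypothesis ee : idempotent e.

Lemma right_ideal_projective : projective right_ideal.
Proof.
move=> N L g f gs; have [n gn] := gs (f (right_ideal_elt 1)).
have l : linear (fun x : right_ideal => (val x : R^c) *: n).
  by move=> a x y /=; rewrite scalerDl scalerA.
pose h : {linear right_ideal -> N} :=
  HB.pack (fun x : right_ideal => (val x : R^c) *: n)
    (GRing.isLinear.Build _ _ _ _ _ l).
exists h => x /=; rewrite linearZ /= gn -linearZ; congr (f _).
apply: val_inj => /=; case: x => x xe /=; have /asboolP[b xb] := xe.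
by rewrite -[LHS]/(e * 1 * x) mulr1 xb mulrA ee.
Qed.

Definition fgproj_right_ideal : fgproj R :=
  FGProj right_ideal_fg right_ideal_projective.

End PrincipalRightIdeal.

(* G(P) is {freeg P / int}; the support of x is [dom x], and [hahn_cone] is
   M(P) for the order le on P. *)
Section HahnPower.
Variables (P : choiceType) (le : P -> P -> Prop).

Definition hahn_cone : set {freeg P / int} :=
  [set x | forall i, i \in dom x ->
     (forall j, j \in dom x -> le i j -> j = i) -> 0 < coeff i x].

Definition hahn_le (x y : {freeg P / int}) : Prop := hahn_cone (y - x).

End HahnPower.

(* The homomorphism G(P) -> V extending f : P -> V. *)
Section FreeLift.
Variables (P : choiceType) (V : zmodType) (f : P -> V).

Definition free_lift (x : {freeg P / int}) : V :=
  \sum_(i <- dom x) f i *~ coeff i x.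

Lemma free_lift_fglift x : free_lift x = fglift (f : P -> zmodule V) x.
Proof.
pose F : {additive {freeg P / int} -> zmodule V} :=
  HB.pack (fglift (f : P -> zmodule V))
    (GRing.isAdditive.Build _ _ _ (lift_is_additive (f : P -> zmodule V))).
rewrite -[fglift _ _]/(F x) -{2}[x]freeg_sumE raddf_sum.
by apply: eq_bigr => i _; rewrite [RHS]liftU.
Qed.

Lemma free_lift_is_additive : zmod_morphism free_lift.
Proof.
move=> x y; rewrite !free_lift_fglift.
exact: (lift_is_additive (f : P -> zmodule V)).
Qed.

Lemma free_liftU i : free_lift << i >> = f i.
Proof. by rewrite free_lift_fglift liftU scale1r. Qed.

End FreeLift.

(* G(B) -> V, the homomorphism that is the identity on B, is an isomorphism. *)
Definition is_basis (V : zmodType) (B : set V) : Prop :=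
  bijective (free_lift (val : B -> V)).

(* The ring CFM_X(K) of column-finite X x X matrices; the sums below run over a
   possibly infinite X but have finite support. *)
Section CFM.
Variables (K : fieldType) (X : choiceType).
Implicit Types (x y z : X).

Definition column_finite : {pred X -> X -> K^o} :=
  [pred a : X -> X -> K^o | `[< forall y, finite_set [set x | a x y != 0] >]].

Lemma column_finiteP (a : X -> X -> K^o) :
  reflect (forall y, finite_set [set x | a x y != 0]) (a \in column_finite).
Proof. exact: asboolP. Qed.

Lemma column_finite_submod_closed : submod_closed column_finite.
Proof.
split=> [|c a b /column_finiteP fa /column_finiteP fb].
  apply/column_finiteP => y; rewrite (_ : [set _ | _] = set0) //.
  by apply/seteqP; split=> x //=; rewrite eqxx.
apply/column_finiteP => y.
apply: (@sub_finite_set _ _ ([set x | a x y != 0] `|` [set x | b x y != 0])).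
  move=> x /=; rewrite -[_ x y]/(c * a x y + b x y).
  apply: contra_neqP => /not_orP[/negP/negPn/eqP -> /negP/negPn/eqP ->].
  by rewrite mulr0 addr0.
by rewrite finite_setU.
Qed.

HB.instance Definition _ := GRing.isSubmodClosed.Build K (X -> X -> K^o)
  column_finite column_finite_submod_closed.

Definition CFM := {a : X -> X -> K^o | a \in column_finite}.

HB.instance Definition _ := SubChoice.on CFM.
HB.instance Definition _ := [SubChoice_isSubLmodule of CFM by <:].

Definition entry (a : CFM) : X -> X -> K := val a.
Coercion entry : CFM >-> Funclass.

Implicit Types a b c : CFM.

Lemma CFM_finite a y : finite_set [set x | a x y != 0].
Proof. by move: y; apply/column_finiteP/(valP a). Qed.

Lemma CFM_ext a b : (forall x y, a x y = b x y) -> a = b.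
Proof.
by move=> e; apply: val_inj; apply/funext => x; apply/funext => y; exact: e.
Qed.

Lemma entryD a b x y : (a + b : CFM) x y = a x y + b x y.
Proof. by []. Qed.
Lemma entryN a x y : (- a : CFM) x y = - a x y.
Proof. by []. Qed.
Lemma entry0 x y : (0 : CFM) x y = 0.
Proof. by []. Qed.
Lemma entryZ (k : K) a x y : (k *: a : CFM) x y = k * a x y.
Proof. by []. Qed.

Definition mkCFM (f : X -> X -> K)
  (h : forall y, finite_set [set x | f x y != 0]) : CFM :=
  exist _ (f : X -> X -> K^o) (introT (column_finiteP f) h).

Definition mulCFM_entry a b x y : K := \sum_(z \in [set: X]) a x z * b z y.

Lemma mulCFM_entryE a b x y (s : seq X) : uniq s ->
  (forall z, b z y != 0 -> z \in s) ->
  mulCFM_entry a b x y = \sum_(z <- s) a x z * b z y.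
Proof.
move=> us bs; rewrite (bigfs _ us) => [|z _ zs]; last first.
  have [->|/bs] := eqVneq (b z y) 0; first by rewrite mulr0.
  by rewrite (negbTE zs).
by apply: eq_fsbigl; apply/seteqP; split.
Qed.

Lemma CFM_support b y :
  exists2 s : seq X, uniq s & forall z, b z y != 0 -> z \in s.
Proof.
have /finite_seqP[s e] := CFM_finite b y.
exists (undup s) => [|z bz]; first exact: undup_uniq.
by rewrite mem_undup; suff : [set` s] z by []; rewrite -e.
Qed.

Lemma mulCFM_entry_neq0 a b x y : mulCFM_entry a b x y != 0 ->
  exists z, a x z != 0 /\ b z y != 0.
Proof.
move=> ab; have [//|z _ h] := @fsbigN1 K 0 +%R X X [set: X]
  (fun x z => a x z * b z y) x; exists z.
by split; apply: contra_neq h => ->; rewrite ?mulr0 ?mul0r.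
Qed.

Lemma mulCFM_finite a b y : finite_set [set x | mulCFM_entry a b x y != 0].
Proof.
apply: (@sub_finite_set _ _
  (\bigcup_(z in [set z | b z y != 0]) [set x | a x z != 0])).
  by move=> x /mulCFM_entry_neq0[z [az bz]]; exists z.
by apply: bigcup_finite => *; exact: CFM_finite.
Qed.

Definition mulCFM a b : CFM := mkCFM (mulCFM_finite a b).

Lemma oneCFM_finite y : finite_set [set x | (x == y)%:R != 0 :> K].
Proof.
apply: (@sub_finite_set _ _ [set y]) => [x /=|]; last exact: finite_set1.
by case: (x =P y) => // _; rewrite eqxx.
Qed.

Definition oneCFM : CFM := mkCFM oneCFM_finite.

Let mulA : associative mulCFM.
Proof.
move=> a b c; apply: CFM_ext => x y.
rewrite -[LHS]/(mulCFM_entry a (mulCFM b c) x y).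
rewrite -[RHS]/(mulCFM_entry (mulCFM a b) c x y).
have [s us sP] := CFM_support c y.
rewrite (mulCFM_entryE _ _ us sP).
have /finite_seqP[t' tE] :
    finite_set (\bigcup_(z in [set` s]) [set w | b w z != 0]).
  by apply: bigcup_finite => *; [exact: finite_seq|exact: CFM_finite].
pose t := undup t'; have ut : uniq t by exact: undup_uniq.
have tP w z : z \in s -> b w z != 0 -> w \in t.
  move=> zs bwz; rewrite mem_undup; suff : [set` t'] w by [].
  by rewrite -tE; exists z.
rewrite (mulCFM_entryE a (b := mulCFM b c) _ ut); last first.
  by move=> w /mulCFM_entry_neq0[z [bwz /sP zs]]; exact: tP bwz.
have -> : \sum_(z <- s) mulCFM a b x z * c z y =
    \sum_(z <- s) \sum_(w <- t) a x w * b w z * c z y.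
  apply: eq_big_seq => z zs; rewrite -mulr_suml; congr (_ * _).
  by apply: (mulCFM_entryE a x ut) => w; exact: tP.
rewrite exchange_big; apply: eq_bigr => w _ /=.
rewrite -[mulCFM b c w y]/(mulCFM_entry b c w y) (mulCFM_entryE _ _ us sP).
by rewrite mulr_sumr; apply: eq_bigr => z _; rewrite mulrA.
Qed.

Let mul1 : left_id oneCFM mulCFM.
Proof.
move=> a; apply: CFM_ext => x y.
rewrite -[LHS]/(\sum_(z \in [set: X]) (x == z)%:R * a z y).
rewrite -(@fsbig_widen _ _ _ _ [set x]) ?fsbig_set1 ?eqxx ?mul1r //.
by move=> z [_ /= /eqP zx]; rewrite eq_sym (negbTE zx) mul0r.
Qed.

Let mulr1 : right_id oneCFM mulCFM.
Proof.
move=> a; apply: CFM_ext => x y.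
rewrite -[LHS]/(\sum_(z \in [set: X]) a x z * (z == y)%:R).
rewrite -(@fsbig_widen _ _ _ _ [set y]) ?fsbig_set1 ?eqxx ?GRing.mulr1 //.
by move=> z [_ /= /eqP zx]; rewrite (negbTE zx) mulr0.
Qed.

Let mulDl : left_distributive mulCFM +%R.
Proof.
move=> a b c; apply: CFM_ext => x y; have [s us sP] := CFM_support c y.
rewrite entryD -[LHS]/(mulCFM_entry (a + b) c x y).
rewrite -[mulCFM a c x y]/(mulCFM_entry a c x y).
rewrite -[mulCFM b c x y]/(mulCFM_entry b c x y).
rewrite !(mulCFM_entryE _ _ us sP) -big_split; apply: eq_bigr => z _ /=.
by rewrite entryD mulrDl.
Qed.

Let mulDr : right_distributive mulCFM +%R.
Proof.
move=> a b c; apply: CFM_ext => x y.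
have [s us sP] := CFM_support b y; have [t ut tP] := CFM_support c y.
pose r := undup (s ++ t).
have ur : uniq r by exact: undup_uniq.
have bP z : b z y != 0 -> z \in r.
  by move=> /sP zs; rewrite mem_undup mem_cat zs.
have cP z : c z y != 0 -> z \in r.
  by move=> /tP zs; rewrite mem_undup mem_cat zs orbT.
rewrite entryD -[LHS]/(mulCFM_entry a (b + c) x y).
rewrite -[mulCFM a b x y]/(mulCFM_entry a b x y).
rewrite -[mulCFM a c x y]/(mulCFM_entry a c x y).
rewrite (mulCFM_entryE a x ur bP) (mulCFM_entryE a x ur cP).
rewrite (mulCFM_entryE a (b := b + c) x ur); last first.
  move=> z; rewrite entryD; have [bz|/bP //] := eqVneq (b z y) 0.
  by rewrite bz add0r; exact: cP.
by rewrite -big_split; apply: eq_bigr => z _ /=; rewrite entryD mulrDr.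
Qed.

HB.instance Definition _ :=
  GRing.Zmodule_isPzRing.Build CFM mulA mul1 mulr1 mulDl mulDr.

Lemma entryM a b x y : (a * b : CFM) x y = \sum_(z \in [set: X]) a x z * b z y.
Proof. by []. Qed.

Lemma entry1 x y : (1 : CFM) x y = (x == y)%:R.
Proof. by []. Qed.

Lemma entryM_neq0 a b x y : (a * b : CFM) x y != 0 ->
  exists z, a x z != 0 /\ b z y != 0.
Proof. exact: mulCFM_entry_neq0. Qed.

Definition FR : set CFM :=
  [set a | finite_set [set x | exists y, a x y != 0]].

End CFM.
Arguments FR {K X}.

(* A cardinal is an initial ordinal: a well-ordered type none of whose proper
   initial segments is at least as large as the whole; \bot is the ordinal 0,
   that is, the empty set. *)
Definition initial_ordinal (d : Order.disp_t) (aleph : bOrderType d) : Prop :=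
  well_founded (fun a b : aleph => (a < b)%O) /\
  forall a : aleph, ~ ([set: aleph] #<= [set b : aleph | (b < a)%O]).

Definition infinite_cardinal (d : Order.disp_t) (aleph : bOrderType d) : Prop :=
  infinite_set [set: aleph] /\ initial_ordinal aleph.

Section MaximalChains.
Variables (d : Order.disp_t) (P : porderType d).
Implicit Types (A B : set P).

Definition chain A : Prop := total_on A (fun x y => (x <= y)%O).

Definition maximal_chain A : bool :=
  `[< chain A /\ forall B, chain B -> A `<=` B -> B = A >].

Definition maxchain := {A : set P | maximal_chain A}.

HB.instance Definition _ := Choice.on maxchain.

Definition maxchain_pred (A : maxchain) : P -> Prop := val A.
Coercion maxchain_pred : maxchain >-> Funclass.

Definition maximal_element (i : P) : Prop := forall j, (i <= j)%O -> j = i.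

Definition has_finite_cofinal_subset : Prop :=
  exists F : set P, finite_set F /\ forall i, exists2 j, F j & (i <= j)%O.

Lemma maxchain_chain (A : maxchain) : chain (val A).
Proof. by have /asboolP[] := valP A. Qed.

Lemma maxchain_mem (A : maxchain) k :
  (forall a, A a -> (a <= k)%O \/ (k <= a)%O) -> A k.
Proof.
move=> h; have /asboolP[cA mA] := valP A.
rewrite -[maxchain_pred A](mA (val A `|` [set k])); [by right| |by left].
move=> s t [As|->] [At|->]; [exact: cA| | |by left].
- exact: h.
- by have [] := h _ At; [right|left].
Qed.

Lemma maximal_chainP A : chain A ->
  (forall k, (forall a, A a -> (a <= k)%O \/ (k <= a)%O) -> A k) ->
  maximal_chain A.
Proof.
move=> cA h; apply/asboolP; split=> // B cB AB; apply/seteqP; split=> // k Bk.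
by apply: h => a /AB Ba; have := cB _ _ Ba Bk.
Qed.

End MaximalChains.

Section UpperSubposet.
Variables (d : Order.disp_t) (I : porderType d) (i : I).

Definition up := {k : I | (i <= k)%O}.

HB.instance Definition _ := SubChoice.on up.
HB.instance Definition _ := [SubChoice_isSubPOrder of up by <: with d].

End UpperSubposet.

Section Index.
Variables (d0 : Order.disp_t) (aleph : bOrderType d0).

(* aleph^(A) *)
Definition finsupp_map (A : choiceType) :=
  {p : A -> aleph | `[< finite_set [set k | p k != \bot%O] >]}.

HB.instance Definition _ A := Choice.on (finsupp_map A).

Definition finsupp_fun A (p : finsupp_map A) : A -> aleph := val p.
Coercion finsupp_fun : finsupp_map >-> Funclass.

(* X(P) = aleph^(P) x M(P) *)
Definition idx d (P : porderType d) : Type :=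
  (finsupp_map P * maxchain P)%type.

HB.instance Definition _ d (P : porderType d) := Choice.on (idx P).

Definition aleph_poset d (P : porderType d) : Prop :=
  ([set: P] #<= [set: aleph]) /\ ([set: maxchain P] #<= [set: aleph]).

Lemma finsupp_finite A (p : finsupp_map A) : finite_set [set k | p k != \bot%O].
Proof. by have /asboolP := valP p. Qed.

Variables (d : Order.disp_t) (I : porderType d) (i : I).
Implicit Types (x y z : idx I).

Lemma restr_map_subproof (p : finsupp_map I) :
  `[< finite_set [set k : up i | p (val k) != \bot%O] >].
Proof.
apply/asboolP.
apply: (@finite_preimage _ _ [set k | p k != \bot%O] (fun k : up i => val k)).
  by move=> k l _ _; exact: val_inj.
exact: finsupp_finite.
Qed.

Definition restr_map (p : finsupp_map I) : finsupp_map (up i) :=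
  exist _ (fun k : up i => p (val k)) (restr_map_subproof p).

Lemma restr_chain_subproof (A : maxchain I) : A i ->
  maximal_chain [set k : up i | A (val k)].
Proof.
move=> Ai; apply: maximal_chainP => [k l Ak Al|k h].
  exact: (maxchain_chain Ak Al).
apply: maxchain_mem => a Aa.
have [ai|ia] := maxchain_chain Aa Ai.
  by left; apply: le_trans ai (valP k).
by have := h (exist _ a ia) Aa.
Qed.

Definition restr_chain (A : maxchain I) (Ai : A i) : maxchain (up i) :=
  exist _ [set k : up i | A (val k)] (restr_chain_subproof Ai).

Definition restr x (h : x.2 i) : idx (up i) := (restr_map x.1, restr_chain h).

(* The condition under which the ((p,A),(q,B)) entry of psi_{I,i}(a) is read
   off from a. *)
Definition linked x y : Prop :=
  [/\ x.2 i, y.2 i,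
      [set k | x.2 k /\ (k <= i)%O] = [set k | y.2 k /\ (k <= i)%O] &
      forall k, ~~ (i <= k)%O -> x.1 k = y.1 k].

Lemma linkedl x y : linked x y -> x.2 i. Proof. by case. Qed.
Lemma linkedr x y : linked x y -> y.2 i. Proof. by case. Qed.

Lemma linked_le x y k : linked x y -> (k <= i)%O -> x.2 k <-> y.2 k.
Proof.
move=> [_ _ /seteqP[h1 h2] _] ki.
by split=> hk; [have [] := h1 k|have [] := h2 k].
Qed.

Lemma linked_intro x y : x.2 i -> y.2 i ->
  (forall k, (k <= i)%O -> x.2 k <-> y.2 k) ->
  (forall k, ~~ (i <= k)%O -> x.1 k = y.1 k) -> linked x y.
Proof.
move=> xi yi h1 h2; split=> //; apply/seteqP.
by split=> k [hk ki]; split=> //; apply/(h1 k ki).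
Qed.

Lemma linked_refl x : x.2 i -> linked x x.
Proof. by move=> xi; apply: linked_intro. Qed.

Lemma linked_sym x y : linked x y -> linked y x.
Proof. by move=> [h1 h2 h3 h4]; split=> // k /h4. Qed.

Lemma linked_trans y x z : linked x y -> linked y z -> linked x z.
Proof.
move=> [h1 h2 h3 h4] [g1 g2 g3 g4]; split=> //; first by rewrite h3.
by move=> k ik; rewrite h4 // g4.
Qed.

Lemma restr_eq x y (hx : x.2 i) (hy : y.2 i) : restr hx = restr hy <->
  forall k, (i <= k)%O -> x.1 k = y.1 k /\ (x.2 k <-> y.2 k).
Proof.
split=> [[e1 e2] k ik|h].
  split; first exact: (congr1 (fun p => p (exist _ k ik : up i)) e1).
  by have := congr1 (fun A => A (exist _ k ik : up i)) e2; rewrite /= => ->.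
congr pair; apply: val_inj => /=.
  by apply/funext => -[k ik] /=; have [] := h k ik.
by apply/seteqP; split=> -[k ik] /=; have [_ [h1 h2]] := h k ik.
Qed.

Lemma linked_inj x y (hx : x.2 i) (hy : y.2 i) :
  linked x y -> restr hx = restr hy -> x = y.
Proof.
move=> l /restr_eq h; rewrite [x]surjective_pairing [y]surjective_pairing.
congr pair; apply: val_inj => /=.
  apply/funext => k; have [ik|/negP ik] := boolP (i <= k)%O.
    by have [] := h k ik.
  by case: l => _ _ _; apply; exact/negP.
apply/seteqP; split=> k hk.
- have [ki|ik] := maxchain_chain hk hx; first exact/(linked_le l ki).
  by have [_ [h1 _]] := h k ik; exact: h1.
- have [ki|ik] := maxchain_chain hk hy; first exact/(linked_le l ki).
  by have [_ [_ h1]] := h k ik; exact: h1.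
Qed.

(* Every x' in X(i<=) is the restriction of exactly one element linked to a
   given x. *)
Definition lift_map (p : finsupp_map I) (p' : finsupp_map (up i)) (k : I) :
    aleph :=
  if (i <= k)%O =P true is ReflectT ik then p' (exist _ k ik) else p k.

Lemma lift_map_subproof p p' :
  `[< finite_set [set k | lift_map p p' k != \bot%O] >].
Proof.
apply/asboolP; apply: (@sub_finite_set _ _ ([set k | p k != \bot%O] `|`
  val @` [set k : up i | p' k != \bot%O])).
  move=> k /=; rewrite /lift_map; case: eqP => [ik|_]; last by left.
  by move=> h; right; exists (exist _ k ik).
by rewrite finite_setU; split;
  [exact: finsupp_finite|exact/finite_image/finsupp_finite].
Qed.

Definition lift_chain (A : maxchain I) (A' : maxchain (up i)) : set I :=
  [set k | A k /\ (k <= i)%O] `|` [set val k | k in (A' : up i -> Prop)].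

Lemma lift_chain_subproof (A : maxchain I) (A' : maxchain (up i)) : A i ->
  maximal_chain (lift_chain A A').
Proof.
move=> Ai; apply: maximal_chainP.
  move=> k l [[Ak ki]|[k' Ak <-]] [[Al li]|[l' Al <-]].
  - exact: (maxchain_chain Ak Al).
  - by left; apply: le_trans ki (valP l').
  - by right; apply: le_trans li (valP k').
  - exact: (maxchain_chain Ak Al).
move=> k h; have [ik|ki] : (i <= k)%O \/ (k <= i)%O by apply: h; left.
  right; exists (exist _ k ik : up i) => //; apply: maxchain_mem => a Aa.
  by apply: (h (val a)); right; exists a.
left; split=> //; apply: maxchain_mem => a Aa.
have [ai|ia] := maxchain_chain Aa Ai; first by apply: h; left.
by right; apply: le_trans ki ia.
Qed.

Definition lift_idx x (h : x.2 i) (x' : idx (up i)) : idx I :=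
  (exist _ (lift_map x.1 x'.1) (lift_map_subproof x.1 x'.1),
   exist _ (lift_chain x.2 x'.2) (lift_chain_subproof x'.2 h)).

Lemma lift_mem x (h : x.2 i) (x' : idx (up i)) : (lift_idx h x').2 i.
Proof. by left. Qed.

Lemma linked_lift x (h : x.2 i) (x' : idx (up i)) : linked x (lift_idx h x').
Proof.
apply: linked_intro => //; first exact: lift_mem.
- move=> k ki; split=> [xk|[[]//|[k' hk' ek]]]; first by left.
  suff -> : k = i by [].
  by apply/eqP; rewrite eq_le ki /= -ek; exact: (valP k').
- move=> k ik; rewrite -[RHS]/(lift_map _ _ _) /lift_map; case: eqP => // e.
  by rewrite e in ik.
Qed.

Lemma up_bottom (A : maxchain (up i)) : A (exist _ i (lexx i)).
Proof. by apply: maxchain_mem => a _; right; exact: (valP a). Qed.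

Lemma liftK x (h : x.2 i) (x' : idx (up i)) (hx' : (lift_idx h x').2 i) : restr hx' = x'.
Proof.
move: hx'; case: x' => p' A' hx'; congr pair; apply: val_inj => /=.
  apply/funext => -[k ik] /=.
  rewrite -[LHS]/(lift_map _ _ _) /lift_map; case: eqP => // e.
  by congr (finsupp_fun p' _); exact: val_inj.
apply/seteqP; split=> -[k ik] /=; last by move=> hk; right; exists (exist _ k ik).
case=> [[xk ki]|[k' hk' e]].
  suff -> : exist _ k ik = exist _ i (lexx i) :> up i by exact: up_bottom.
  by apply: val_inj; apply/eqP; rewrite /= eq_le ki ik.
by suff -> : exist _ k ik = k' :> up i by []; exact: val_inj.
Qed.

Lemma restrK x y (h : x.2 i) (hy : y.2 i) : linked x y -> lift_idx h (restr hy) = y.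
Proof.
move=> l; apply: (linked_inj (hx := lift_mem _ _) (hy := hy)).
  by apply: linked_trans l; apply/linked_sym/linked_lift.
exact: liftK.
Qed.

End Index.

Section Psi.
Variables (d0 : Order.disp_t) (aleph : bOrderType d0) (K : fieldType).
Variables (d : Order.disp_t) (I : porderType d).

Notation Q := (CFM K (idx aleph I)).
Implicit Types (x y z : idx aleph I) (i j k : I) (m : Q).

Section PsiDef.
Variable i : I.
Implicit Types a b : CFM K (idx aleph (up i)).

Definition psi_entry a x y : K :=
  match pselect (linked i x y) with
  | left h => a (restr (linkedl h)) (restr (linkedr h))
  | right _ => 0
  end.

Lemma psi_entryE a x y (hx : x.2 i) (hy : y.2 i) : linked i x y ->
  psi_entry a x y = a (restr hx) (restr hy).
Proof.
move=> l; rewrite /psi_entry; case: pselect => // h.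
by rewrite (Prop_irrelevance (linkedl h) hx) (Prop_irrelevance (linkedr h) hy).
Qed.

Lemma psi_entry0 a x y : ~ linked i x y -> psi_entry a x y = 0.
Proof. by rewrite /psi_entry; case: pselect. Qed.

Lemma psi_entry_linked a x y : psi_entry a x y != 0 -> linked i x y.
Proof. by rewrite /psi_entry; case: pselect => //; rewrite eqxx. Qed.

Lemma psi_finite a y : finite_set [set x | psi_entry a x y != 0].
Proof.
have [hy|hy] := pselect (y.2 i); last first.
  rewrite (_ : [set _ | _] = set0) //; apply/seteqP; split=> x //=.
  by move=> /psi_entry_linked/linkedr.
apply: (@sub_finite_set _ _
    (lift_idx hy @` [set x' | a x' (restr hy) != 0])); last first.
  exact/finite_image/CFM_finite.
move=> x /= h; have l := psi_entry_linked h; exists (restr (linkedl l)).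
  by rewrite /= -psi_entryE.
by rewrite restrK //; exact: linked_sym.
Qed.

Definition psi a : Q := mkCFM (psi_finite a).

Lemma psiE a x y (hx : x.2 i) (hy : y.2 i) : linked i x y ->
  psi a x y = a (restr hx) (restr hy).
Proof. exact: psi_entryE. Qed.

Lemma psi_unlinked a x y : ~ linked i x y -> psi a x y = 0.
Proof. exact: psi_entry0. Qed.

Lemma psi_linked a x y : psi a x y != 0 -> linked i x y.
Proof. exact: psi_entry_linked. Qed.

Lemma psi_is_linear : linear psi.
Proof.
move=> c a b; apply: CFM_ext => x y; rewrite entryD entryZ.
have [l|l] := pselect (linked i x y).
  by rewrite !(psiE _ (linkedl l) (linkedr l) l).
by rewrite !(psi_unlinked _ l) mulr0 addr0.
Qed.

HB.instance Definition _ := GRing.isLinear.Build K _ _ _ psi psi_is_linear.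

Lemma sum_linked x (hx : x.2 i) (f : idx aleph I -> K) :
  (forall z, ~ linked i x z -> f z = 0) ->
  \sum_(z \in [set: idx aleph I]) f z =
  \sum_(z \in [set: idx aleph (up i)]) f (lift_idx hx z).
Proof.
move=> f0; rewrite -(@fsbig_widen _ _ _ _ [set z | linked i x z]) //; last first.
  by move=> z [_ /=]; exact: f0.
apply: reindex_fsbig; split.
- by move=> z _ /=; exact: linked_lift.
- move=> z w _ _ e.
  rewrite -(liftK (lift_mem hx z)) -(liftK (lift_mem hx w)).
  by apply/restr_eq; rewrite e.
- by move=> z l; exists (restr (linkedr l)) => //; exact: restrK.
Qed.

Lemma psiM a b : psi (a * b) = psi a * psi b.
Proof.
apply: CFM_ext => x y; rewrite entryM.
have [l|l] := pselect (linked i x y); last first.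
  rewrite psi_unlinked // fsbig1 // => z _.
  have [az|/psi_linked lz] := eqVneq (psi a x z) 0.
    by rewrite az mul0r.
  rewrite (psi_unlinked b) ?mulr0 // => lz'.
  by apply: l; apply: linked_trans lz lz'.
have hx := linkedl l; have hy := linkedr l.
rewrite (psiE _ hx hy l) entryM (sum_linked hx); last first.
  by move=> z lz; rewrite psi_unlinked ?mul0r.
apply: eq_fsbigr => z _.
have lz := linked_lift hx z.
rewrite (psiE a hx (lift_mem hx z) lz).
rewrite (psiE b (lift_mem hx z) hy) ?liftK //.
by apply: linked_trans l; exact: linked_sym.
Qed.

Lemma psi1 x y : psi 1 x y = ((x == y) && `[< x.2 i >])%:R.
Proof.
have [l|l] := pselect (linked i x y); last first.
  rewrite psi_unlinked //; case: eqP => //= e; case: asboolP => //= hx.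
  by case: l; rewrite -e; exact: linked_refl.
rewrite (psiE _ (linkedl l) (linkedr l) l) entry1.
rewrite (asboolT (linkedl l)) andbT; congr (_%:R).
congr nat_of_bool; apply/eqP/eqP => [|e].
  exact: linked_inj.
by apply/restr_eq; rewrite e.
Qed.

Lemma psi_image m :
  (forall x y, m x y != 0 -> linked i x y) ->
  (forall x y x2 y2 (hx : x.2 i) (hy : y.2 i) (hx2 : x2.2 i) (hy2 : y2.2 i),
     linked i x y -> linked i x2 y2 -> restr hx = restr hx2 ->
     restr hy = restr hy2 -> m x y = m x2 y2) ->
  (forall x, finite_set [set z | linked i x z /\ exists y, m z y != 0]) ->
  exists2 a, FR a & m = psi a.
Proof.
move=> ml mi mf.
have [[x0 h0]|nx] := pselect (exists x, x.2 i); last first.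
  exists 0.
    rewrite /FR /= (_ : [set _ | _] = set0) //; apply/seteqP; split=> x //=.
    by move=> [y]; rewrite entry0 eqxx.
  apply: CFM_ext => x y; rewrite psi_unlinked => [|/linkedl hx]; last first.
    by apply: nx; exists x.
  by apply/eqP/negP => /negP/ml/linkedl hx; apply: nx; exists x.
pose f (x' y' : idx aleph (up i)) : K := m (lift_idx h0 x') (lift_idx h0 y').
have liftI : injective (lift_idx h0).
  move=> z w e; rewrite -(liftK (lift_mem h0 z)) -(liftK (lift_mem h0 w)).
  by apply/restr_eq; rewrite e.
have ff (y' : idx aleph (up i)) : finite_set [set x' | f x' y' != 0].
  apply: (@finite_preimage _ _ [set x | m x (lift_idx h0 y') != 0]).
    by move=> z w _ _; exact: liftI.
  exact: CFM_finite.
exists (mkCFM ff).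
  apply: (@sub_finite_set _ _ (lift_idx h0 @^-1`
      [set z | linked i x0 z /\ exists y, m z y != 0])).
    by move=> x [y] /= fxy; split; [exact: linked_lift|exists (lift_idx h0 y)].
  by apply: finite_preimage => // z w _ _; exact: liftI.
apply: CFM_ext => x y.
have [l|l] := pselect (linked i x y); last first.
  by rewrite psi_unlinked //; apply/eqP/negP => /negP/ml.
rewrite (psiE _ (linkedl l) (linkedr l) l) -[RHS]/(f _ _) /f.
apply: (mi _ _ _ _ (linkedl l) (linkedr l)
  (lift_mem h0 _) (lift_mem h0 _)) => //; last 2 first.
- by rewrite liftK.
- by rewrite liftK.
by apply: linked_trans (linked_lift h0 _); exact/linked_sym/linked_lift.
Qed.

End PsiDef.

Lemma linked_down i j x y : (i <= j)%O -> x.2 i -> linked j x y ->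
  linked i x y.
Proof.
move=> ij xi l; have yi : y.2 i by exact/(linked_le l).
apply: linked_intro => //.
  by move=> k ki; apply: (linked_le l); exact: le_trans ki ij.
move=> k ik; case: l => _ _ _; apply; apply: contra ik.
exact: le_trans.
Qed.

Lemma linked_transfer i j x y x2 y2
    (hx : x.2 i) (hy : y.2 i) (hx2 : x2.2 i) (hy2 : y2.2 i) :
  (i <= j)%O -> linked i x y -> linked i x2 y2 -> restr hx = restr hx2 ->
  restr hy = restr hy2 -> linked j x y -> linked j x2 y2.
Proof.
move=> ij l l2 /restr_eq ex /restr_eq ey lj.
apply: linked_intro.
- by have [_ [h _]] := ex j ij; exact/h/(linkedl lj).
- by have [_ [h _]] := ey j ij; exact/h/(linkedr lj).
- move=> k kj.
  have comp (z : idx aleph I) : z.2 i -> z.2 k -> (k <= i)%O \/ (i <= k)%O.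
    by move=> zi zk; exact: (maxchain_chain zk zi).
  split=> hk.
    have [ki|ik] := comp _ hx2 hk; first exact/(linked_le l2 ki).
    have [_ [_ h]] := ex k ik; have [_ [h' _]] := ey k ik.
    by apply/h'/(linked_le lj kj)/h.
  have [ki|ik] := comp _ hy2 hk; first exact/(linked_le l2 ki).
  have [_ [h _]] := ex k ik; have [_ [_ h']] := ey k ik.
  by apply/h/(linked_le lj kj)/h'.
move=> k jk; have [ik|ik] := boolP (i <= k)%O; last by case: l2 => _ _ _; apply.
have [<- _] := ex k ik; have [<- _] := ey k ik.
by case: lj => _ _ _; apply.
Qed.

Lemma psi_transfer i j (b : CFM K (idx aleph (up j))) x y x2 y2
    (hx : x.2 i) (hy : y.2 i) (hx2 : x2.2 i) (hy2 : y2.2 i) :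
  (i <= j)%O -> linked i x y -> linked i x2 y2 -> restr hx = restr hx2 ->
  restr hy = restr hy2 -> psi b x y = psi b x2 y2.
Proof.
move=> ij l l2 ex ey.
have [lj|lj] := pselect (linked j x y); last first.
  rewrite !psi_unlinked // => lj2; apply: lj.
  by apply: (linked_transfer (hx := hx2) (hy := hy2)) lj2.
have lj2 := linked_transfer ij l l2 ex ey lj.
rewrite (psiE _ (linkedl lj) (linkedr lj) lj).
rewrite (psiE _ (linkedl lj2) (linkedr lj2) lj2).
move/restr_eq: ex => ex; move/restr_eq: ey => ey.
congr (b _ _); apply/restr_eq => k jk.
  by apply: ex; exact: le_trans ij jk.
by apply: ey; exact: le_trans ij jk.
Qed.

Lemma psi_mul_lt i j (a : CFM K (idx aleph (up i)))
    (b : CFM K (idx aleph (up j))) : (i <= j)%O -> FR a ->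
  exists2 c : CFM K (idx aleph (up i)), FR c & psi a * psi b = psi c.
Proof.
move=> ij fa; apply: psi_image.
- move=> x y /entryM_neq0[z [/psi_linked l /psi_linked l']].
  by apply: (linked_trans l); apply: linked_down ij (linkedr l) l'.
- move=> x y x2 y2 hx hy hx2 hy2 l l2 ex ey; rewrite !entryM.
  rewrite (sum_linked hx); last by move=> z h; rewrite psi_unlinked ?mul0r.
  rewrite (sum_linked hx2); last by move=> z h; rewrite psi_unlinked ?mul0r.
  apply: eq_fsbigr => z _; congr (_ * _).
    rewrite (psiE a hx (lift_mem hx z) (linked_lift hx z)).
    by rewrite (psiE a hx2 (lift_mem hx2 z) (linked_lift hx2 z)) !liftK ex.
  apply: (psi_transfer b (hx := lift_mem hx z) (hy := hy)
    (hx2 := lift_mem hx2 z) (hy2 := hy2)) => //; rewrite ?liftK //.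
    by apply: linked_trans l; exact/linked_sym/linked_lift.
  by apply: linked_trans l2; exact/linked_sym/linked_lift.
move=> x; have [hx|hx] := pselect (x.2 i); last first.
  rewrite (_ : [set _ | _] = set0) //; apply/seteqP; split=> z //= [].
  by move=> /linkedl.
apply: (@sub_finite_set _ _ (lift_idx hx @` [set z | exists y : idx aleph (up i), a z y != 0])).
  move=> z [l [y /entryM_neq0[w [azw _]]]].
  have l' := psi_linked azw; exists (restr (linkedr l)); last exact: restrK.
  by exists (restr (linkedr l')); rewrite -psiE.
exact: finite_image.
Qed.

Lemma psi_mul_gt i j (a : CFM K (idx aleph (up i)))
    (b : CFM K (idx aleph (up j))) : (i <= j)%O -> FR a ->
  exists2 c : CFM K (idx aleph (up i)), FR c & psi b * psi a = psi c.
Proof.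
move=> ij fa; apply: psi_image.
- move=> x y /entryM_neq0[z [/psi_linked l /psi_linked l']].
  apply: (linked_trans _ l'); apply: linked_sym.
  by apply: linked_down ij (linkedl l') (linked_sym l).
- move=> x y x2 y2 hx hy hx2 hy2 l l2 ex ey; rewrite !entryM.
  have nl x' y' (h' : x'.2 i) z : ~ linked i x' z -> psi b x' z * psi a z y' = 0.
    move=> h; have [->|/psi_linked lb] := eqVneq (psi b x' z) 0.
      by rewrite mul0r.
    by case: h; exact: linked_down ij h' lb.
  rewrite (sum_linked hx); last by move=> z; exact: nl.
  rewrite (sum_linked hx2); last by move=> z; exact: nl.
  apply: eq_fsbigr => z _; congr (_ * _).
    apply: (psi_transfer b (hx := hx) (hy := lift_mem hx z)
      (hx2 := hx2) (hy2 := lift_mem hx2 z)) => //; rewrite ?liftK //;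
    exact: linked_lift.
  rewrite (psiE a (lift_mem hx z) hy); last first.
    by apply: linked_trans l; exact/linked_sym/linked_lift.
  rewrite (psiE a (lift_mem hx2 z) hy2); last first.
    by apply: linked_trans l2; exact/linked_sym/linked_lift.
  by rewrite !liftK ey.
move=> x; have [hx|hx] := pselect (x.2 i); last first.
  rewrite (_ : [set _ | _] = set0) //; apply/seteqP; split=> z //= [].
  by move=> /linkedl.
apply: (@sub_finite_set _ _ (\bigcup_(w in [set w | exists y : idx aleph (up i), a w y != 0])
    [set z | psi b z (lift_idx hx w) != 0])).
  move=> z [l [y /entryM_neq0[w [bzw awy]]]].
  have l' := psi_linked awy.
  have lw : linked i x w.
    by apply: (linked_trans l); exact: linked_down ij (linkedr l) (psi_linked bzw).
  exists (restr (linkedr lw)); last by rewrite /= restrK.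
  exists (restr (linkedr l')).
  rewrite (_ : restr _ = restr (linkedl l')) -?psiE //.
  by apply/restr_eq.
by apply: bigcup_finite => // w _; exact: CFM_finite.
Qed.

Definition Hset i : set Q :=
  if `[< maximal_element i >]
  then [set c *: psi (1 : CFM K (idx aleph (up i))) | c in [set: K]]
  else [set psi a | a in (FR : set (CFM K (idx aleph (up i))))].

Lemma Hset_psi i m : Hset i m -> exists a : CFM K (idx aleph (up i)), m = psi a.
Proof.
rewrite /Hset; case: asboolP => _ [a _ <-]; last by exists a.
by exists (a *: (1 : CFM K (idx aleph (up i)))); rewrite linearZ.
Qed.

Lemma Hset0 i : Hset i 0.
Proof.
rewrite /Hset; case: asboolP => _; first by exists 0 => //; rewrite scale0r.
exists 0; last by rewrite linear0.
rewrite /FR /= (_ : [set _ | _] = set0) //; apply/seteqP; split=> x //=.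
by move=> [y]; rewrite entry0 eqxx.
Qed.

Lemma HsetN i m : Hset i m -> Hset i (- m).
Proof.
rewrite /Hset; case: asboolP => _ [a ha <-].
  by exists (- a) => //; rewrite scaleNr.
exists (- a); last by rewrite linearN.
apply: sub_finite_set ha => x [y]; rewrite entryN oppr_eq0 => axy.
by exists y.
Qed.

Lemma HsetM i j m n : Hset i m -> Hset j n -> exists k, Hset k (m * n).
Proof.
have [<-{j}|ij] := eqVneq i j.
  move=> hm hn; exists i; move: hm hn; rewrite /Hset.
  case: asboolP => _ [a ha <-] [b hb <-].
    exists (a * b) => //; apply: CFM_ext => x y.
    rewrite entryZ entryM (eq_fsbigr (fun z =>
      a * b * (psi (1 : CFM K (idx aleph (up i))) x z *
        psi (1 : CFM K (idx aleph (up i))) z y))); last first.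
      by move=> z _; rewrite !entryZ mulrACA.
    by rewrite -mulr_fsumr -entryM -psiM mulr1.
  exists (a * b); last exact: psiM.
  by apply: sub_finite_set ha => x [y /entryM_neq0[z [az _]]]; exists z.
move=> hm hn; have [a ea] := Hset_psi hm; have [b eb] := Hset_psi hn.
have [lij|nlij] := boolP (i <= j)%O.
  exists i; move: hm; rewrite /Hset; case: asboolP => [mi|_ [c fc <-]].
    by move: ij; rewrite (mi _ lij) eqxx.
  by rewrite eb; have [e fe ->] := psi_mul_lt b lij fc; exists e.
have [lji|nlji] := boolP (j <= i)%O.
  exists j; move: hn; rewrite /Hset; case: asboolP => [mj|_ [c fc <-]].
    by move: ij; rewrite (mj _ lji) eqxx.
  by rewrite ea; have [e fe ->] := psi_mul_gt a lji fc; exists e.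
exists i; suff -> : m * n = 0 by exact: Hset0.
apply: CFM_ext => x y; rewrite entry0; apply/eqP/negP => /negP.
move=> /entryM_neq0[z []]; rewrite ea eb => /psi_linked/linkedr zi.
move=> /psi_linked/linkedl zj.
have [] := maxchain_chain zi zj; first exact/negP.
exact/negP.
Qed.

Definition Bset : set Q :=
  [set m | exists s : seq Q,
     (forall b, b \in s -> exists i, Hset i b) /\ m = \sum_(b <- s) b].

Lemma Hset_Bset i m : Hset i m -> Bset m.
Proof.
move=> h; exists [:: m]; rewrite big_seq1; split=> // b.
by rewrite inE => /eqP ->; exists i.
Qed.

Lemma Bset0 : Bset 0.
Proof. by exists [::]; rewrite big_nil. Qed.

Lemma BsetB m n : Bset m -> Bset n -> Bset (m - n).
Proof.
move=> [s [hs ->]] [t [ht ->]]; exists (s ++ map -%R t); split.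
  move=> b; rewrite mem_cat => /orP[/hs//|/mapP[c /ht[i hi] ->]].
  by exists i; exact: HsetN.
by rewrite big_cat big_map sumrN.
Qed.

Lemma BsetM m n : Bset m -> Bset n -> Bset (m * n).
Proof.
move=> [s [hs ->]] [t [ht ->]]; exists [seq b * c | b <- s, c <- t]; split.
  by move=> _ /allpairsP[[b c] /= [/hs[i hi] /ht[j hj] ->]]; exact: HsetM hi hj.
rewrite big_allpairs_dep mulr_suml; apply: eq_bigr => b _.
by rewrite mulr_sumr.
Qed.

Hypothesis cof : has_finite_cofinal_subset I.

Lemma maximal_finite : finite_set [set i : I | maximal_element i].
Proof.
have [F [fF cF]] := cof; apply: sub_finite_set fF => i mi.
by have [j Fj /mi <-] := cF i.
Qed.

Lemma maxchain_maximal (A : maxchain I) i : A i ->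
  exists2 j, A j & maximal_element j.
Proof.
move=> Ai; have [F [/finite_seqP[s ->] cF]] := cof.
suff [j Aj Amax] : exists2 j, A j & forall k, A k -> (k <= j)%O.
  exists j => // k jk; apply/eqP; rewrite eq_le jk andbT.
  apply: (Amax); apply: maxchain_mem => a /Amax aj; left.
  exact: le_trans jk.
suff [[k Ak hk]|//] : (exists2 k, A k & forall j, j \in s -> ~ (k <= j)%O) \/
    (exists2 j, A j & forall k, A k -> (k <= j)%O).
  by have [j /= js kj] := cF k; case: (hk j js).
clear cF.
elim: s => [|j s [[k Ak hk]|]]; [by left; exists i| |by right].
have [kj|kj] := boolP (k <= j)%O; last first.
  left; exists k => // l; rewrite inE => /orP[/eqP ->|/hk //].
  exact/negP.
have [[l Al lj]|nl] := pselect (exists2 l, A l & ~ (l <= j)%O).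
  left; have [kl|lk] := maxchain_chain Ak Al; last first.
    by case: lj; exact: le_trans lk kj.
  exists l => // r; rewrite inE => /orP[/eqP -> //|/hk kr lr].
  by apply: kr; exact: le_trans kl lr.
have bj l : A l -> (l <= j)%O.
  by move=> Al; apply: contrapT => lj; apply: nl; exists l.
right; exists j => //; apply: maxchain_mem => a /bj; by left.
Qed.

Lemma Bset1 : [set: I] !=set0 -> Bset 1.
Proof.
move=> [i0 _]; have /finite_seqP[s' es'] := maximal_finite.
pose s := undup s'; have us : uniq s by exact: undup_uniq.
have es i : (i \in s) = `[< maximal_element i >].
  rewrite mem_undup; apply/idP/asboolP => [h|h].
    by suff : [set i : I | maximal_element i] i by []; rewrite es'.
  by suff : [set` s'] i by []; rewrite -es'.
pose p i : Q := psi (1 : CFM K (idx aleph (up i))).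
exists (map p s); split.
  move=> _ /mapP[i + ->]; rewrite es => /asboolP mi; exists i.
  by rewrite /Hset asboolT //; exists 1; rewrite // scale1r.
rewrite big_map; apply: CFM_ext => x y.
have -> : (\sum_(i <- s) p i : Q) x y = \sum_(i <- s) p i x y.
  by apply: (big_ind2 (fun (m : Q) v => m x y = v)) => // m v n w <- <-.
rewrite entry1; under eq_bigr do rewrite psi1.
case: eqP => [_|_] /=; last by rewrite big1.
have [j xj mj] : exists2 j, x.2 j & maximal_element j.
  suff [i xi] : exists i, x.2 i by exact: maxchain_maximal xi.
  apply/not_existsP => h; apply: (h i0); apply: maxchain_mem => a /h [].
rewrite (bigD1_seq j) //= ?es ?asboolT // big1_seq ?addr0 // => i.
case/andP => ij; rewrite es => /asboolP mi; case: asboolP => // xi.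
have [/mi e|/mj e] := maxchain_chain xi xj; by rewrite e eqxx in ij.
Qed.

End Psi.

Arguments Hset {d0} aleph K {d I} i.

Section Balg.
Variables (d0 : Order.disp_t) (aleph : bOrderType d0) (K : fieldType).
Variables (d : Order.disp_t) (I : porderType d).
Hypothesis cof : has_finite_cofinal_subset I.

Notation Q := (CFM K (idx aleph I)).

Definition Bpred : {pred Q} := [pred m : Q | `[< Bset m >]].

Lemma Bpred_zmod_closed : zmod_closed Bpred.
Proof.
split; first by apply/asboolP; exact: Bset0.
by move=> m n /asboolP hm /asboolP hn; apply/asboolP; exact: BsetB.
Qed.

HB.instance Definition _ := GRing.isZmodClosed.Build Q Bpred Bpred_zmod_closed.

(* The ring B(I).  Its identity is that of Q(I) as soon as I is nonempty; when I
   is empty, B(I) is the zero ring whereas Q(I) is K. *)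
Definition Balg of has_finite_cofinal_subset I := {m : Q | m \in Bpred}.

HB.instance Definition _ := SubChoice.on (Balg cof).
HB.instance Definition _ := [SubChoice_isSubZmodule of Balg cof by <:].

Definition mulB (a b : Balg cof) : Balg cof :=
  exist _ (val a * val b : Q)
    (asboolT (BsetM (asboolW (valP a)) (asboolW (valP b)))).

Lemma oneB_subproof :
  (if `[< [set: I] !=set0 >] then 1 else 0 : Q) \in Bpred.
Proof.
apply/asboolP; case: asboolP => h; [exact: Bset1|exact: Bset0].
Qed.

Definition oneB : Balg cof :=
  exist _ (if `[< [set: I] !=set0 >] then 1 else 0 : Q) oneB_subproof.

Lemma oneB_empty (a : Balg cof) : ~ ([set: I] !=set0) -> val a = 0.
Proof.
move=> h; have /asboolP[s [hs ->]] := valP a.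
rewrite big_seq big1 // => b /hs[i _]; case: h; by exists i.
Qed.

Let mulA : associative mulB.
Proof. by move=> a b c; apply: val_inj; exact: mulrA. Qed.
Let mul1 : left_id oneB mulB.
Proof.
move=> a; apply: val_inj => /=; case: asboolP => h; first exact: mul1r.
by rewrite (oneB_empty _ h) mul0r.
Qed.
Let mulr1 : right_id oneB mulB.
Proof.
move=> a; apply: val_inj => /=; case: asboolP => h; first exact: GRing.mulr1.
by rewrite (oneB_empty _ h) mulr0.
Qed.
Let mulDl : left_distributive mulB +%R.
Proof. by move=> a b c; apply: val_inj; exact: mulrDl. Qed.
Let mulDr : right_distributive mulB +%R.
Proof. by move=> a b c; apply: val_inj; exact: mulrDr. Qed.

HB.instance Definition _ :=
  GRing.Zmodule_isPzRing.Build (Balg cof) mulA mul1 mulr1 mulDl mulDr.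

Lemma primitive_idempotent_Balg i (e : Balg cof) :
  primitive_idempotent_in (Hset aleph K i) (val e) -> idempotent e.
Proof. by case=> _ ee _ _; exact: val_inj. Qed.

End Balg.
Arguments Balg {d0} aleph K {d I} _.

(* Main.v *)
From HB Require Import structures.
Require Import Defs.
From mathcomp Require Import all_boot all_order all_algebra.
From mathcomp Require Import freeg.
From mathcomp Require Import all_classical.

Import Order.TTheory GRing.Theory Num.Theory.

Local Open Scope classical_set_scope.
Local Open Scope ring_scope.

(* A right module over B(I) is a left module over the converse ring, and every
   finitely generated projective one is the image of an idempotent matrix E.
   The parts of E on the layers H(I,i) with i in an upper set U of I again form an
   idempotent matrix, because the sum of those layers is a subring isomorphic to
   the quotient of B(I) by the sum of the other ones.

   - Dropping a minimal layer i changes E by a matrix factoring through finitely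
     many copies of a rank one idempotent w_i of H(I,i), hence changes its class by
     an integer multiple of [w_i]: the classes [w_i] generate K_0.
   - One-sided inverse matrices over B(I) are two-sided: on a maximal layer where
     they fail to be, they are finite rank perturbations of invertible matrices.
     This allows one to cancel modulo the layers not above i, so that a class with
     a negative coefficient at a maximal element i of its support is not that of a
     module.  Applied to x and -x this also gives linear independence.
   - If k < m, an idempotent whose part on the layer m is nonzero does not
     annihilate H(I,k), so that it contains a copy of w_k; the copies can be split
     off w_m one after the other, the smallest indices coming last.  Hence every
     element of the cone is the class of a module. *)

Set Implicit Arguments.
Unset Strict Implicit.
Unset Printing Implicit Defensive.

(** * Idempotent matrices and K_0 *)

Section LinearOf.
Variables (S : pzRingType) (M N : lmodType S) (f : M -> N).

Lemma linear_of : linear f -> exists g : {linear M -> N}, forall x, g x = f x.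
Proof.
move=> lf; pose g : {linear M -> N} :=
  HB.pack f (GRing.isLinear.Build _ _ _ _ f lf).
by exists g.
Qed.

End LinearOf.

Section RowImage.
Variables (S : pzRingType) (n : nat) (E : 'M[S]_n).

(** For idempotent [E] the fixed vectors are the image of [v |-> v *m E]; as solutions of a linear
    equation they form a submodule. *)
Definition row_image_pred : {pred 'rV[S]_n} := [pred v | v *m E == v].

Lemma row_image_submod_closed : submod_closed row_image_pred.
Proof.
split=> [|a u v /eqP hu /eqP hv]; first by rewrite inE mul0mx.
by rewrite inE mulmxDl -scalemxAl hu hv.
Qed.

HB.instance Definition _ :=
  GRing.isSubmodClosed.Build _ _ row_image_pred row_image_submod_closed.

Definition row_image := {v : 'rV[S]_n | v \in row_image_pred}.

HB.instance Definition _ := SubChoice.on row_image.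
HB.instance Definition _ := [SubChoice_isSubLmodule of row_image by <:].

Lemma row_imageE (v : row_image) : val v *m E = val v.
Proof. exact/eqP/(valP v). Qed.

Hypothesis EE : E *m E = E.

Lemma row_image_mem (v : 'rV[S]_n) : v *m E \in row_image_pred.
Proof. by rewrite inE -mulmxA EE. Qed.

Definition row_image_proj (v : 'rV[S]_n) : row_image :=
  exist _ (v *m E) (row_image_mem v).

Lemma row_image_proj_linear : linear row_image_proj.
Proof. by move=> a u v; apply: val_inj; rewrite /= mulmxDl -scalemxAl. Qed.

Lemma row_image_projK (v : row_image) : row_image_proj (val v) = v.
Proof. by apply: val_inj; rewrite /= row_imageE. Qed.

Lemma row_image_sum (v : row_image) :
  v = \sum_i (val v) 0 i *: row_image_proj (delta_mx 0 i).
Proof.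
have [p pE] := linear_of row_image_proj_linear.
rewrite -{1}[v]row_image_projK -pE [X in p X]row_sum_delta linear_sum.
by apply: eq_bigr => i _; rewrite linearZ pE.
Qed.

Lemma row_image_fg : finitely_generated row_image.
Proof.
exists n, (fun i => row_image_proj (delta_mx 0 i)) => v.
by exists (val v 0); exact: row_image_sum.
Qed.

(** The values of [f] at the generators [e_i *m E] are lifted one by one to [m i]. The map
    [v |-> \sum_i v_i *: m i] lifts [f], because a fixed vector [v] equals
    [\sum_i v_i *: (e_i *m E)]. *)
Lemma row_image_projective : projective row_image.
Proof.
move=> N L g f gs.
have /choice[m hm] i : exists x, g x = f (row_image_proj (delta_mx 0 i)).
  exact: gs.
have l : linear (fun v : row_image => \sum_i (val v) 0 i *: m i).
  move=> a u v; rewrite scaler_sumr -big_split; apply: eq_bigr => i _ /=.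
  by rewrite !mxE scalerDl scalerA.
have [h hE] := linear_of l; exists h => v.
rewrite hE [in RHS](row_image_sum v) !linear_sum; apply: eq_bigr => i _.
by rewrite !linearZ hm.
Qed.

End RowImage.

Section IdempotentMatrices.
Variable R : pzRingType.
Notation S := R^c.

Definition mxproj n (E : 'M[S]_n) (EE : E *m E = E) : fgproj R :=
  FGProj (row_image_fg EE) (row_image_projective EE).

Lemma K0class_iso (A B : fgproj R) : isomorphic A B -> K0class A = K0class B.
Proof. by rewrite /K0class => /VclassP ->. Qed.

(** Projectivity, applied to the identity of [A], splits a surjection from a free module. *)
Lemma fgproj_split (A : fgproj R) : exists n (p : {linear 'rV[S]_n -> A})
  (s : {linear A -> 'rV[S]_n}), forall x, p (s x) = x.
Proof.
have [n [g gP]] := fgproj_fg A.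
have l : linear (fun v : 'rV[S]_n => \sum_i v 0 i *: g i).
  move=> a u v; rewrite scaler_sumr -big_split; apply: eq_bigr => i _ /=.
  by rewrite !mxE scalerDl scalerA.
have [p pE] := linear_of l.
have ps y : exists v, p v = y.
  have [c ->] := gP y; exists (\row_i c i); rewrite pE.
  by apply: eq_bigr => i _; rewrite mxE.
have [s sP] := @fgproj_projective _ A _ _ p idfun ps.
by exists n, p, s.
Qed.

(** [E] is the matrix of [s \o p], which is idempotent since [p \o s] is the identity; [s]
    identifies [A] with its image. *)
Lemma fgproj_mx (A : fgproj R) : exists n (E : 'M[S]_n) (EE : E *m E = E),
  K0class A = K0class (mxproj EE).
Proof.
have [n [p [s ps]]] := fgproj_split A.
have EE' (v : 'rV_n) : v *m lin1_mx (s \o p) = s (p v).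
  by rewrite (mul_rV_lin1 (s \o p)).
have EE : lin1_mx (s \o p) *m lin1_mx (s \o p) = lin1_mx (s \o p).
  by apply/row_matrixP => i; rewrite row_mul !rowE !EE' ps.
exists n, _, EE; apply: K0class_iso.
have sI x : s x \in row_image_pred (lin1_mx (s \o p)).
  by rewrite inE EE' ps.
apply: (@isomorphicI _ A (row_image (lin1_mx (s \o p)))
  (fun x => exist _ (s x) (sI x)) (fun v => p (val v))).
- by move=> a x y; apply: val_inj; rewrite /= linearP.
- by move=> x /=; rewrite ps.
- by move=> v; apply: val_inj; rewrite /= -EE' row_imageE.
Qed.

(** Equivalent idempotents have isomorphic images: on these, right multiplications by [X] and by [Y]
    are inverse to each other. *)
Lemma mxproj_equiv n m (E : 'M[S]_n) (F : 'M[S]_m)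
    (EE : E *m E = E) (FF : F *m F = F) (X : 'M[S]_(n, m)) (Y : 'M[S]_(m, n)) :
  X *m Y = E -> Y *m X = F -> K0class (mxproj EE) = K0class (mxproj FF).
Proof.
move=> XY YX; apply: K0class_iso.
have hX (v : row_image E) : val v *m X \in row_image_pred F.
  by rewrite inE -YX -!mulmxA (mulmxA X) XY mulmxA row_imageE.
have hY (v : row_image F) : val v *m Y \in row_image_pred E.
  by rewrite inE -XY -!mulmxA (mulmxA Y) YX mulmxA row_imageE.
pose gX v : row_image F := exist _ (val v *m X) (hX v).
pose gY v : row_image E := exist _ (val v *m Y) (hY v).
apply: (@isomorphicI _ (row_image E) (row_image F) gX gY).
- by move=> a u v; apply: val_inj; rewrite /= mulmxDl -scalemxAl.
- by move=> v; apply: val_inj; rewrite /= -mulmxA XY row_imageE.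
- by move=> v; apply: val_inj; rewrite /= -mulmxA YX row_imageE.
Qed.

Lemma idem_block n m (E : 'M[S]_n) (F : 'M[S]_m) : E *m E = E -> F *m F = F ->
  block_mx E 0 0 F *m block_mx E 0 0 F = block_mx E 0 0 F.
Proof.
by move=> EE FF; rewrite mulmx_block EE FF !mulmx0 !mul0mx !addr0 !add0r.
Qed.

Lemma mxproj_block n m (E : 'M[S]_n) (F : 'M[S]_m)
    (EE : E *m E = E) (FF : F *m F = F)
    (GG : block_mx E 0 0 F *m block_mx E 0 0 F = block_mx E 0 0 F) :
  K0class (mxproj GG) = K0class (mxproj EE) + K0class (mxproj FF).
Proof.
rewrite -K0classD; apply: K0class_iso.
have h1 (v : row_image (block_mx E 0 0 F)) :
    lsubmx (val v) \in row_image_pred E.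
  have := row_imageE v; rewrite -{1 2}[val v]hsubmxK mul_row_block !mulmx0.
  by rewrite addr0 add0r => /eq_row_mx[e1 _]; rewrite inE e1.
have h2 (v : row_image (block_mx E 0 0 F)) :
    rsubmx (val v) \in row_image_pred F.
  have := row_imageE v; rewrite -{1 2}[val v]hsubmxK mul_row_block !mulmx0.
  by rewrite addr0 add0r => /eq_row_mx[_ e2]; rewrite inE e2.
have h3 (v : row_image E * row_image F) :
    row_mx (val v.1) (val v.2) \in row_image_pred (block_mx E 0 0 F).
  by rewrite inE mul_row_block !mulmx0 addr0 add0r !row_imageE.
apply: (@isomorphicI _ (row_image (block_mx E 0 0 F))
  (row_image E * row_image F)%type
  (fun v => (exist _ (lsubmx (val v)) (h1 v), exist _ (rsubmx (val v)) (h2 v)))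
  (fun v => exist _ (row_mx (val v.1) (val v.2)) (h3 v))).
- by move=> a u v; congr pair; apply: val_inj;
    rewrite /= ?linearP.
- by move=> v; apply: val_inj; rewrite /= hsubmxK.
- by move=> [u v]; congr pair; apply: val_inj; rewrite /= ?row_mxKl ?row_mxKr.
Qed.

(** The row and the column with blocks [E] and [F] make [E + F] equivalent to a block diagonal
    matrix; orthogonality kills the off-diagonal blocks. *)
Lemma mxproj_orthogonal n (E F : 'M[S]_n) (EE : E *m E = E) (FF : F *m F = F)
    (GG : (E + F) *m (E + F) = E + F) : E *m F = 0 -> F *m E = 0 ->
  K0class (mxproj GG) = K0class (mxproj EE) + K0class (mxproj FF).
Proof.
move=> EF FE; rewrite -(mxproj_block EE FF (idem_block EE FF)).
apply: (@mxproj_equiv _ _ _ _ _ _ (row_mx E F) (col_mx E F)).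
  by rewrite mul_row_col EE FF.
by rewrite mul_col_row EE FF EF FE.
Qed.

Lemma mxproj0 n (ZZ : (0 : 'M[S]_n) *m 0 = 0) : K0class (mxproj ZZ) = 0.
Proof.
(* The class [z] of the zero module satisfies [z + z = z]. *)
have e0 : K0class (fgproj0 R) = 0.
  have := K0classD (fgproj0 R) (fgproj0 R).
  have -> : K0class (dsum (fgproj0 R) (fgproj0 R)) = K0class (fgproj0 R).
    by apply: K0class_iso; exact: isomorphic_prod0.
  move/eqP.
  by rewrite eq_sym -subr_eq0 addrK => /eqP.
rewrite -e0; apply: K0class_iso.
have v0 (v : row_image (0 : 'M[S]_n)) : v = 0.
  by apply: val_inj; rewrite /= -[LHS](row_imageE v) mulmx0.
apply: (@isomorphicI _ (row_image (0 : 'M[S]_n)) 'rV[S]_0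
  (fun _ => 0) (fun _ => 0)).
- by move=> a u v; rewrite scaler0 addr0.
- by move=> v; rewrite [RHS]v0.
- by move=> v; apply/rowP => -[].
Qed.

(** Products in [R^c] are reversed products in [R], so a one by one row is fixed by [e] iff its
    entry [x] satisfies [e x = x] in [R], that is, lies in [e R]. *)
Lemma mxproj_right_ideal (e : R) (ee : Defs.idempotent e)
    (EE : ((e : S)%:M : 'M[S]_1) *m (e : S)%:M = (e : S)%:M) :
  K0class (fgproj_right_ideal ee) = K0class (mxproj EE).
Proof.
apply: K0class_iso.
have h1 (v : right_ideal e) :
    ((val v : S)%:M : 'rV_1) \in row_image_pred ((e : S)%:M : 'M[S]_1).
  have /asboolP[b eb] := valP v.
  rewrite inE -scalar_mxM; apply/eqP; congr (_%:M).
  by rewrite -[LHS]/((e : R) * (val v : R)) /= eb mulrA ee.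
have h2 (v : row_image ((e : S)%:M : 'M[S]_1)) :
    (val v 0 0 : (R^c)^o) \in right_ideal_pred e.
  apply/asboolP; exists (val v 0 0); have := row_imageE v.
  by move/matrixP/(_ 0 0); rewrite !mxE big_ord1 mxE eqxx mulr1n => {1}<-.
apply: (@isomorphicI _ (right_ideal e) (row_image ((e : S)%:M : 'M[S]_1))
  (fun v => exist _ ((val v : S)%:M) (h1 v))
  (fun v => exist _ (val v 0 0 : (R^c)^o) (h2 v))).
- move=> a u v; apply: val_inj; rewrite /=.
  by apply/matrixP => i j; rewrite !mxE !ord1 !mulr1n.
- by move=> v; apply: val_inj; rewrite /= mxE eqxx mulr1n.
- by move=> v; apply: val_inj; rewrite /= -mx11_scalar.
Qed.

End IdempotentMatrices.

(** * Stratified rings *)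

(* A ring S which is, like B(I), the direct sum of layers H(i): part i is the
   projection onto H(i), and scal i c is c times an idempotent w i := scal i 1 of
   H(i) with w i * H(i) * w i = K w i and H(i) = H(i) * w i * H(i). *)
Record stratification (S : pzRingType) (K : fieldType)
    (d : Order.disp_t) (I : porderType d) := Stratification {
  part : I -> S -> S;
  scal : I -> K -> S;
  partB : forall i, {morph part i : a b / a - b};
  part_part : forall i j a, part i (part j a) = if i == j then part j a else 0;
  part_ext : forall a, (forall i, part i a = 0) -> a = 0;
  part_finite : forall a, exists s : seq I, forall i, part i a != 0 -> i \in s;
  part_mul_le : forall i j a b, (i <= j)%O -> part i a = a -> part j b = b ->
    part i (a * b) = a * b /\ part i (b * a) = b * a;
  part_mul_incomparable : forall i j a b, ~~ (i <= j)%O -> ~~ (j <= i)%O ->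
    part i a = a -> part j b = b -> a * b = 0;
  part_scal : forall i k, part i (scal i k) = scal i k;
  scalD : forall i, {morph scal i : k l / k + l};
  scalM : forall i, {morph scal i : k l / k * l};
  scal1_neq0 : forall i, scal i 1 != 0;
  scal_corner : forall i a, part i a = a ->
    exists k, scal i 1 * a * scal i 1 = scal i k;
  part_factor : forall i a, part i a = a ->
    exists r (x y : 'I_r -> S),
      [/\ forall l, part i (x l) = x l /\ x l * scal i 1 = x l,
          forall l, part i (y l) = y l /\ scal i 1 * y l = y l &
          a = \sum_l x l * y l];
  part_left_inverse : forall i a, part i a = a -> a * scal i 1 = a -> a != 0 ->
    exists b, [/\ part i b = b, scal i 1 * b = b & b * a = scal i 1];
  part_faithful : forall i k a, (k <= i)%O -> part i a != 0 ->
    (forall j, (i < j)%O -> part j a = 0) ->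
    exists2 b, part k b = b & a * b != 0 }.

Section Stratified.
Variables (S : pzRingType) (K : fieldType).
Variables (d : Order.disp_t) (I : porderType d).
Variable str : stratification S K I.
Implicit Types (i j k : I) (a b : S).

Local Notation part := (part str).
Local Notation scal := (scal str).
Local Notation w i := (scal i 1).

Definition layer i : set S := [set a | part i a = a].

Lemma part0 i : part i 0 = 0.
Proof. by rewrite -[X in part i X](subrr 0) partB subrr. Qed.

Lemma partN i : {morph part i : a / - a}.
Proof. by move=> a; rewrite -[- a]sub0r partB part0 sub0r. Qed.

Lemma partD i : {morph part i : a b / a + b}.
Proof. by move=> a b; rewrite -{1}[b]opprK partB partN opprK. Qed.

Lemma part_sum i (T : Type) (r : seq T) (P : pred T) (F : T -> S) :
  part i (\sum_(x <- r | P x) F x) = \sum_(x <- r | P x) part i (F x).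
Proof. exact: (big_morph (part i) (partD i) (part0 i)). Qed.

Lemma part_id i a : part i (part i a) = part i a.
Proof. by rewrite part_part eqxx. Qed.

Lemma part_layer i j a : layer j a -> part i a = if i == j then a else 0.
Proof. by move=> ja; rewrite -{1}ja part_part ja. Qed.

Lemma part_inj a b : (forall i, part i a = part i b) -> a = b.
Proof.
move=> h; apply/eqP; rewrite -subr_eq0; apply/eqP/(part_ext (s := str)) => i.
by rewrite partB h subrr.
Qed.

Lemma layer0 i : layer i 0. Proof. exact: part0. Qed.

Lemma layerD i a b : layer i a -> layer i b -> layer i (a + b).
Proof. by move=> ha hb; rewrite /layer /= partD ha hb. Qed.

Lemma layerN i a : layer i a -> layer i (- a).
Proof. by move=> ha; rewrite /layer /= partN ha. Qed.

Lemma layer_sum i (T : Type) (r : seq T) (P : pred T) (F : T -> S) :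
  (forall x, P x -> layer i (F x)) -> layer i (\sum_(x <- r | P x) F x).
Proof.
move=> h; apply: big_rec; first exact: layer0.
by move=> x a /h; exact: layerD.
Qed.

Lemma layerM i a b : layer i a -> layer i b -> layer i (a * b).
Proof. by move=> ha hb; case: (part_mul_le (lexx i) ha hb). Qed.

Lemma part_seq a : exists2 s : seq I, uniq s &
  (forall i, i \notin s -> part i a = 0) /\ a = \sum_(i <- s) part i a.
Proof.
have [t tP] := part_finite str a; pose s := undup t.
have us : uniq s by exact: undup_uniq.
have s0 i : i \notin s -> part i a = 0.
  by rewrite mem_undup; apply: contraNeq => /tP.
exists s => //; split=> //; apply: part_inj => i; rewrite part_sum.
have [si|si] := boolP (i \in s); last first.
  rewrite s0 // big_seq big1 // => j js; rewrite part_part; case: eqP => // e.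
  by rewrite e js in si.
rewrite (bigD1_seq i) //= part_id big1 ?addr0 // => j ji.
by rewrite part_part eq_sym (negbTE ji).
Qed.

Lemma part_ind a (P : S -> Prop) :
  P 0 -> (forall x y, P x -> P y -> P (x + y)) ->
  (forall i, part i a != 0 -> P (part i a)) -> P a.
Proof.
move=> P0 PD Pc; have [s _ [_ ->]] := part_seq a.
apply: big_ind => // i _; have [->//|] := eqVneq (part i a) 0; exact: Pc.
Qed.

Section Upper.
Variable U : pred I.

Lemma upper_part_ex a :
  exists b, forall i, part i b = if U i then part i a else 0.
Proof.
have [s us [s0 _]] := part_seq a.
exists (\sum_(j <- s | U j) part j a) => i; rewrite part_sum.
have [si|si] := boolP (i \in s); last first.
  rewrite s0 // if_same big_seq_cond big1 // => j /andP[js _].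
  by rewrite part_part; case: eqP => // e; rewrite e js in si.
rewrite big_mkcond (bigD1_seq i) //= part_id big1 ?addr0 // => j ji.
by rewrite part_part eq_sym (negbTE ji) if_same.
Qed.

(** An element is determined by its parts, so the choice made here is the only possible one. *)
Definition upper_part a : S := projT1 (cid (upper_part_ex a)).

Lemma part_upper_part i a : part i (upper_part a) = if U i then part i a else 0.
Proof. by rewrite /upper_part; case: cid. Qed.

Lemma upper_partD : {morph upper_part : a b / a + b}.
Proof.
move=> a b; apply: part_inj => i; rewrite partD !part_upper_part partD.
by case: ifP => // _; rewrite addr0.
Qed.

Lemma upper_partN : {morph upper_part : a / - a}.
Proof.
move=> a; apply: part_inj => i; rewrite partN !part_upper_part partN.
by case: ifP => // _; rewrite oppr0.
Qed.

Lemma upper_part0 : upper_part 0 = 0.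
Proof. by apply: part_inj => i; rewrite part_upper_part part0 if_same. Qed.

Lemma upper_part_eq0 a : (forall i, U i -> part i a = 0) -> upper_part a = 0.
Proof.
move=> h; apply: part_inj => i; rewrite part_upper_part part0.
by case: ifP => // /h.
Qed.

Lemma upper_part_layer i a : layer i a -> upper_part a = if U i then a else 0.
Proof.
move=> ia; apply: part_inj => j; rewrite part_upper_part.
rewrite !(part_layer _ ia) [RHS]fun_if part0 (part_layer _ ia).
by case: (j =P i) => [->//|_]; rewrite !if_same.
Qed.

Hypothesis upU : forall i j, (i <= j)%O -> U i -> U j.

(** By additivity, [a] and [b] may be taken in layers [i] and [j]. If these are comparable, the
    product lies in the smaller layer: when [U] contains that index it contains both, otherwise both
    sides vanish. If they are incomparable, the product is zero. *)
Lemma upper_partM : {morph upper_part : a b / a * b}.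
Proof.
move=> a b; have := erefl (upper_part a * upper_part b).
apply: (@part_ind a (fun a => upper_part a * upper_part b = _ -> _)) => //.
- by rewrite !mul0r upper_part0 mul0r.
- move=> x y hx hy _; rewrite mulrDl !upper_partD mulrDl.
  by rewrite hx // hy.
move=> i _ _; have ia : layer i (part i a) by exact: part_id.
move: (part i a) ia => {}a ia.
apply: (@part_ind b
  (fun b => upper_part (a * b) = upper_part a * upper_part b)).
- by rewrite !mulr0 upper_part0 mulr0.
- by move=> x y hx hy; rewrite mulrDr !upper_partD mulrDr hx hy.
move=> j _; have jb : layer j (part j b) by exact: part_id.
move: (part j b) jb => {}b jb.
rewrite (upper_part_layer ia) (upper_part_layer jb).
have [ij|ij] := boolP (i <= j)%O.
  have [h _] := part_mul_le ij ia jb; rewrite (upper_part_layer h).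
  by case: ifP => [/(upU ij) ->//|_]; rewrite mul0r.
have [ji|ji] := boolP (j <= i)%O.
  have [_ h] := part_mul_le ji jb ia; rewrite (upper_part_layer h).
  by case: (boolP (U j)) => [/(upU ji) ->//|_]; rewrite mulr0.
rewrite (part_mul_incomparable ij ji ia jb) upper_part0.
case: ifP; case: ifP; rewrite ?mulr0 ?mul0r //.
by rewrite (part_mul_incomparable ij ji ia jb).
Qed.

End Upper.

(** The parts of [a] at indices [k >= i] keep [b] in the layer [i]; those at indices incomparable
    with [i] annihilate it. *)
Lemma layer_mull i a b : (forall k, (k < i)%O -> part k a = 0) -> layer i b ->
  layer i (a * b).
Proof.
move=> ha ib; apply: (@part_ind a (fun a => layer i (a * b))).
- by rewrite mul0r; exact: layer0.
- by move=> x y hx hy; rewrite mulrDl; exact: layerD.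
move=> k ka; have ik : ~~ (k < i)%O by apply: contraNN ka => /ha/eqP.
have [ki|ki] := boolP (i <= k)%O.
  by have [] := part_mul_le ki ib (part_id k a).
have ki' : ~~ (k <= i)%O.
  apply: contra ik => h; rewrite lt_neqAle h andbT.
  by apply: contraNneq ki => ->.
by rewrite (part_mul_incomparable ki' ki (part_id k a) ib); exact: layer0.
Qed.

Lemma layer_mulr i a b : (forall k, (k < i)%O -> part k b = 0) -> layer i a ->
  layer i (a * b).
Proof.
move=> hb ia; apply: (@part_ind b (fun b => layer i (a * b))).
- by rewrite mulr0; exact: layer0.
- by move=> x y hx hy; rewrite mulrDr; exact: layerD.
move=> k kb; have ik : ~~ (k < i)%O by apply: contraNN kb => /hb/eqP.
have [ki|ki] := boolP (i <= k)%O.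
  by have [] := part_mul_le ki ia (part_id k b).
have ki' : ~~ (k <= i)%O.
  apply: contra ik => h; rewrite lt_neqAle h andbT.
  by apply: contraNneq ki => ->.
by rewrite (part_mul_incomparable ki ki' ia (part_id k b)); exact: layer0.
Qed.

Lemma scal0 i : scal i 0 = 0.
Proof. by apply: (addrI (scal i 0)); rewrite -scalD !addr0. Qed.

Lemma scalN i : {morph scal i : x / - x}.
Proof. by move=> x; apply: (addrI (scal i x)); rewrite -scalD !subrr scal0. Qed.

Lemma scal_inj i : injective (scal i).
Proof.
move=> x y e; apply/eqP; rewrite -subr_eq0; apply/negPn/negP => xy.
have := scal1_neq0 str i; rewrite -(divff xy) scalM scalD scalN e subrr mul0r.
by rewrite eqxx.
Qed.

Lemma scal_layer i (x : K) : layer i (scal i x). Proof. exact: part_scal. Qed.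

Lemma w_idem i : w i * w i = w i. Proof. by rewrite -scalM mulr1. Qed.

Definition layer_mx i m n (A : 'M[S]_(m, n)) : Prop :=
  forall p q, layer i (A p q).

Lemma layer_mxM i m n p (A : 'M[S]_(m, n)) (B : 'M[S]_(n, p)) :
  layer_mx i A -> layer_mx i B -> layer_mx i (A *m B).
Proof.
by move=> hA hB p' q; rewrite mxE; apply: layer_sum => l _; exact: layerM.
Qed.

Lemma layer_mxD i m n (A B : 'M[S]_(m, n)) :
  layer_mx i A -> layer_mx i B -> layer_mx i (A + B).
Proof. by move=> hA hB p q; rewrite mxE; exact: layerD. Qed.

Lemma layer_mxN i m n (A : 'M[S]_(m, n)) : layer_mx i A -> layer_mx i (- A).
Proof. by move=> hA p q; rewrite mxE; exact: layerN. Qed.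

Lemma layer_mx_mull i m n p (A : 'M[S]_(m, n)) (B : 'M[S]_(n, p)) :
  (forall k, (k < i)%O -> forall p q, part k (A p q) = 0) ->
  layer_mx i B -> layer_mx i (A *m B).
Proof.
move=> hA hB p' q; rewrite mxE; apply: layer_sum => l _.
by apply: layer_mull => // k ki; exact: hA.
Qed.

Lemma layer_mx_mulr i m n p (A : 'M[S]_(m, n)) (B : 'M[S]_(n, p)) :
  (forall k, (k < i)%O -> forall p q, part k (B p q) = 0) ->
  layer_mx i A -> layer_mx i (A *m B).
Proof.
move=> hB hA p' q; rewrite mxE; apply: layer_sum => l _.
by apply: layer_mulr => // k ki; exact: hB.
Qed.

Definition scal_mx i m n (A : 'M[K]_(m, n)) : 'M[S]_(m, n) := map_mx (scal i) A.

Lemma scal_mx_layer i m n (A : 'M[K]_(m, n)) : layer_mx i (scal_mx i A).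
Proof. by move=> p q; rewrite mxE; exact: scal_layer. Qed.

Lemma scal_mxM i m n p (A : 'M[K]_(m, n)) (B : 'M[K]_(n, p)) :
  scal_mx i (A *m B) = scal_mx i A *m scal_mx i B.
Proof.
apply/matrixP => x y; rewrite !mxE (big_morph (scal i) (scalD _ _) (scal0 i)).
by apply: eq_bigr => l _; rewrite !mxE scalM.
Qed.

Lemma scal_mxD i m n (A B : 'M[K]_(m, n)) :
  scal_mx i (A + B) = scal_mx i A + scal_mx i B.
Proof. by apply/matrixP => x y; rewrite !mxE scalD. Qed.

Lemma scal_mxN i m n (A : 'M[K]_(m, n)) : scal_mx i (- A) = - scal_mx i A.
Proof. by apply/matrixP => x y; rewrite !mxE scalN. Qed.

Lemma scal_mx1 i n : scal_mx i (1%:M : 'M_n) = (w i)%:M.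
Proof.
by apply/matrixP => x y; rewrite !mxE; case: eqP => _; rewrite ?scal0 ?mulr0n.
Qed.

Lemma scal_mx_inj i m n : injective (@scal_mx i m n).
Proof.
move=> A B /matrixP e; apply/matrixP => x y.
by have := e x y; rewrite !mxE => /scal_inj.
Qed.

(** Each entry lies in the corner [w i * H(i) * w i], which is a copy of [K]. *)
Lemma layer_corner i m n (A : 'M[S]_(m, n)) : layer_mx i A ->
  (w i)%:M *m A = A -> A *m (w i)%:M = A -> exists N, A = scal_mx i N.
Proof.
move=> hA wA Aw.
have Ae x y : w i * A x y = A x y by rewrite -{2}wA mul_scalar_mx mxE.
have Ae' x y : A x y * w i = A x y.
  rewrite -{2}Aw mxE (bigD1 y) //= mxE eqxx mulr1n big1 ?addr0 // => z zy.
  by rewrite mxE (negbTE zy) mulr0n mulr0.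
have /choice[f fP] (p : 'I_m * 'I_n) : exists x, A p.1 p.2 = scal i x.
  by have [x e] := scal_corner (hA p.1 p.2); exists x; rewrite -e Ae Ae'.
by exists (\matrix_(x, y) f (x, y)); apply/matrixP => x y; rewrite !mxE -fP.
Qed.

(** Factorizations of two matrices combine into one of their sum by juxtaposing blocks, which
    reduces the claim to matrices with one nonzero entry, that is, to [part_factor]. *)
Lemma layer_mx_factor i m n (A : 'M[S]_(m, n)) : layer_mx i A ->
  exists r (al : 'M_(m, r)) (be : 'M_(r, n)),
    [/\ layer_mx i al, layer_mx i be, al *m (w i)%:M = al,
        (w i)%:M *m be = be & A = al *m be].
Proof.
move=> hA; rewrite [A]matrix_sum_delta.
pose P (A : 'M[S]_(m, n)) := exists r (al : 'M_(m, r)) (be : 'M_(r, n)),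
  [/\ layer_mx i al, layer_mx i be, al *m (w i)%:M = al,
      (w i)%:M *m be = be & A = al *m be].
have P0 : P 0.
  exists 0%N, 0, 0; split; rewrite ?mul0mx ?mulmx0 //.
  - by move=> ? [].
  - by move=> [].
have PD B C : P B -> P C -> P (B + C).
  move=> [r [al [be [h1 h2 h3 h4 ->]]]] [r' [al' [be' [h1' h2' h3' h4' ->]]]].
  exists (r + r')%N, (row_mx al al'), (col_mx be be'); split.
  - by move=> x y; rewrite mxE; case: fintype.split.
  - by move=> x y; rewrite mxE; case: fintype.split.
  - by rewrite scalar_mx_block mul_row_block !mulmx0 addr0 add0r h3 h3'.
  - by rewrite scalar_mx_block mul_block_col !mul0mx addr0 add0r h4 h4'.
  - by rewrite mul_row_col.
apply: (big_ind P) => // p _; apply: (big_ind P) => // q _.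
have [r [x [y [hx hy ->]]]] := part_factor (hA p q).
(* The entry in position [(p, q)] is [\sum_l x l * y l]: the left factor lives in row [p], the right
   one in column [q]. *)
exists r, (\matrix_(s, l) if s == p then x l else 0),
  (\matrix_(l, t) if t == q then y l else 0); split.
- by move=> s l; rewrite mxE; case: eqP => _; [case: (hx l)|exact: layer0].
- by move=> l t; rewrite mxE; case: eqP => _; [case: (hy l)|exact: layer0].
- apply/matrixP => s l; rewrite mxE (bigD1 l) //= big1 => [|z zl]; last first.
    by rewrite !mxE (negbTE zl) mulr0n mulr0.
  rewrite !mxE eqxx mulr1n addr0; case: eqP => _; last by rewrite mul0r.
  by case: (hx l).
- rewrite mul_scalar_mx; apply/matrixP => l t; rewrite !mxE.
  by case: eqP => _; [case: (hy l)|rewrite mulr0].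
apply/matrixP => s t; rewrite !mxE.
have [sp|/negbTE sp] := eqVneq s p; last first.
  by rewrite mulr0 big1 // => l _; rewrite !mxE sp mul0r.
have [tq|/negbTE tq] := eqVneq t q; last first.
  by rewrite mulr0 big1 // => l _; rewrite !mxE tq mulr0.
by rewrite mulr1; apply: eq_bigr => l _; rewrite !mxE sp tq !eqxx.
Qed.

End Stratified.

Section ExtremalElements.
Variables (d : Order.disp_t) (I : porderType d).

Lemma exists_maximal (P : I -> Prop) (s : seq I) i : P i ->
  (forall j, P j -> j \in s) -> exists2 j, (i <= j)%O /\ P j &
    forall k, (j < k)%O -> ~ P k.
Proof.
elim: s P i => [|x s IH] P i Pi Ps; first by have := Ps _ Pi.
have [[ix Px]|nx] := pselect ((i <= x)%O /\ P x).
  have [[k xk Pk]|nk] := pselect (exists2 k, (x < k)%O & P k); last first.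
    by exists x => // k xk Pk; apply: nk; exists k.
  have [||j [kj [xj Pj]] jm] := IH (fun j => (x < j)%O /\ P j) k.
  - by [].
  - move=> j [xj /Ps]; rewrite inE => /orP[/eqP e|//].
    by rewrite e ltxx in xj.
  exists j; first by split=> //; apply: le_trans ix (ltW xj).
  by move=> l jl Pl; apply: (jm l jl); split=> //; exact: lt_trans jl.
have [||j [ij [ij' Pj]] jm] := IH (fun j => (i <= j)%O /\ P j) i.
- by [].
- move=> j [ij Pj]; have := Ps j Pj; rewrite inE => /orP[/eqP e|//].
  by case: nx; rewrite -e.
exists j => // l jl Pl; apply: (jm l jl); split=> //.
exact: le_trans ij (ltW jl).
Qed.

End ExtremalElements.

Lemma exists_minimal (d : Order.disp_t) (I : porderType d) (P : I -> Prop)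
    (s : seq I) i : P i -> (forall j, P j -> j \in s) ->
  exists2 j, (j <= i)%O /\ P j & forall k, (k < j)%O -> ~ P k.
Proof. exact: (@exists_maximal _ I^d). Qed.

(** * Direct finiteness of matrix rings over a stratified ring *)

Section DirectlyFinite.
Variables (S : pzRingType) (K : fieldType).
Variables (d : Order.disp_t) (I : porderType d).
Variable str : stratification S K I.
Implicit Types (i j k : I) (a b : S).

Local Notation part := (part str).
Local Notation layer_mx := (layer_mx str).
Local Notation scal_mx := (scal_mx str).
Local Notation w i := (scal str i 1).

(* With h = al *m be, one-sided inverses of 1 + al *m be and of 1 + be *m al
   correspond to each other, and the latter is a matrix over K. *)
Lemma layer_mx_unitC i n (h h' : 'M[S]_n) : layer_mx i h -> layer_mx i h' ->
  (1%:M + h) *m (1%:M + h') = 1%:M -> (1%:M + h') *m (1%:M + h) = 1%:M.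
Proof.
move=> ih ih' e; set z := 1%:M + h' in e *.
have [r [al [be [ial ibe alw wbe hE]]]] := layer_mx_factor ih.
set W := (w i)%:M in alw wbe.
have WW : W *m W = W by rewrite -scalar_mxM w_idem.
have [N NE] : exists N, be *m al = scal_mx i N.
  apply: layer_corner; first exact: layer_mxM.
    by rewrite mulmxA wbe.
  by rewrite -mulmxA alw.
have [Z ZE] : exists Z, be *m z *m al = scal_mx i Z.
  apply: layer_corner.
  - rewrite mulmxDr mulmx1 mulmxDl; apply: layer_mxD; first exact: layer_mxM.
    by apply: layer_mxM => //; exact: layer_mxM.
  - by rewrite !mulmxA wbe.
  - by rewrite -!mulmxA alw.
(* If [(1 + al be) z = 1] then [(1 + be al) (1 - be z al) = 1]; here this is read in the corner,
   where the identity is [W]. Over the field [K] the inverse is then two-sided. *)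
have NZ : (1%:M + N) *m (1%:M - Z) = 1%:M.
  apply: (@scal_mx_inj _ _ _ _ str i).
  rewrite scal_mxM !scal_mxD scal_mxN scal_mx1 -/W -NE -ZE.
  have -> : (W + be *m al) *m (W - be *m z *m al) =
      W + be *m al - be *m ((1%:M + h) *m z) *m al.
    rewrite mulmxBr !mulmxDl WW mul1mx mulmxDr mulmxDl -(mulmxA be al W) alw.
    by rewrite hE !mulmxA wbe.
  by rewrite e mulmx1 addrK.
have ZN := mulmx1C NZ.
have : scal_mx i ((1%:M - Z) *m (1%:M + N)) = W by rewrite ZN scal_mx1.
rewrite scal_mxM !scal_mxD scal_mxN scal_mx1 -/W -NE -ZE => {}ZN.
(* The same identity in the other direction yields a left inverse of [1 + h]. *)
pose y := 1%:M - al *m (W - be *m z *m al) *m be.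
have y1 : y *m (1%:M + h) = 1%:M.
  rewrite mulmxBl mul1mx; apply/eqP; rewrite subr_eq; apply/eqP.
  congr (_ + _); have bh : be *m (1%:M + h) = (W + be *m al) *m be.
    by rewrite mulmxDr mulmx1 mulmxDl wbe hE mulmxA.
  rewrite -(mulmxA _ be) bh -(mulmxA al) (mulmxA (W - _)) ZN mulmxA alw.
  exact: hE.
have -> : z = y by rewrite -[z]mul1mx -y1 -mulmxA e mulmx1.
exact: y1.
Qed.

Section UpperMatrix.
Variable U : pred I.
Hypothesis upU : forall i j, (i <= j)%O -> U i -> U j.

Definition upper_mx m n (A : 'M[S]_(m, n)) : 'M[S]_(m, n) :=
  map_mx (upper_part str U) A.

Lemma upper_mxD m n (A B : 'M[S]_(m, n)) :
  upper_mx (A + B) = upper_mx A + upper_mx B.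
Proof. by apply/matrixP => p q; rewrite !mxE upper_partD. Qed.

Lemma upper_mxN m n (A : 'M[S]_(m, n)) : upper_mx (- A) = - upper_mx A.
Proof. by apply/matrixP => p q; rewrite !mxE upper_partN. Qed.

Lemma upper_mxM m n p (A : 'M[S]_(m, n)) (B : 'M[S]_(n, p)) :
  upper_mx (A *m B) = upper_mx A *m upper_mx B.
Proof.
apply/matrixP => x y; rewrite !mxE.
rewrite (big_morph _ (upper_partD str U) (upper_part0 str U)).
by apply: eq_bigr => l _; rewrite !mxE upper_partM.
Qed.

(* The identity of the image of upper_mx is not 1; adding the missing
   complement makes the projection unital. *)
Definition upper_unital n (A : 'M[S]_n) : 'M[S]_n :=
  upper_mx A + (1%:M - upper_mx 1%:M).

Lemma upper_unital1 n : upper_unital (1%:M : 'M[S]_n) = 1%:M.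
Proof. by rewrite /upper_unital addrC subrK. Qed.

Lemma upper_unitalM n (A B : 'M[S]_n) :
  upper_unital (A *m B) = upper_unital A *m upper_unital B.
Proof.
have [c cE] : exists c, c = 1%:M - upper_mx (1%:M : 'M[S]_n) by eexists.
have Ac C : upper_mx C *m c = 0 :> 'M_n.
  by rewrite cE mulmxBr mulmx1 -upper_mxM mulmx1 subrr.
have cA C : c *m upper_mx C = 0 :> 'M_n.
  by rewrite cE mulmxBl mul1mx -upper_mxM mul1mx subrr.
have cc : c *m c = c by rewrite {2}cE mulmxBr mulmx1 cA subr0.
by rewrite /upper_unital -cE mulmxDl !mulmxDr Ac cA cc addr0 add0r upper_mxM.
Qed.

End UpperMatrix.

Lemma upper_ge i : forall j k, (j <= k)%O -> (i <= j)%O -> (i <= k)%O.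
Proof. by move=> j k jk ij; exact: le_trans jk. Qed.

Lemma upper_gt i : forall j k, (j <= k)%O -> (i < j)%O -> (i < k)%O.
Proof. by move=> j k jk ij; exact: lt_le_trans jk. Qed.

Lemma part_mx_finite m n (A : 'M[S]_(m, n)) :
  exists s : seq I, forall i p q, part i (A p q) != 0 -> i \in s.
Proof.
have /choice[f fP] (p : 'I_m * 'I_n) := part_finite str (A p.1 p.2).
exists (flatten (codom f)) => i p q h; apply/flattenP.
by exists (f (p, q)); [exact: codom_f|exact: (fP (p, q))].
Qed.

(** The two upper sets differ by the index [j] alone. *)
Lemma upper_unital_diff j n (A : 'M[S]_n) :
  layer_mx j (upper_unital (fun k => j <= k)%O A -
              upper_unital (fun k => j < k)%O A).
Proof.
have h (a : S) : layer str j (upper_part str (fun k => j <= k)%O a -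
    upper_part str (fun k => j < k)%O a).
  apply: (@part_inj _ _ _ _ str) => k.
  rewrite part_part !partB !part_upper_part.
  case: (eqVneq k j) => [->|kj]; first by rewrite lexx ltxx.
  rewrite lt_neqAle (eq_sym j) kj /=.
  by case: ifP; rewrite subrr.
rewrite /upper_unital opprD addrACA opprB [X in _ + X]addrC [X in _ + X]addrA.
rewrite subrK => p q.
by rewrite !mxE; apply: layerD; [|rewrite -opprB; apply: layerN]; exact: h.
Qed.

Lemma part_upper_gt j k m n (A : 'M[S]_(m, n)) p q : (k < j)%O ->
  part k (upper_mx (fun l => j < l)%O A p q) = 0.
Proof. by move=> kj; rewrite mxE part_upper_part (lt_gtF kj). Qed.

(** The right factor is the identity plus a matrix with parts strictly above [j] only, and such a
    matrix preserves the layer [j]. *)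
Lemma layer_mx_mul_upper j n (X A : 'M[S]_n) : layer_mx j X ->
  layer_mx j (X *m upper_unital (fun k => j < k)%O A).
Proof.
move=> jX; rewrite mulmxDr mulmxBr mulmx1.
have h (C : 'M[S]_n) : layer_mx j (X *m upper_mx (fun k => j < k)%O C).
  by apply: layer_mx_mulr => // k kj p q; exact: part_upper_gt.
by apply: layer_mxD => //; apply: layer_mxD => //; exact: layer_mxN.
Qed.

Lemma layer_mx_upper_mul j n (X A : 'M[S]_n) : layer_mx j X ->
  layer_mx j (upper_unital (fun k => j < k)%O A *m X).
Proof.
move=> jX; rewrite mulmxDl mulmxBl mul1mx.
have h (C : 'M[S]_n) : layer_mx j (upper_mx (fun k => j < k)%O C *m X).
  by apply: layer_mx_mull => // k kj p q; exact: part_upper_gt.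
by apply: layer_mxD => //; apply: layer_mxD => //; exact: layer_mxN.
Qed.

(* If 1 - B *m A is nonzero, take a maximal layer j where it does not vanish: modulo
   the layer j, A and B are inverses of each other on both sides. *)
Lemma mulmx1_stratified n (A B : 'M[S]_n) : A *m B = 1%:M -> B *m A = 1%:M.
Proof.
move=> AB; apply/eqP; rewrite eq_sym -subr_eq0; apply/negPn/negP => g0.
set g := 1%:M - B *m A in g0.
have [p [q gpq]] : exists p q, g p q != 0.
  apply: contrapT => h; case/negP: g0; apply/eqP/matrixP => p q.
  rewrite [RHS]mxE.
  by apply/eqP/negPn/negP => gpq; apply: h; exists p, q.
have [i gi] : exists i, part i (g p q) != 0.
  apply: contrapT => h; case/negP: gpq; apply/eqP/(part_ext (s := str)) => i.
  by apply/eqP/negPn/negP => gi; apply: h; exists i.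
have [s sP] := part_mx_finite g.
have [||j [_ [p' [q' gj]]] jm] :=
    @exists_maximal _ I (fun i => exists p q, part i (g p q) != 0) s i.
- by exists p, q.
- by move=> k [x [y /sP]].
case/negP: gj; apply/eqP; pose f := @upper_unital (fun k => j <= k)%O n.
pose f1 := @upper_unital (fun k => j < k)%O n.
have fM X Y : f (X *m Y) = f X *m f Y by apply: upper_unitalM; exact: upper_ge.
have f1M X Y : f1 (X *m Y) = f1 X *m f1 Y.
  by apply: upper_unitalM; exact: upper_gt.
have fAB : f A *m f B = 1%:M by rewrite -fM AB; exact: upper_unital1.
have f1AB : f1 A *m f1 B = 1%:M by rewrite -f1M AB; exact: upper_unital1.
(* By maximality of [j], the entries of [1 - B *m A] have no part strictly above [j]. *)
have f1BA : f1 B *m f1 A = 1%:M.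
  rewrite -f1M -[RHS](upper_unital1 (fun k => j < k)%O) /f1 /upper_unital.
  congr (_ + _); apply/eqP; rewrite eq_sym -subr_eq0 -upper_mxN -upper_mxD.
  apply/eqP/matrixP => x y; rewrite !mxE; apply: upper_part_eq0 => k jk.
  apply/eqP/negPn/negP => h; apply: (jm k jk); exists x, y.
  by move: h; rewrite !mxE.
(* [f A *m f1 B] and [f1 A *m f B] differ from the identity only in the layer [j], so that
   [layer_mx_unitC] applies to them. *)
have hA : layer_mx j (f A *m f1 B - 1%:M).
  by rewrite -f1AB -mulmxBl; apply/layer_mx_mul_upper/upper_unital_diff.
have hB : layer_mx j (f1 A *m f B - 1%:M).
  by rewrite -f1AB -mulmxBr; apply/layer_mx_upper_mul/upper_unital_diff.
have e : (f A *m f1 B) *m (f1 A *m f B) = 1%:M.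
  by rewrite mulmxA -(mulmxA (f A)) f1BA mulmx1.
have e' : (f1 A *m f B) *m (f A *m f1 B) = 1%:M.
  have := layer_mx_unitC hA hB.
  by rewrite ![1%:M + (_ - _)]addrC !subrK; apply.
have : f B *m f A = 1%:M.
  have -> : f B *m f A = f1 B *m ((f1 A *m f B) *m (f A *m f1 B)) *m f1 A.
    by rewrite !mulmxA f1BA mul1mx -!mulmxA f1BA mulmx1.
  by rewrite e' mulmx1.
rewrite -fM -[RHS](upper_unital1 (fun k => j <= k)%O) => /addIr/esym/eqP.
rewrite -subr_eq0 -upper_mxN -upper_mxD => /eqP/matrixP/(_ p' q').
by rewrite !mxE => /(congr1 (part j)); rewrite part_upper_part lexx part0.
Qed.

End DirectlyFinite.

(** * Idempotent matrices in one layer, and perturbation by one layer *)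

Section StratifiedMatrices.
Variables (S : pzRingType) (K : fieldType).
Variables (d : Order.disp_t) (I : porderType d).
Variable str : stratification S K I.
Implicit Types (i j k : I).

Local Notation part := (part str).
Local Notation layer := (layer str).
Local Notation layer_mx := (layer_mx str).
Local Notation scal_mx := (scal_mx str).
Local Notation w i := (scal str i 1).

Lemma zero_mx_idem n : (0 : 'M[S]_n) *m (0 : 'M[S]_n) = 0.
Proof. exact: mul0mx. Qed.

Lemma w_mx_idem i n : (w i)%:M *m (w i)%:M = (w i)%:M :> 'M[S]_n.
Proof. by rewrite -scalar_mxM w_idem. Qed.

(** With [Z = al *m be], the corner matrix [be *m Z *m al] is an idempotent [P] over [K]. A rank
    factorization [P = C *m D] has [D *m C = 1], and it transports back to [Z]; [r] is the rank of
    [P]. *)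
Lemma layer_idem_rank i n (Z : 'M[S]_n) : layer_mx i Z -> Z *m Z = Z ->
  exists r (X : 'M_(n, r)) (Y : 'M_(r, n)),
    [/\ X *m Y = Z, Y *m X = (w i)%:M, layer_mx i X & layer_mx i Y].
Proof.
move=> iZ ZZ; have [r [al [be [ial ibe alw wbe ZE]]]] := layer_mx_factor iZ.
have [P PE] : exists P, be *m Z *m al = scal_mx i P.
  apply: layer_corner.
  - by apply: layer_mxM => //; exact: layer_mxM.
  - by rewrite !mulmxA wbe.
  - by rewrite -!mulmxA alw.
have PP : P *m P = P.
  apply: (@scal_mx_inj _ _ _ _ str i); rewrite scal_mxM -PE !mulmxA.
  by rewrite -(mulmxA _ al be) -ZE -!(mulmxA be) !ZZ.
have [t [C [D [CD [C' CC'] [D' DD']]]]] : exists t (C : 'M_(r, t))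
    (D : 'M_(t, r)), [/\ C *m D = P, exists C', C' *m C = 1%:M &
    exists D', D *m D' = 1%:M].
  exists (\rank P), (col_base P), (row_base P); split; first exact: mulmx_base.
    exact/row_fullP/col_base_full.
  exact/row_freeP/row_base_free.
have DC : D *m C = 1%:M.
  have : (C *m D) *m (C *m D) = C *m D by rewrite !CD.
  move=> /(congr1 (fun M => C' *m M *m D')).
  by rewrite !mulmxA CC' mul1mx -!mulmxA DD' mulmx1.
exists t, (Z *m al *m scal_mx i C), (scal_mx i D *m (be *m Z)); split.
- rewrite -!mulmxA (mulmxA (scal_mx i C)) -scal_mxM CD -PE !mulmxA.
  by rewrite -(mulmxA Z al be) -ZE !ZZ -(mulmxA Z al be) -ZE !ZZ.
- have -> : scal_mx i D *m (be *m Z) *m (Z *m al *m scal_mx i C) =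
      scal_mx i D *m (be *m (Z *m Z) *m al) *m scal_mx i C by rewrite !mulmxA.
  rewrite ZZ PE -!scal_mxM -CD mulmxA DC mul1mx DC.
  exact: scal_mx1.
- by apply: layer_mxM; [apply: layer_mxM|exact: scal_mx_layer].
- by apply: layer_mxM; [exact: scal_mx_layer|apply: layer_mxM].
Qed.

(** [u] is equivalent to a diagonal matrix of [r] copies of [w i], with [r] nonzero as [u] is. The
    first copy gives a subidempotent of [u] equivalent to [w i]; by primitivity it is all of [u]. *)
Lemma primitive_layer_idem i (u : S) : layer i u -> u * u = u -> u != 0 ->
  ~ (exists f g : S, [/\ layer i f /\ layer i g, f * f = f /\ g * g = g,
       f != 0 /\ g != 0, f * g = 0 /\ g * f = 0 & u = f + g]) ->
  exists x y : S, x * y = u /\ y * x = w i.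
Proof.
move=> iu uu u0 prim.
have [||r [X [Y [XY YX iX iY]]]] := @layer_idem_rank i 1 u%:M.
- by move=> p q; rewrite !ord1 mxE eqxx mulr1n.
- by rewrite -scalar_mxM uu.
have uE : u = \sum_l X 0 l * Y l 0.
  by move/matrixP/(_ 0 0): XY; rewrite !mxE eqxx mulr1n => <-.
have YXE l l' : Y l 0 * X 0 l' = if l == l' then w i else 0.
  move/matrixP/(_ l l'): YX; rewrite !mxE big_ord1 => ->.
  by case: eqP; rewrite ?mulr1n ?mulr0n.
clear XY YX; case: r X Y iX iY uE YXE => [|r] X Y iX iY uE YXE.
  by move: u0; rewrite uE big_ord0 eqxx.
pose x := X 0 0; pose y := Y 0 0; pose f := x * y.
have yx : y * x = w i by rewrite YXE eqxx.
have yu : y * u = w i * y.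
  rewrite uE mulr_sumr (bigD1 0) //= mulrA YXE eqxx big1 ?addr0 // => l l0.
  by rewrite mulrA YXE eq_sym (negbTE l0) mul0r.
have ux : u * x = x * w i.
  rewrite uE mulr_suml (bigD1 0) //= -mulrA YXE eqxx big1 ?addr0 // => l l0.
  by rewrite -mulrA YXE (negbTE l0) mulr0.
(* Since [y * x = w i], the square of [x * y] is [x * w i * y]; with [w i] inserted the element is
   idempotent. *)
pose e := x * w i * y.
have yxw : y * (x * w i) = w i by rewrite mulrA yx w_idem.
have ee : e * e = e.
  by rewrite /e !mulrA -(mulrA _ y x) yx -2!(mulrA x) !w_idem.
have eu : e * u = e by rewrite /e -mulrA yu mulrA -(mulrA x) w_idem.
have ue : u * e = e by rewrite /e mulrA mulrA ux -(mulrA x) w_idem.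
have e0 : e != 0.
  apply: contraTneq (scal1_neq0 str i) => e0; rewrite negbK; apply/eqP.
  have : y * e * x = w i by rewrite /e !mulrA yx w_idem -mulrA yx w_idem.
  by rewrite e0 mulr0 mul0r.
have ie : layer i e.
  by apply: layerM; [apply: layerM; [exact: iX|exact: scal_layer]|exact: iY].
have [ue0|ue0] := eqVneq (u - e) 0.
  exists (x * w i), y; split=> //.
  by apply/eqP; rewrite eq_sym -subr_eq0; apply/eqP.
case: prim; exists e, (u - e); split=> //; last by rewrite addrC subrK.
- by split=> //; apply: layerD => //; exact: layerN.
- by split=> //; rewrite mulrBl !mulrBr uu ue eu ee subrr subr0.
- by rewrite mulrBr mulrBl ue eu ee subrr.
Qed.

(* E and E' differ by al *m be, which factors through r copies of w i, so E is a
   direct summand of E' (+) (w i)^r, with complement Z in the layer i. *)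
Lemma idem_perturb i n (E E' : 'M[S]_n) : E *m E = E -> E' *m E' = E' ->
  layer_mx i (E - E') ->
  (forall k, (k < i)%O -> forall p q, part k (E p q) = 0) ->
  (forall k, (k < i)%O -> forall p q, part k (E' p q) = 0) ->
  exists r (X : 'M_(n, n + r)) (Y : 'M_(n + r, n)) (Z : 'M_(n + r)),
    [/\ X *m Y = E /\ E *m X = X, layer_mx i Z, Z *m Z = Z,
        Y *m X *m Z = 0 /\ Z *m (Y *m X) = 0 &
        Y *m X + Z = block_mx E' 0 0 (w i)%:M].
Proof.
move=> EE EE' /[dup] ih /layer_mx_factor[r [al [be [ial ibe alw wbe hE]]]].
move=> lE lE'.
pose W : 'M[S]_r := (w i)%:M.
have WW : W *m W = W by exact: w_mx_idem.
pose F := block_mx E' 0 0 W.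
have FF : F *m F = F.
  by rewrite mulmx_block EE' WW !mulmx0 !mul0mx !addr0 !add0r.
(* [X *m Y = E *m (E' + al *m be) *m E = E], as [al *m be = E - E']. *)
pose X := row_mx (E *m E') (E *m al); pose Y := col_mx (E' *m E) (be *m E).
have XY : X *m Y = E.
  rewrite mul_row_col !mulmxA -(mulmxA E E') EE' -(mulmxA E al be) -hE.
  by rewrite -mulmxDl -mulmxDr addrC subrK EE EE.
have XF : X *m F = X.
  by rewrite mul_row_block !mulmx0 addr0 add0r -!mulmxA EE' alw.
have FY : F *m Y = Y.
  by rewrite mul_block_col !mul0mx addr0 add0r !mulmxA EE' wbe.
pose Q := Y *m X.
have QQ : Q *m Q = Q.
  by rewrite /Q mulmxA -(mulmxA Y) XY -(mulmxA Y) mul_mx_row !mulmxA EE.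
have QF : Q *m F = Q by rewrite /Q -mulmxA XF.
have FQ : F *m Q = Q by rewrite /Q mulmxA FY.
pose Z := F - Q.
have ZZ : Z *m Z = Z by rewrite mulmxBl !mulmxBr FF QF FQ QQ subrr subr0.
have QZ : Q *m Z = 0 by rewrite mulmxBr QF QQ subrr.
have ZQ : Z *m Q = 0 by rewrite mulmxBl FQ QQ subrr.
have iW : layer_mx i W.
  by move=> p q; rewrite mxE; case: eqP => _; [exact: scal_layer|exact: layer0].
have iZ : layer_mx i Z.
  (* Each block is written with a factor in the layer [i]; the other factors have no parts below
     [i], so they keep it there. *)
  have -> : Z = block_mx (- (E' *m (E - E') *m E')) (- (E' *m E *m al))
      (- (be *m E *m E')) (W - be *m E *m al).
    rewrite /Z /F /Q mul_col_row opp_block_mx add_block_mx !add0r.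
    rewrite !mulmxA -!(mulmxA _ E E) !EE mulmxBr mulmxBl opprB.
    by rewrite !EE'.
  have h1 : layer_mx i (E' *m (E - E') *m E').
    by apply: layer_mx_mulr => //; exact: layer_mx_mull.
  have h2 : layer_mx i (E' *m E *m al).
    by rewrite -mulmxA; apply: layer_mx_mull => //; exact: layer_mx_mull.
  have h3 : layer_mx i (be *m E *m E').
    by apply: layer_mx_mulr => //; exact: layer_mx_mulr.
  have h4 : layer_mx i (be *m E *m al).
    by apply: layer_mxM => //; exact: layer_mx_mulr.
  move=> p q; rewrite mxE.
  by case: fintype.split => x; rewrite mxE; case: fintype.split => y;
    rewrite ?[(- _ : 'M_(_, _)) _ _]mxE; [apply: layerN; exact: h1|
    apply: layerN; exact: h2|apply: layerN; exact: h3|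
    rewrite mxE; apply: layerD; first exact: iW;
    rewrite mxE; apply: layerN; exact: h4].
exists r, X, Y, Z; split=> //; last by rewrite addrC subrK.
by split=> //; rewrite mul_mx_row !mulmxA EE.
Qed.

End StratifiedMatrices.

(** * Generation of K_0 by the classes of the idempotents [w i] *)

Section StratifiedK0.
Variables (R : pzRingType) (K : fieldType).
Variables (d : Order.disp_t) (I : porderType d).
Variable str : stratification R^c K I.
Implicit Types (i j k : I).

Local Notation S := (R^c).
Local Notation part := (part str).
Local Notation layer := (layer str).
Local Notation layer_mx := (layer_mx str).
Local Notation scal_mx := (scal_mx str).
Local Notation w i := (scal str i 1).

Lemma mxproj_eq n (E F : 'M[S]_n) (EE : E *m E = E) (FF : F *m F = F) :
  E = F -> K0class (mxproj EE) = K0class (mxproj FF).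
Proof. by move=> EF; apply: (@mxproj_equiv _ _ _ _ _ _ _ E E); rewrite EE. Qed.

Definition wclass i : K0 R := K0class (mxproj (w_mx_idem str i 1)).

Lemma mxproj_w i n : K0class (mxproj (w_mx_idem str i n)) = wclass i *+ n.
Proof.
elim: n => [|n IH].
  rewrite mulr0n -(mxproj0 (zero_mx_idem S 0)); apply: mxproj_eq.
  by apply/matrixP => -[].
have GG := idem_block (w_mx_idem str i 1) (w_mx_idem str i n).
rewrite mulrS -IH -(mxproj_block _ _ GG); apply: mxproj_eq.
exact: (@scalar_mx_block _ 1 n (w i)).
Qed.

Lemma mxproj_layer i n (Z : 'M[S]_n) (ZZ : Z *m Z = Z) : layer_mx i Z ->
  exists r, K0class (mxproj ZZ) = wclass i *+ r.
Proof.
move=> iZ; have [r [X [Y [XY YX _ _]]]] := layer_idem_rank iZ ZZ.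
by exists r; rewrite -mxproj_w; exact: mxproj_equiv XY YX.
Qed.

Definition wlift : {freeg I / int} -> K0 R := free_lift wclass.

Lemma wliftB : {morph wlift : x y / x - y}.
Proof. exact: free_lift_is_additive. Qed.

Lemma wlift0 : wlift 0 = 0.
Proof. by rewrite -[X in wlift X](subrr 0) wliftB subrr. Qed.

Lemma wliftD : {morph wlift : x y / x + y}.
Proof.
move=> x y; rewrite -{1}[y]opprK wliftB -[- y]sub0r wliftB wlift0 sub0r.
by rewrite opprK.
Qed.

Lemma wliftU i (c : int) : wlift << c *g i >> = wclass i *~ c.
Proof. by rewrite /wlift free_lift_fglift liftU. Qed.

(** By [idem_perturb], the image of [E] plus that of some [Z] in the layer [i] is the image of [E']
    plus [r] copies of [w i]. As [Z] amounts to [s] copies, the integer is [r - s]. *)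
Lemma mxproj_perturb i n (E E' : 'M[S]_n) (EE : E *m E = E)
    (EE' : E' *m E' = E') :
  layer_mx i (E - E') ->
  (forall k, (k < i)%O -> forall p q, part k (E p q) = 0) ->
  (forall k, (k < i)%O -> forall p q, part k (E' p q) = 0) ->
  exists m : int, K0class (mxproj EE) = K0class (mxproj EE') + wclass i *~ m.
Proof.
move=> ih lE lE'.
have [r [X [Y [Z [[XY EX] iZ ZZ [QZ ZQ] QZF]]]]] :=
  idem_perturb EE EE' ih lE lE'.
have QQ : Y *m X *m (Y *m X) = Y *m X.
  by rewrite -mulmxA (mulmxA X) XY EX.
have FF := idem_block EE' (w_mx_idem str i r).
have GG : (Y *m X + Z) *m (Y *m X + Z) = Y *m X + Z by rewrite QZF.
have e1 : K0class (mxproj GG) = K0class (mxproj QQ) + K0class (mxproj ZZ).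
  exact: mxproj_orthogonal.
have e2 : K0class (mxproj GG) = K0class (mxproj FF) by exact: mxproj_eq.
have e3 : K0class (mxproj QQ) = K0class (mxproj EE).
  exact: (mxproj_equiv _ _ (erefl (Y *m X)) XY).
have e4 : K0class (mxproj FF) = K0class (mxproj EE') + wclass i *+ r.
  by rewrite -mxproj_w; apply: mxproj_block.
have [s sE] := mxproj_layer ZZ iZ.
exists (r%:Z - s%:Z); rewrite mulrzBr -!pmulrn.
by move: e1; rewrite e2 e3 e4 sE addrA => ->; rewrite addrK.
Qed.

(** Induction on the number of indices available to [E]: a minimal layer is dropped at the cost of a
    multiple of its class. *)
Lemma K0class_span (A : fgproj R) : exists x, K0class A = wlift x.
Proof.
have [n [E [EE ->]]] := fgproj_mx A.
have [s sP] := part_mx_finite str E.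
have [m] := ubnP (size s); elim: m s E EE sP => // m IH s E EE sP sm.
have [[i [p [q Ei]]]|E0] := pselect (exists i p q, part i (E p q) != 0);
    last first.
  have e : E = 0.
    apply/matrixP => p q; rewrite mxE; apply: (part_ext (s := str)) => i.
    by apply/eqP/negPn/negP => h; apply: E0; exists i, p, q.
  by exists 0; rewrite wlift0 (mxproj_eq _ (zero_mx_idem S n) e) mxproj0.
have [||j [_ Pj] jm] :=
    @exists_minimal _ I (fun i => exists p q, part i (E p q) != 0) s i.
- by exists p, q.
- by move=> k [x [y /sP]].
have lE k : (k < j)%O -> forall p q, part k (E p q) = 0.
  move=> kj x y; apply/eqP/negPn/negP => h; apply: (jm k kj); by exists x, y.
(* This is an upper set, and since [E] has no parts strictly below [j], restricting to it only drops
   the layer [j]. *)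
pose U k := ~~ (k <= j)%O.
have upU k l : (k <= l)%O -> U k -> U l.
  by move=> kl; apply: contra => lj; exact: le_trans kl lj.
pose E' := upper_mx str U E.
have EE' : E' *m E' = E' by rewrite -upper_mxM // EE.
have partE' k x y : part k (E' x y) = if U k then part k (E x y) else 0.
  by rewrite mxE part_upper_part.
have lE' k : (k < j)%O -> forall p q, part k (E' p q) = 0.
  by move=> kj x y; rewrite partE' lE // if_same.
have iE : layer_mx j (E - E').
  move=> x y; rewrite !mxE; apply: (@part_inj _ _ _ _ str) => k.
  rewrite part_part !partB !part_upper_part /U; case: (eqVneq k j) => [->|kj].
    by [].
  case: ifPn; rewrite ?subrr // negbK subr0 => kj'; apply/esym/lE.
  by rewrite lt_neqAle kj.
have [c ->] := mxproj_perturb EE EE' iE lE lE'.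
have [||x ->] := IH [seq k <- s | U k] E' EE'.
- move=> k x y; rewrite partE'; case: ifP => [Uk h|]; last by rewrite eqxx.
  by rewrite mem_filter Uk; exact: sP h.
- apply: leq_trans (sm : (size s <= m)%N).
  rewrite ltn_neqAle size_filter count_size andbT.
  rewrite -all_count; apply/negP => /allP h; have [x [y /sP/h]] := Pj.
  by rewrite /U lexx.
by exists (x + << c *g j >>); rewrite wliftD wliftU.
Qed.

End StratifiedK0.

(** * Cancellation modulo the layers outside an upper set *)

Section Cancellation.
Variables (S : pzRingType) (K : fieldType).
Variables (d : Order.disp_t) (I : porderType d).
Variable str : stratification S K I.
Variable U : pred I.
Hypothesis upU : forall i j, (i <= j)%O -> U i -> U j.

Local Notation upper := (upper_mx str U).

(** For a finitely generated projective [M] and an upper set [U], this says that [M] becomes zero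
    modulo the ideal of the layers outside [U]. Testing on maps to free modules avoids forming the
    quotient. *)
Definition killed (M : lmodType S) : Prop :=
  forall n (g : {linear M -> 'rV[S]_n}) x, upper (g x) = 0.

Lemma inl_linear (M N : lmodType S) :
  exists f : {linear M -> (M * N)%type}, forall x, f x = (x, 0).
Proof.
by apply: linear_of => a x y; congr pair; rewrite /= scaler0 addr0.
Qed.

Lemma inr_linear (M N : lmodType S) :
  exists f : {linear N -> (M * N)%type}, forall x, f x = (0, x).
Proof.
by apply: linear_of => a x y; congr pair; rewrite /= scaler0 addr0.
Qed.

Lemma killed_prod (M N : lmodType S) : killed M -> killed N ->
  killed (M * N)%type.
Proof.
move=> kM kN n g [x y]; have [l lE] := inl_linear M N.
have [r rE] := inr_linear M N.
have -> : (x, y) = l x + r y.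
  by rewrite lE rE; congr pair; rewrite /= ?addr0 ?add0r.
rewrite linearD upper_mxD -[g (l x)]/((g \o l) x) -[g (r y)]/((g \o r) y).
by rewrite kM kN addr0.
Qed.

Lemma killed_prodr (M N : lmodType S) : killed (M * N)%type -> killed N.
Proof.
move=> k n g x; have := k n (g \o snd) (0, x); exact.
Qed.

(* Followed by the C-component of the inverse, the C-component of the isomorphism
   differs from the identity by a map factoring through P.  So modulo U the two
   are one-sided, hence two-sided, inverses of each other. *)
Lemma killed_cancel (M P C : lmodType S) n
    (p : {linear 'rV[S]_n -> C}) (s : {linear C -> 'rV[S]_n}) :
  (forall x, p (s x) = x) -> isomorphic (M * C)%type (P * C)%type ->
  killed P -> killed M.
Proof.
move=> ps [f [f' fK f'K]] kP m b x0.
have [g gE] : exists g : {linear (P * C)%type -> (M * C)%type},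
    forall x, g x = f' x.
  apply: linear_of => a x y.
  by apply: (can_inj fK); rewrite linearP !f'K.
have gK x : g (f x) = x by rewrite gE.
have [lM lME] := inl_linear M C; have [rM rME] := inr_linear M C.
have [lP lPE] := inl_linear P C; have [rP rPE] := inr_linear P C.
have fE x : rP (f x).2 = f x - lP (f x).1.
  rewrite lPE rPE; case: (f x) => y c; congr pair; rewrite /= ?subr0 //.
  by rewrite subrr.
have grP x : g (rP (f x).2) = x - g (lP (f x).1) by rewrite fE linearB gK.
(* The C-components of [f] and of its inverse, restricted to C, are extended by the identity on the
   kernel of [p] so as to become square matrices. *)
pose T : {linear 'rV[S]_n -> 'rV[S]_n} :=
  (s \o snd \o f \o rM \o p) \+ (idfun \- (s \o p)).
pose T' : {linear 'rV[S]_n -> 'rV[S]_n} :=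
  (s \o snd \o g \o rP \o p) \+ (idfun \- (s \o p)).
have T'E c v : p v = c -> T' v = s (g (rP c)).2 + (v - s c) by move=> <-.
have kill n' (h : {linear (M * C)%type -> 'rV[S]_n'}) y :
    upper (h (g (lP y))) = 0.
  exact: (kP _ (h \o g \o lP)).
have TT' v : upper (T' (T v)) = upper v.
  have TE : T v = s (f (rM (p v))).2 + (v - s (p v)) by [].
  rewrite (T'E (f (rM (p v))).2); last first.
    by rewrite TE linearD linearB !ps subrr addr0.
  rewrite TE grP rME [X in _ + X]addrAC subrr add0r /= linearB /=.
  rewrite addrC addrA subrK upper_mxD upper_mxN.
  by rewrite (kill _ (s \o snd)) subr0.
have MM : upper_unital str U (lin1_mx T) *m
    upper_unital str U (lin1_mx T') = 1%:M.
  rewrite -upper_unitalM // -[RHS](upper_unital1 str U) /upper_unital.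
  congr (_ + _); apply/row_matrixP => i.
  have rowU A : row i (upper A) = upper (row i A) :> 'rV[S]_n.
    by apply/rowP => j; rewrite !mxE.
  rewrite !rowU !rowE mulmxA !mul_rV_lin1 /= TT'.
  by rewrite mulmx1.
have := mulmx1_stratified str MM.
rewrite -upper_unitalM // -[RHS](upper_unital1 str U) => /addIr M'M.
(* [T'] sends [a] to the C-component of [x0], which is zero, up to a term through P. As [T'] is
   invertible modulo [U], [a] vanishes there; hence [f (lM x0)] comes from P modulo [U]. *)
pose a := s (f (lM x0)).2.
have aT' : upper (a *m lin1_mx T') = 0.
  rewrite mul_rV_lin1 (T'E (f (lM x0)).2); last by rewrite ps.
  rewrite subrr addr0 grP lME /= sub0r linearN upper_mxN.
  by rewrite (kill _ (s \o snd)) oppr0.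
have a0 : upper a = 0.
  rewrite -[a]mulmx1 upper_mxM // -M'M -upper_mxM // mulmxA upper_mxM // aT'.
  by rewrite mul0mx.
pose B : {linear 'rV[S]_n -> 'rV[S]_m} := b \o fst \o g \o rP \o p.
have : upper (B a) = 0 by rewrite -mul_rV_lin1 upper_mxM // a0 mul0mx.
have -> : B a = b x0 - (b \o fst) (g (lP (f (lM x0)).1)).
  by rewrite /B /= ps grP lME -linearB.
by rewrite upper_mxD upper_mxN (kill _ (b \o fst)) subr0.
Qed.

End Cancellation.

(** * The positive cone of K_0 and the independence of the classes *)

Section PositiveCone.
Variables (R : pzRingType) (K : fieldType).
Variables (d : Order.disp_t) (I : porderType d).
Variable str : stratification R^c K I.
Implicit Types (i j k m : I).

Local Notation S := (R^c).
Local Notation part := (part str).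
Local Notation layer := (layer str).
Local Notation w i := (scal str i 1).
Local Notation wclass := (wclass str).
Local Notation wlift := (wlift str).
Local Notation wsum s := (\sum_(k <- s) wclass k).

(** Such a module is generated by one vector, with coefficients [c = c * w k], and [w k] has no part
    in [U]. *)
Lemma killed_w (U : pred I) : (forall i j, (i <= j)%O -> U i -> U j) ->
  forall k, ~~ U k -> killed str U (row_image ((w k)%:M : 'M[S]_1)).
Proof.
move=> upU k Uk n g x.
have xE : x = (val x 0 0) *: row_image_proj (w_mx_idem str k 1) (1%:M).
  apply: val_inj => /=; rewrite -[LHS]row_imageE [val x]mx11_scalar.
  by rewrite mul1mx mul_scalar_mx.
have xw : val x 0 0 * w k = val x 0 0.
  move: (row_imageE x) => /matrixP/(_ 0 0).
  by rewrite !mxE big_ord1 !mxE eqxx mulr1n.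
have x0 : upper_part str U (val x 0 0) = 0.
  rewrite -xw upper_partM // (upper_part_layer U (scal_layer str k 1)).
  by rewrite (negbTE Uk) mulr0.
rewrite xE linearZ; apply/matrixP => p q.
by rewrite !mxE upper_partM // x0 mul0r.
Qed.

Lemma killed0 (U : pred I) : killed str U ('rV[S]_0).
Proof.
move=> n g x; have -> : x = 0 by apply/rowP => -[].
by rewrite linear0; apply/matrixP => p q; rewrite !mxE upper_part0.
Qed.

Definition wproj (s : seq I) : fgproj R :=
  foldr (fun k A => dsum (mxproj (w_mx_idem str k 1)) A) (fgproj0 R) s.

Lemma K0class_wproj s : K0class (wproj s) = wsum s.
Proof.
by elim: s => [|k s IH]; rewrite ?big_nil ?big_cons // -IH -K0classD.
Qed.

(** Equality would give stably isomorphic modules, the one on the right killed by the indices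
    [>= i]. After cancellation the image of [w i] would be killed too, whereas [w i] is nonzero and
    is its own upper part. *)
Lemma wclass_not_below (A : fgproj R) i (s : seq I) :
  (forall k, k \in s -> ~~ (i <= k)%O) -> K0class A + wclass i != wsum s.
Proof.
move=> si; apply/eqP; rewrite -K0class_wproj -K0classD => /K0classP[C e].
have [n [p [t pt]]] := fgproj_split C.
have upU := @upper_ge _ I i.
have kP : killed str (fun k => i <= k)%O (wproj s).
  elim: s si {e} => [|k s IH] si; first exact: killed0.
  apply: killed_prod.
    by apply: killed_w => //; apply: si; rewrite mem_head.
  by apply: IH => l ls; apply: si; rewrite inE ls orbT.
have /killed_prodr kw := killed_cancel upU pt e kP.
have [v vE] : exists g : {linear row_image ((w i)%:M : 'M[S]_1) -> 'rV[S]_1},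
    forall x, g x = val x.
  by apply: linear_of => a x y.
have := kw _ v (row_image_proj (w_mx_idem str i 1) 1%:M).
rewrite vE /= mul1mx => /matrixP/(_ 0 0); rewrite !mxE eqxx mulr1n.
rewrite (upper_part_layer _ (scal_layer str i 1)) lexx.
exact/eqP/scal1_neq0.
Qed.

Lemma wsum_rem i (t : seq I) : i \in t -> wsum t = wclass i + wsum (rem i t).
Proof. by move=> it; rewrite (perm_big _ (perm_to_rem it)) big_cons. Qed.

(** [s] and [t] are the positive and negative parts of [x], each index being repeated as often as
    the absolute value of its coefficient. *)
Lemma wlift_split (x : {freeg I / int}) : exists s t : seq I,
  [/\ wlift x = wsum s - wsum t, forall k, (k \in s) = (0 < coeff k x) &
      forall k, (k \in t) = (coeff k x < 0)].
Proof.
pose L (P : int -> bool) :=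
  flatten [seq nseq `|coeff k x|%N k | k <- dom x & P (coeff k x)].
have LE (P : int -> bool) : ~~ P 0 -> forall k, (k \in L P) = P (coeff k x).
  move=> P0 k; apply/flatten_mapP/idP => [[l]|Pk].
    by rewrite mem_filter mem_nseq => /andP[Pl _] /andP[_ /eqP ->].
  have k0 : coeff k x != 0 by apply: contraNneq P0 => <-.
  exists k; last by rewrite mem_nseq eqxx absz_gt0 k0.
  by rewrite mem_filter Pk /= mem_dom.
have LS (P : int -> bool) : wsum (L P) =
    \sum_(k <- dom x | P (coeff k x)) wclass k *+ `|coeff k x|%N.
  rewrite /L big_flatten big_map big_filter; apply: eq_bigr => k _.
  by rewrite big_nseq iter_addr_0.
exists (L (fun c => 0 < c)), (L (fun c => c < 0)); split; last 2 first.
- by apply: LE; rewrite ltxx.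
- by apply: LE; rewrite ltxx.
rewrite !LS /wlift /free_lift (bigID (fun k => 0 < coeff k x)) /=.
congr (_ + _); first by apply: eq_bigr => k k0; rewrite pmulrn gtz0_abs.
rewrite -sumrN [LHS]big_seq_cond [RHS]big_seq_cond; apply: eq_big => k.
  case: (boolP (k \in dom x)) => //; rewrite mem_dom => k0.
  by rewrite -leNgt lt_neqAle k0.
move=> /andP[_ k0]; by rewrite pmulrn -mulrNz lez0_abs ?opprK // leNgt.
Qed.

(** A negative coefficient at a maximal index [i] lets [wclass i] be moved to the side of [A]. The
    positive terms that remain on the other side have no index [>= i], against
    [wclass_not_below]. *)
Lemma rho_pos_cone x : K0pos R (wlift x) -> hahn_cone (fun i j => (i <= j)%O) x.
Proof.
move=> [A rA] i idom imax; rewrite ltNge; apply/negP => ci.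
have {ci} ci : coeff i x < 0 by move: idom; rewrite mem_dom lt_neqAle => ->.
have [s [t [rE sE tE]]] := wlift_split x.
have it : i \in t by rewrite tE.
have : K0class (dsum A (wproj (rem i t))) + wclass i = wsum s.
  rewrite K0classD K0class_wproj -addrA [wsum _ + _]addrC -wsum_rem //.
  by rewrite -rA rE subrK.
apply/eqP/wclass_not_below => k; rewrite sE => ck; apply/negP => ik.
have /imax/(_ ik) ki : k \in dom x by rewrite mem_dom gt_eqF.
by move: ck; rewrite ki ltNge (ltW ci).
Qed.

Lemma mx11_idem (p : S) : p * p = p -> p%:M *m p%:M = p%:M :> 'M[S]_1.
Proof. by move=> pp; rewrite -scalar_mxM pp. Qed.

(* p does not annihilate the layer k, as its part of index m > k is nonzero. *)
Lemma peel_off m k (p : S) : p * p = p -> part m p != 0 ->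
  (forall j, (m < j)%O -> part j p = 0) -> (k < m)%O ->
  (forall j, (j < k)%O -> part j p = 0) ->
  exists x y : S, [/\ layer k (x * y), p * x = x, y * p = y & y * x = w k].
Proof.
move=> pp mp mjp km kp.
have [b kb pb] := part_faithful (ltW km) mp mjp.
have [r [x [y [xP yP bE]]]] := part_factor kb.
have [l pxl] : exists l, p * x l != 0.
  apply: contrapT => h; case/eqP: pb; rewrite bE mulr_sumr big1 // => l _.
  rewrite mulrA; have [->|h'] := eqVneq (p * x l) 0; first by rewrite mul0r.
  by case: h; exists l.
have [kx xw] := xP l.
have [||c [kc wc cx]] := @part_left_inverse _ _ _ _ str k (p * x l) _ _ pxl.
- exact: layer_mull.
- by rewrite -mulrA xw.
exists (p * x l), (c * p); split.
- apply: layerM; [exact: layer_mull|exact: layer_mulr].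
- by rewrite mulrA pp.
- by rewrite -mulrA pp.
- by rewrite -(mulrA c) (mulrA p) pp.
Qed.

(** Copies of [w k], for [k] in [s], are split off [w m] one after the other. Each one lies in a
    layer below [m], so the part of index [m] remains [w m] and [peel_off] can be applied again. *)
Lemma wclass_sub m (s : seq I) : (forall k, k \in s -> (k < m)%O) ->
  exists (p : S) (pp : p * p = p), [/\ part m p = w m,
    forall j, part j p != 0 -> j \in m :: s &
    wclass m = K0class (mxproj (mx11_idem pp)) + wsum s].
Proof.
have [n] := ubnP (size s); elim: n s => // n IH s sn sm.
case: s => [|k0 s0] in sn sm *.
  exists (w m), (w_idem str m); split.
  - exact: scal_layer.
  - move=> j; rewrite (part_layer j (scal_layer str m 1)) inE.
    by case: ifP => //; rewrite eqxx.
  - by rewrite big_nil addr0; exact: mxproj_eq.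
set s := k0 :: s0 in sn sm *.
(* A minimal index is split off last: then [p] has no parts below it, as [peel_off] requires. *)
have [||k [_ ks] kmin] := @exists_minimal _ I (fun k => k \in s) s k0.
- by rewrite mem_head.
- by [].
have [||p [pp [mp pj pE]]] := IH (rem k s).
- by rewrite size_rem //; exact: sn.
- by move=> j /mem_rem/sm.
have km := sm _ ks.
have pj' j : j \notin m :: s -> part j p = 0.
  apply: contraNeq => /pj; rewrite !inE => /orP[->//|/mem_rem].
  by rewrite inE => ->; rewrite orbT.
have pk j : (j < k)%O -> part j p = 0.
  move=> jk; apply: pj'; rewrite inE negb_or lt_eqF ?(lt_trans jk) //=.
  by apply/negP => /(kmin _ jk).
have [||x [y [kxy px yp yx]]] := @peel_off m k p pp _ _ km pk.
- by rewrite mp; exact: scal1_neq0.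
- move=> j mj; apply: pj'; rewrite inE negb_or gt_eqF //=.
  by apply/negP => /sm jm; move: (lt_trans mj jm); rewrite ltxx.
pose e := x * w k * y.
have xyxy : e * e = e.
  by rewrite /e !mulrA -(mulrA _ y x) yx -2!(mulrA x) !w_idem.
have pe : p * e = e by rewrite /e !mulrA px.
have ep : e * p = e by rewrite /e -mulrA yp.
have qq : (p - e) * (p - e) = p - e.
  by rewrite mulrBl !mulrBr pp pe ep xyxy subrr subr0.
(* [peel_off] places the product [x * y] in the layer [k], but not the factors; hence this form of
   [e]. *)
have eE : e = x * y * (x * y) by rewrite /e !mulrA -(mulrA x y x) yx.
have ke : layer k e by rewrite eE; exact: layerM.
exists (p - e), qq; split.
- by rewrite partB mp (part_layer m ke) gt_eqF // subr0.
- move=> j; have [->|jk] := eqVneq j k; first by rewrite inE ks orbT.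
  rewrite partB (part_layer j ke) (negbTE jk) subr0.
  by apply: contraNT => /pj' ->.
rewrite pE (wsum_rem ks) addrA; congr (_ + _).
have ee : e%:M *m e%:M = e%:M :> 'M[S]_1 by rewrite -scalar_mxM xyxy.
have GG : ((p - e)%:M + e%:M) *m ((p - e)%:M + e%:M) =
    (p - e)%:M + e%:M :> 'M[S]_1.
  by rewrite -raddfD subrK mx11_idem.
rewrite (mxproj_eq (mx11_idem pp) GG); last by rewrite -raddfD subrK.
rewrite (mxproj_orthogonal (mx11_idem qq) ee).
- congr (_ + _); apply: (@mxproj_equiv _ _ _ _ _ _ _ (x * w k)%:M (w k * y)%:M).
    by rewrite -scalar_mxM /e mulrA -(mulrA x) w_idem.
  by rewrite -scalar_mxM mulrA -(mulrA _ y x) yx !w_idem.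
- by rewrite -scalar_mxM mulrBl pe xyxy subrr raddf0.
- by rewrite -scalar_mxM mulrBr ep xyxy subrr raddf0.
Qed.

Lemma K0posD x y : K0pos R x -> K0pos R y -> K0pos R (x + y).
Proof. by move=> [A ->] [B ->]; exists (dsum A B); rewrite K0classD. Qed.

(** The head [m] of [s] absorbs, by [wclass_sub], all the terms of [t] below it; every other term of
    [t] is below an element of the tail. *)
Lemma wsum_pos (s t : seq I) :
  (forall k, k \in t -> exists2 m, m \in s & (k < m)%O) ->
  K0pos R (wsum s - wsum t).
Proof.
elim: s t => [|m s IH] t st.
  case: t st => [|k t] st; last by have [] := st k (mem_head _ _).
  by rewrite !big_nil subr0; exists (fgproj0 R).
rewrite big_cons [wsum t](bigID (fun k => (k < m)%O)) /= opprD addrACA.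
apply: K0posD; last first.
  rewrite -[X in _ - X]big_filter; apply: IH => k; rewrite mem_filter.
  move=> /andP[km /st[l]].
  by rewrite inE => /orP[/eqP ->|ls kl]; [rewrite (negbTE km)|exists l].
rewrite -big_filter.
have [|p [pp [_ _ ->]]] := @wclass_sub m [seq k <- t | (k < m)%O].
  by move=> k; rewrite mem_filter => /andP[].
by rewrite addrK; exists (mxproj (mx11_idem pp)).
Qed.

(** Every index with a negative coefficient lies below a maximal one of the support, whose
    coefficient is positive; [wsum_pos] then applies. *)
Lemma rho_cone_pos x : hahn_cone (fun i j => (i <= j)%O) x -> K0pos R (wlift x).
Proof.
move=> xc; have [s [t [-> sE tE]]] := wlift_split x.
apply: wsum_pos => k; rewrite tE => ck.
have kdom : k \in dom x by rewrite mem_dom lt_eqF.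
have [//|//|m [km mdom] mmax] :=
  @exists_maximal _ I (fun k => k \in dom x) (dom x) k.
have cm : 0 < coeff m x.
  apply: xc => // j jdom mj; apply/eqP/negPn/negP => jm.
  by apply: (mmax j) => //; rewrite lt_neqAle mj eq_sym jm.
exists m; first by rewrite sE.
rewrite lt_neqAle km andbT; apply: contraTneq cm => <-.
by rewrite -leNgt ltW.
Qed.

Lemma wlift_posP x : K0pos R (wlift x) <-> hahn_cone (fun i j => (i <= j)%O) x.
Proof. by split; [exact: rho_pos_cone|exact: rho_cone_pos]. Qed.

Lemma wlift_surj y : exists x, y = wlift x.
Proof.
have [A [B ->]] := K0classB y; have [x ->] := K0class_span str A.
by have [z ->] := K0class_span str B; exists (x - z); rewrite wliftB.
Qed.

(** An element [z] of the kernel lies in the cone together with [- z], which is impossible at a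
    maximal index of its support. *)
Lemma wlift_inj : injective wlift.
Proof.
move=> x y exy; apply/eqP; rewrite -subr_eq0; apply/negPn/negP => z0.
set z := x - y in z0.
have rz : wlift z = 0 by rewrite wliftB exy subrr.
have pos0 : K0pos R (0 : K0 R) by exists (fgproj0 R).
have cz : hahn_cone (fun i j => (i <= j)%O) z by apply/wlift_posP; rewrite rz.
have cNz : hahn_cone (fun i j => (i <= j)%O) (- z).
  by apply/wlift_posP; rewrite -[- z]sub0r wliftB rz wlift0 subrr.
have [i idom] : exists i, i \in dom z.
  apply: contrapT => h; case/eqP: z0; apply/eqP/freeg_eqP => i.
  by rewrite coeff0 coeff_outdom //; apply/negP => idom; apply: h; exists i.
have [//|//|m [_ mdom] mmax] :=
  @exists_maximal _ I (fun k => k \in dom z) (dom z) i.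
have mmax' j : j \in dom z -> (m <= j)%O -> j = m.
  move=> jdom mj; apply/eqP/negPn/negP => jm.
  by apply: (mmax j) => //; rewrite lt_neqAle mj eq_sym jm.
have c1 := cz m mdom mmax'.
have : 0 < coeff m (- z).
  by apply: cNz => [|j]; rewrite domN //; exact: mmax'.
by rewrite coeffN oppr_gt0 ltNge (ltW c1).
Qed.

End PositiveCone.

(** * The layers of B(I) *)

Section MaximalChainExistence.
Variables (d : Order.disp_t) (P : porderType d).

(** Zorn's lemma is applied to the sets whose union with [C] is a chain, rather than to the chains
    containing [C], so that the union of an empty family also qualifies. *)
Lemma chain_extend (C : set P) : chain C -> exists A : maxchain P, C `<=` val A.
Proof.
move=> cC; pose F (B : set P) := chain (B `|` C).
have [A [cA mA]] : exists A, F A /\ forall B, A `<` B -> ~ F B.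
  apply: Zorn_bigcup => G GF tG x y.
  move=> [[X GX Xx]|Cx] [[Y GY Yy]|Cy].
  - have [XY|YX] := tG X Y GX GY.
      by apply: (GF Y GY); left => //; exact: XY.
    by apply: (GF X GX); left => //; exact: YX.
  - by apply: (GF X GX); [left|right].
  - by apply: (GF Y GY); [right|left].
  - exact: cC.
have mAC : maximal_chain (A `|` C).
  apply/asboolP; split=> // B cB AB; apply/seteqP; split=> // x Bx.
  apply: contrapT => nx; apply: (mA B).
    split; first by move=> y Ay; apply: AB; left.
    by move=> BA; apply: nx; left; exact: BA.
  rewrite /F (_ : B `|` C = B) //; apply/seteqP; split=> y; last by left.
  by case=> // Cy; apply: AB; right.
by exists (exist _ (A `|` C) mAC) => x Cx; right.
Qed.

Lemma maxchain_through (k i : P) : (k <= i)%O ->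
  exists A : maxchain P, A k /\ A i.
Proof.
move=> ki; have [|A kiA] := @chain_extend [set k; i].
  move=> x y [->|->] [->|->]; by [left|right|left; rewrite lexx|left].
by exists A; split; apply: kiA; [left|right].
Qed.

End MaximalChainExistence.

(** * Matrix units among the column-finite matrices *)

Section MatrixUnits.
Variables (K : fieldType) (X : choiceType).
Implicit Types (a b : CFM K X) (x y z : X).

Lemma CFM_scalel (k : K) a b : (k *: a) * b = k *: (a * b).
Proof.
apply: CFM_ext => x y; rewrite entryZ !entryM mulr_fsumr.
by apply: eq_fsbigr => z _; rewrite entryZ mulrA.
Qed.

Lemma CFM_scaler (k : K) a b : a * (k *: b) = k *: (a * b).
Proof.
apply: CFM_ext => x y; rewrite entryZ !entryM mulr_fsumr.
by apply: eq_fsbigr => z _; rewrite entryZ mulrCA.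
Qed.

Lemma entry_sum (T : Type) (r : seq T) (F : T -> CFM K X) x y :
  (\sum_(t <- r) F t : CFM K X) x y = \sum_(t <- r) F t x y.
Proof. by apply: (big_morph (fun a : CFM K X => a x y)). Qed.

Lemma CFM_neq0 a : a != 0 -> exists x y, a x y != 0.
Proof.
move=> a0; apply: contrapT => h; case/eqP: a0; apply: CFM_ext => x y.
by apply/eqP/negPn/negP => axy; apply: h; exists x, y.
Qed.

Lemma unit_mx_finite x y z :
  finite_set [set t : X | ((t == x) && (z == y))%:R != 0 :> K].
Proof.
apply: (@sub_finite_set _ _ [set x]) => [t /=|]; last exact: finite_set1.
by case: (t =P x) => //= _; rewrite eqxx.
Qed.

Definition unit_mx x y : CFM K X := mkCFM (unit_mx_finite x y).

Lemma entry_unit x y s t : unit_mx x y s t = ((s == x) && (t == y))%:R.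
Proof. by []. Qed.

Lemma entry_unitM x y a s t :
  (unit_mx x y * a : CFM K X) s t = (s == x)%:R * a y t.
Proof.
rewrite entryM -(@fsbig_widen _ _ _ _ [set y]) ?fsbig_set1 //.
  by rewrite entry_unit eqxx andbT.
by move=> z [_ /= /eqP zy]; rewrite entry_unit (negbTE zy) andbF mul0r.
Qed.

Lemma entry_Munit x y a s t :
  (a * unit_mx x y : CFM K X) s t = a s x * (t == y)%:R.
Proof.
rewrite entryM -(@fsbig_widen _ _ _ _ [set x]) ?fsbig_set1 //.
  by rewrite entry_unit eqxx.
by move=> z [_ /= /eqP zy]; rewrite entry_unit (negbTE zy) mulr0.
Qed.

Lemma FR_unitM x y a : FR (unit_mx x y * a).
Proof.
apply: (@sub_finite_set _ _ [set x]) => [s [t] /=|]; last exact: finite_set1.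
by rewrite entry_unitM; case: (s =P x) => // _; rewrite mul0r eqxx.
Qed.

Lemma FR_unit x y : FR (unit_mx x y).
Proof. by rewrite -[unit_mx x y]mulr1; exact: FR_unitM. Qed.

(** [a] is the sum of [e_zy (e_yz a)] over its finitely many nonzero rows [z], where [e_zy] is the
    matrix unit. *)
Lemma FR_factor y a : FR a -> exists r (b c : 'I_r -> CFM K X),
  [/\ forall l, FR (b l) /\ b l * unit_mx y y = b l,
      forall l, FR (c l) /\ unit_mx y y * c l = c l & a = \sum_l b l * c l].
Proof.
move=> /finite_seqP[s0 sE]; pose s := undup s0.
have us : uniq s by exact: undup_uniq.
have sP x t : a x t != 0 -> x \in s.
  move=> axt; rewrite mem_undup; suff : [set` s0] x by [].
  by rewrite -sE; exists t.
exists (size s), (fun l => unit_mx (nth y s l) y),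
  (fun l => unit_mx y (nth y s l) * a).
split=> [l|l|]; first split.
- exact: FR_unit.
- apply: CFM_ext => x t; rewrite entry_Munit !entry_unit eqxx andbT.
  by case: eqP; case: eqP; rewrite /= ?mulr1 ?mulr0.
- split; first exact: FR_unitM.
  apply: CFM_ext => x t; rewrite !entry_unitM eqxx mul1r //.
apply: CFM_ext => x t; rewrite -(big_mkord xpredT
  (fun l => unit_mx (nth y s l) y * (unit_mx y (nth y s l) * a))).
rewrite -(big_nth y xpredT (fun z => unit_mx z y * (unit_mx y z * a))).
rewrite entry_sum.
have e z : (unit_mx z y * (unit_mx y z * a) : CFM K X) x t =
    (x == z)%:R * a z t.
  by rewrite entry_unitM entry_unitM eqxx mul1r.
under eq_bigr do rewrite e.
have [xs|xs] := boolP (x \in s).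
  rewrite (bigD1_seq x) //= eqxx mul1r big1 ?addr0 // => z zx.
  by rewrite eq_sym (negbTE zx) mul0r.
rewrite big_seq big1 => [|z zs]; last first.
  by case: eqP => [xz|_]; rewrite ?mul0r //; rewrite xz zs in xs.
by apply/eqP; apply: contraNT xs => /sP.
Qed.

End MatrixUnits.

(** * Products and rank one idempotents in the layers H(I,i) *)

Section Layers.
Variables (d0 : Order.disp_t) (aleph : bOrderType d0) (K : fieldType).
Variables (d : Order.disp_t) (I : porderType d).
Hypothesis aleph_infinite : infinite_set [set: aleph].

Local Notation Q := (CFM K (idx aleph I)).
Local Notation Hset := (Hset aleph K).
Implicit Types (i j k : I) (m n : Q) (x y z : idx aleph I).

Lemma finsupp_bot (A : choiceType) :
  `[< finite_set [set k : A | (\bot%O : aleph) != \bot%O] >].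
Proof.
apply/asboolP; rewrite (_ : [set _ | _] = set0) //.
by apply/seteqP; split=> t //=; rewrite eqxx.
Qed.

Definition finsupp0 (A : choiceType) : finsupp_map aleph A :=
  exist _ (fun=> \bot%O) (finsupp_bot A).

Lemma idx_through i : exists x, x.2 i.
Proof.
have [A [Ai _]] := maxchain_through (lexx i).
by exists (finsupp0 I, A).
Qed.

(** Lifting along one [x] whose chain passes through [i] exhibits every entry of [a] as an entry of
    [psi a]. *)
Lemma psi_inj i : injective (@psi _ aleph K _ I i).
Proof.
move=> a b e; have [x hx] := idx_through i; apply: CFM_ext => s t.
have l : linked i (lift_idx hx s) (lift_idx hx t).
  by apply: linked_trans (linked_lift hx t); exact/linked_sym/linked_lift.
have := congr1 (fun m : Q => m (lift_idx hx s) (lift_idx hx t)) e.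
by rewrite /= !(psiE _ (lift_mem hx s) (lift_mem hx t) l) !Defs.liftK.
Qed.

Lemma idx_up_ex i : exists x : idx aleph (up i), True.
Proof. by have [x hx] := idx_through i; exists (restr hx). Qed.

Definition base i : idx aleph (up i) := projT1 (cid (idx_up_ex i)).

(** At a maximal [i] the layer is a copy of [K], whose only nonzero idempotent is its identity;
    elsewhere a diagonal matrix unit has rank one. *)
Definition wmat i : CFM K (idx aleph (up i)) :=
  if `[< maximal_element i >] then 1 else unit_mx K (base i) (base i).

Definition wQ i : Q := psi (wmat i).

Lemma psiZ i c (a : CFM K (idx aleph (up i))) : psi (c *: a) = c *: psi a.
Proof. exact: linearZ. Qed.

Lemma HsetP i m :
  Hset i m <-> exists2 a : CFM K (idx aleph (up i)), m = psi a &
  (if `[< maximal_element i >]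
   then exists c, a = c *: (1 : CFM K (idx aleph (up i))) else FR a).
Proof.
rewrite /Defs.Hset; case: asboolP => _; split.
- by move=> [c _ <-]; exists (c *: (1 : CFM K (idx aleph (up i))));
    [rewrite psiZ|exists c].
- by move=> [_ -> [c ->]]; exists c => //; rewrite psiZ.
- by move=> [a fa <-]; exists a.
- by move=> [a -> fa]; exists a.
Qed.

Lemma HsetD i m n : Hset i m -> Hset i n -> Hset i (m + n).
Proof.
move=> /HsetP[a -> ha] /HsetP[b -> hb]; apply/HsetP; exists (a + b).
  by rewrite linearD.
move: ha hb; case: asboolP => _.
  by move=> [c ->] [e ->]; exists (c + e); rewrite scalerDl.
move=> fa fb; apply: (@sub_finite_set _ _
    ([set s | exists t, a s t != 0] `|` [set s | exists t, b s t != 0])).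
  move=> x [y]; rewrite entryD => h.
  have [az|az] := eqVneq (a x y) 0; last by left; exists y.
  by right; exists y; move: h; rewrite az add0r.
by rewrite finite_setU.
Qed.

Lemma HsetB i m n : Hset i m -> Hset i n -> Hset i (m - n).
Proof. by move=> hm hn; apply: HsetD => //; exact: HsetN. Qed.

Lemma Hset_wQ i : Hset i (wQ i).
Proof.
apply/HsetP; exists (wmat i); rewrite // /wmat; case: asboolP => _.
  by exists 1; rewrite scale1r.
exact: FR_unit.
Qed.

Lemma HsetZ i c m : Hset i m -> Hset i (c *: m).
Proof.
move=> /HsetP[a -> ha]; apply/HsetP; exists (c *: a); first by rewrite psiZ.
move: ha; case: asboolP => _.
  by move=> [e ->]; exists (c * e); rewrite scalerA.
apply: sub_finite_set => x [y]; rewrite entryZ => h; exists y.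
by apply: contraNneq h => ->; rewrite mulr0.
Qed.

Lemma Hset_mul_same i m n : Hset i m -> Hset i n -> Hset i (m * n).
Proof.
move=> /HsetP[a -> ha] /HsetP[b -> hb]; apply/HsetP; exists (a * b).
  by rewrite psiM.
move: ha hb; case: asboolP => _.
  by move=> [c ->] [e ->]; exists (c * e); rewrite CFM_scalel mul1r scalerA.
move=> fa fb; apply: sub_finite_set fa => x [y /entryM_neq0[z [az _]]].
by exists z.
Qed.

Lemma Hset_mul_le i j m n : (i <= j)%O -> Hset i m -> Hset j n ->
  Hset i (m * n) /\ Hset i (n * m).
Proof.
have [<-|ij] := eqVneq i j.
  by move=> _ hm hn; split; exact: Hset_mul_same.
move=> lij /HsetP[a -> ha] /HsetP[b -> _].
have mi : ~ maximal_element i by move=> /(_ _ lij) e; rewrite e eqxx in ij.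
rewrite asboolF // in ha.
have [c fc cE] := psi_mul_lt b lij ha; have [e fe eE] := psi_mul_gt b lij ha.
by split; apply/HsetP; [exists c|exists e]; rewrite ?asboolF.
Qed.

Lemma Hset_mul_incomparable i j m n : ~~ (i <= j)%O -> ~~ (j <= i)%O ->
  Hset i m -> Hset j n -> m * n = 0.
Proof.
move=> ij ji /HsetP[a -> _] /HsetP[b -> _].
apply: CFM_ext => x y; rewrite entry0; apply/eqP/negPn/negP.
move=> /entryM_neq0[z [/psi_linked/linkedr zi /psi_linked/linkedl zj]].
by have [h|h] := maxchain_chain zi zj; [rewrite h in ij|rewrite h in ji].
Qed.

Lemma wQ_idem i : wQ i * wQ i = wQ i.
Proof.
rewrite /wQ -psiM; congr psi; rewrite /wmat; case: asboolP => _.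
  by rewrite mulr1.
apply: CFM_ext => x y; rewrite entry_unitM entry_unit eqxx /=.
by rewrite entry_unit; case: eqP; case: eqP; rewrite /= ?mulr0 ?mulr1.
Qed.

Lemma wQ_neq0 i : wQ i != 0.
Proof.
apply/eqP; rewrite -(linear0 (@psi _ aleph K _ I i)) => /psi_inj.
move=> /(congr1 (fun a : CFM K (idx aleph (up i)) => a (base i) (base i))).
rewrite entry0 /wmat; case: asboolP => _; rewrite ?entry1 ?entry_unit eqxx.
  by move/eqP; rewrite oner_eq0.
by move/eqP; rewrite oner_eq0.
Qed.

Lemma Hset_corner i m : Hset i m -> exists c, wQ i * m * wQ i = c *: wQ i.
Proof.
move=> /HsetP[a -> ha]; rewrite /wQ -!psiM; move: ha.
rewrite /wmat; case: asboolP => _.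
  by move=> [c ->]; exists c; rewrite mul1r mulr1 psiZ.
move=> _; exists (a (base i) (base i)); rewrite -psiZ; congr psi.
apply: CFM_ext => x y; rewrite entry_Munit entry_unitM entryZ entry_unit.
by case: eqP; case: eqP; rewrite /= ?mulr0 ?mulr1 ?mul1r ?mul0r.
Qed.

Lemma Hset_factor i m : Hset i m -> exists r (b c : 'I_r -> Q),
  [/\ forall l, Hset i (b l) /\ b l * wQ i = b l,
      forall l, Hset i (c l) /\ wQ i * c l = c l & m = \sum_l b l * c l].
Proof.
move=> hm; have /HsetP[a mE] := hm; case: asboolP => mi.
  move=> [c aE]; exists 1%N, (fun=> m), (fun=> wQ i).
  have mw : m * wQ i = m.
    by rewrite mE /wQ /wmat asboolT // -psiM mulr1.
  split; rewrite ?big_ord1 ?mw // => _; split=> //; first exact: Hset_wQ.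
  exact: wQ_idem.
move=> /(FR_factor (base i))[r [b [c [hb hc aE]]]].
exists r, (fun l => psi (b l)), (fun l => psi (c l)); split.
- move=> l; have [fb be] := hb l; split.
    by apply/HsetP; exists (b l); rewrite ?asboolF.
  by rewrite /wQ /wmat asboolF // -psiM be.
- move=> l; have [fc ce] := hc l; split.
    by apply/HsetP; exists (c l); rewrite ?asboolF.
  by rewrite /wQ /wmat asboolF // -psiM ce.
- by rewrite mE aE linear_sum; apply: eq_bigr => l _; exact: psiM.
Qed.

(** At a maximal [i] a nonzero scalar is inverted. Otherwise [a] has [base i] as its only nonzero
    row, and a multiple of a matrix unit inverts one nonzero entry of it. *)
Lemma Hset_right_inverse i m : Hset i m -> wQ i * m = m -> m != 0 ->
  exists n, [/\ Hset i n, n * wQ i = n & m * n = wQ i].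
Proof.
move=> /HsetP[a ->]; case: asboolP => mi.
  move=> [c ->] _; rewrite psiZ => c0.
  have cz : c != 0 by apply: contraNneq c0 => ->; rewrite scale0r.
  exists (c^-1 *: wQ i); split; first exact/HsetZ/Hset_wQ.
    by rewrite CFM_scalel wQ_idem.
  rewrite CFM_scaler CFM_scalel scalerA mulVf // scale1r.
  by rewrite /wQ /wmat asboolT // -psiM mulr1.
rewrite /wQ /wmat asboolF // -psiM => fa /psi_inj wa a0.
have [x [y axy]] : exists s t, a s t != 0.
  by apply: CFM_neq0; apply: contraNneq a0 => ->; rewrite linear0.
have aE s t : a s t = (s == base i)%:R * a (base i) t.
  by rewrite -[in LHS]wa entry_unitM.
have aby : a (base i) y != 0.
  by apply: contraNneq axy => a0'; rewrite aE a0' mulr0.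
pose b := (a (base i) y)^-1 *: unit_mx K y (base i).
exists (psi b); split.
- apply/HsetP; exists b; rewrite ?asboolF //.
  apply: (@sub_finite_set _ _ [set y]) => [s [t] /=|]; last exact: finite_set1.
  by rewrite entryZ entry_unit; case: (s =P y) => //= _; rewrite mulr0 eqxx.
- rewrite -psiM CFM_scalel; congr (psi (_ *: _)); apply: CFM_ext => s t.
  rewrite entry_Munit !entry_unit eqxx andbT.
  by case: eqP; case: eqP; rewrite /= ?mulr0 ?mulr1.
- rewrite -psiM CFM_scaler; congr psi; apply: CFM_ext => s t.
  rewrite entryZ entry_Munit (aE s) entry_unit.
  case: (s =P base i) => _ /=; last by rewrite !mul0r mulr0.
  by rewrite mul1r mulrA mulVf // mul1r.
Qed.

(** The values at [i] along the nonzero rows of [psi a] already occur in the nonzero rows of [a],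
    which are finite in number, whereas [aleph] is infinite. *)
Lemma Hset_fresh i m : Hset i m -> ~ maximal_element i ->
  exists v : aleph, forall x y, m x y != 0 -> x.1 i != v.
Proof.
move=> /HsetP[a -> +] mi; rewrite asboolF // => fa.
pose i' : up i := exist _ i (lexx i).
have fv : finite_set [set s.1 i' | s in [set s | exists t, a s t != 0]].
  exact: finite_image.
have [v vP] : exists v, ~ [set s.1 i' | s in [set s | exists t, a s t != 0]] v.
  apply: contrapT => h; apply: aleph_infinite; apply: sub_finite_set fv => v _.
  by apply: contrapT => nv; apply: h; exists v.
exists v => x y mxy; have l := psi_linked mxy.
apply/eqP => xv; apply: vP; exists (restr (linkedl l)).
  by exists (restr (linkedr l)); rewrite -psiE.
exact: xv.
Qed.

(* The coordinates at the indices not above i are chosen outside the values that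
   occur in the finitely many nonzero rows of the other layers, so that only the
   layer i contributes to the entry (x, y). *)
Lemma layers_separated (h : I -> Q) (s : seq I) i k :
  (forall j, Hset j (h j)) -> uniq s -> i \in s -> (k <= i)%O -> h i != 0 ->
  (forall j, (i < j)%O -> h j = 0) ->
  exists x y, [/\ x.2 k, y.2 k & (\sum_(j <- s) h j : Q) x y != 0].
Proof.
move=> Hh us si ki hi0 hgt.
have [x0 [y0 e0]] := CFM_neq0 hi0.
have [a ha] := Hset_psi (Hh i).
have l0 : linked i x0 y0 by move: e0; rewrite ha => /psi_linked.
have /choice[f fP] j : exists v : aleph, ~ maximal_element j ->
    forall x y, h j x y != 0 -> x.1 j != v.
  have [mj|mj] := pselect (maximal_element j); first by exists \bot%O.
  by have [v vP] := Hset_fresh (Hh j) mj; exists v.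
(* Only the layers listed in [s] have to be avoided; the value [\bot] elsewhere makes the support
   finite. *)
pose q j := if j \in s then f j else \bot%O.
have fp : `[< finite_set [set j | q j != \bot%O] >].
  apply/asboolP; rewrite /q; apply: (@sub_finite_set _ _ [set` s]).
    by move=> j /=; case: ifP => //; rewrite eqxx.
  exact: finite_seq.
pose p : finsupp_map aleph I := exist _ q fp.
have [A [Ak Ai]] := maxchain_through ki.
pose z : idx aleph I := (p, A); have hz : z.2 i by exact: Ai.
(* The nonzero entry [(x0, y0)] of [h i] is moved to the base point [z]: at the indices not above
   [i] the coordinates become those of [p], and below [i] the chain becomes [A], which contains
   [k]. *)
pose x := lift_idx hz (restr (linkedl l0)).
pose y := lift_idx hz (restr (linkedr l0)).
have lxy : linked i x y.
  by apply: linked_trans (linked_lift hz _); exact/linked_sym/linked_lift.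
exists x, y; split; [by left|by left|].
rewrite entry_sum (bigD1_seq i) //= big1_seq => [|j /andP[ji sj]].
  rewrite addr0 ha (psiE _ (lift_mem hz _) (lift_mem hz _) lxy) !Defs.liftK.
  by rewrite -psiE // -ha.
(* A second contributing layer [j] shares a chain with [i]. Above [i] it vanishes by hypothesis;
   below [i] the coordinate of [x] at [j] is the avoided value [f j]. *)
apply/eqP/negPn/negP => hj.
have [b hb] := Hset_psi (Hh j).
have lj : linked j x y by move: hj; rewrite hb => /psi_linked.
have jmax : ~~ (i <= j)%O.
  apply/negP => ij; move: hj; rewrite hgt ?entry0 ?eqxx //.
  by rewrite lt_neqAle eq_sym ji.
have lji : (j <= i)%O.
  have [//|ij] := maxchain_chain (linkedl lj) (linkedl lxy).
  by rewrite ij in jmax.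
have mj : ~ maximal_element j by move=> /(_ _ lji) e; rewrite e eqxx in ji.
have := fP j mj x y hj.
rewrite -[finsupp_fun x.1 j]/(lift_map _ _ _) /lift_map.
case: eqP => [ij|_]; first by rewrite ij in jmax.
have -> : finsupp_fun z.1 j = f j; last by rewrite eqxx.
by rewrite -[LHS]/(q j) /q sj.
Qed.

End Layers.

(** * Uniqueness of the components of an element of B(I) *)

Section Decomposition.
Variables (d0 : Order.disp_t) (aleph : bOrderType d0) (K : fieldType).
Variables (d : Order.disp_t) (I : porderType d).
Hypothesis aleph_infinite : infinite_set [set: aleph].

Local Notation Q := (CFM K (idx aleph I)).
Local Notation Hset := (Hset aleph K).
Implicit Types (i j k : I) (m n : Q) (h g : I -> Q).

Definition decomposes h m : Prop := (forall i, Hset i (h i)) /\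
  exists s : seq I, [/\ uniq s, forall j, h j != 0 -> j \in s &
    m = \sum_(j <- s) h j].

Lemma decomposes_seq h m (t : seq I) : decomposes h m -> uniq t ->
  (forall j, h j != 0 -> j \in t) -> m = \sum_(j <- t) h j.
Proof.
move=> [_ [s [us hs ->]]] ut ht.
have e (r : seq I) :
    \sum_(j <- r) h j = \sum_(j <- [seq j <- r | h j != 0]) h j.
  rewrite big_filter [RHS]big_mkcond; apply: eq_bigr => j _.
  by case: eqP => //= ->.
rewrite (e s) (e t); apply: perm_big; apply: uniq_perm; rewrite ?filter_uniq //.
move=> j; rewrite !mem_filter; case: (boolP (h j == 0)) => //= hj.
by rewrite hs // ht.
Qed.

Lemma decomposesB h g m n : decomposes h m -> decomposes g n ->
  decomposes (fun i => h i - g i) (m - n).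
Proof.
move=> dh dg; have [Hh [s [_ hs _]]] := dh; have [Hg [t [_ ht _]]] := dg.
split; first by move=> i; exact: HsetB.
pose r := undup (s ++ t); have ur : uniq r by exact: undup_uniq.
have hr j : h j != 0 -> j \in r by move=> /hs js; rewrite mem_undup mem_cat js.
have gr j : g j != 0 -> j \in r.
  by move=> /ht jt; rewrite mem_undup mem_cat jt orbT.
exists r; split=> //.
  move=> j; have [hj|/hr//] := eqVneq (h j) 0.
  by rewrite hj sub0r oppr_eq0; exact: gr.
by rewrite (decomposes_seq dh ur hr) (decomposes_seq dg ur gr) sumrB.
Qed.

Lemma decomposes0 : decomposes (fun=> 0) 0.
Proof.
split; first by move=> i; exact: Hset0.
by exists [::]; split; rewrite ?big_nil // => j; rewrite eqxx.
Qed.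

Lemma decomposes_layer i m : Hset i m ->
  decomposes (fun j => if j == i then m else 0) m.
Proof.
move=> hm; split; first by move=> j; case: eqP => [->//|_]; exact: Hset0.
exists [:: i]; split=> //; last by rewrite big_seq1 eqxx.
by move=> j; rewrite inE; case: (j == i) => //; rewrite eqxx.
Qed.

Lemma decomposes_ex m : Bset m -> exists h, decomposes h m.
Proof.
move=> [s [hs ->]]; elim: s hs => [|b s IH] hs.
  by exists (fun=> 0); rewrite big_nil; exact: decomposes0.
have [|h dh] := IH; first by move=> c cs; apply: hs; rewrite inE cs orbT.
have [i hi] := hs b (mem_head _ _).
have dN := decomposesB decomposes0 dh.
have := decomposesB (decomposes_layer hi) dN; rewrite sub0r opprK big_cons.
by eexists; eassumption.
Qed.

Lemma decomposes_faithful h m i k : decomposes h m -> (k <= i)%O -> h i != 0 ->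
  (forall j, (i < j)%O -> h j = 0) ->
  exists x y : idx aleph I, [/\ x.2 k, y.2 k & m x y != 0].
Proof.
move=> [Hh [s [us hs ->]]] ki hi hgt.
exact: (layers_separated aleph_infinite Hh us (hs i hi) ki hi hgt).
Qed.

(** At a maximal index of the support of [h], the sum would have a nonzero entry by
    [layers_separated]. *)
Lemma decomposes_eq0 h i : decomposes h 0 -> h i = 0.
Proof.
move=> dh; apply/eqP/negPn/negP => hi.
have [_ [s [_ hs _]]] := dh.
have [//|//|j [_ hj] jmax] := @exists_maximal _ I (fun j => h j != 0) s i.
have [|x [y [_ _]]] := decomposes_faithful dh (lexx j) hj.
  by move=> k jk; apply/eqP/negPn/negP; exact: jmax.
by rewrite entry0 eqxx.
Qed.

Lemma decomposes_inj h g m : decomposes h m -> decomposes g m ->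
  forall i, h i = g i.
Proof.
move=> dh dg i; have := decomposesB dh dg; rewrite subrr => /decomposes_eq0 e.
by apply/eqP; rewrite -subr_eq0; apply/eqP; exact: e.
Qed.

(** [b] comes from the identity or from a diagonal matrix unit; in both cases its row [x] is that of
    the identity, so [b * m] and [m] have the same entry at [(x, y)]. *)
Lemma Hset_detect k m (x y : idx aleph I) : x.2 k -> m x y != 0 ->
  exists2 b : Q, Hset k b & b * m != 0.
Proof.
move=> xk mxy; have [mk|mk] := pselect (maximal_element k).
  exists (psi (1 : CFM K (idx aleph (up k)))).
    apply/HsetP; exists 1; rewrite ?asboolT //.
    by exists 1; rewrite scale1r.
  apply: contraNneq mxy => /(congr1 (fun b : Q => b x y)).
  rewrite entry0 entryM -(@fsbig_widen _ _ _ _ [set x]) ?fsbig_set1 //.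
    by rewrite psi1 eqxx asboolT // mul1r => ->.
  by move=> z [_ /= /eqP zx]; rewrite psi1 eq_sym (negbTE zx) mul0r.
exists (psi (unit_mx K (restr xk) (restr xk))).
  by apply/HsetP; exists (unit_mx K (restr xk) (restr xk)); rewrite ?asboolF //;
    exact: FR_unit.
apply: contraNneq mxy => /(congr1 (fun b : Q => b x y)).
rewrite entry0 entryM -(@fsbig_widen _ _ _ _ [set x]) ?fsbig_set1 //.
  rewrite (psiE _ xk xk (linked_refl xk)) entry_unit eqxx mul1r => ->.
  exact: eqxx.
move=> z [_ /= /eqP zx]; have [l|l] := pselect (linked k x z); last first.
  by rewrite psi_unlinked // mul0r.
rewrite (psiE _ xk (linkedr l) l) entry_unit eqxx /=.
case: eqP => [e|_]; last by rewrite mul0r.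
by move: zx; rewrite (linked_inj l (esym e)) eqxx.
Qed.

End Decomposition.

(** * The stratification of the converse ring of B(I) *)

Section BalgStratification.
Variables (d0 : Order.disp_t) (aleph : bOrderType d0) (K : fieldType).
Variables (d : Order.disp_t) (I : porderType d).
Hypothesis aleph_infinite : infinite_set [set: aleph].
Hypothesis cof : has_finite_cofinal_subset I.

Local Notation Q := (CFM K (idx aleph I)).
Local Notation Hset := (Hset aleph K).
Local Notation B := (Balg aleph K cof).
Local Notation wQ := (@wQ _ aleph K _ I).
Implicit Types (i j k : I) (a b : B).

Definition inB i (m : Q) (hm : Hset i m) : B :=
  exist _ m (asboolT (Hset_Bset hm)).

Definition components a : I -> Q :=
  projT1 (cid (decomposes_ex (asboolW (valP a)))).

Lemma components_decomposes a : decomposes (components a) (val a).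
Proof. by rewrite /components; case: cid. Qed.

Lemma Hset_components i a : Hset i (components a i).
Proof. by case: (components_decomposes a). Qed.

Definition Bpart i a : B := inB (Hset_components i a).

(** By uniqueness, the chosen components may be computed from any decomposition. *)
Lemma BpartE i a h : decomposes h (val a) -> val (Bpart i a) = h i.
Proof.
by move=> dh; apply: decomposes_inj dh _ => //; exact: components_decomposes.
Qed.

Lemma Bpart_Hset i a : Bpart i a = a <-> Hset i (val a).
Proof.
split=> [<-|ha]; first exact: Hset_components.
by apply: val_inj; rewrite (BpartE i (decomposes_layer ha)) eqxx.
Qed.

Definition Bscal i (c : K) : B := inB (HsetZ c (Hset_wQ aleph K i)).

Lemma val_mulB a b : val (a * b) = val a * val b :> Q. Proof. by []. Qed.

Lemma BpartB i : {morph Bpart i : a b / a - b}.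
Proof.
move=> a b; apply: val_inj.
by rewrite (BpartE (a := a - b) i (decomposesB (components_decomposes a)
  (components_decomposes b))).
Qed.

Lemma Bpart_part i j a : Bpart i (Bpart j a) = if i == j then Bpart j a else 0.
Proof.
apply: val_inj.
rewrite (BpartE (a := Bpart j a) i (decomposes_layer (Hset_components j a))).
by case: eqP.
Qed.

Lemma Bpart_ext a : (forall i, Bpart i a = 0) -> a = 0.
Proof.
move=> h; apply: val_inj; have [_ [s [_ _ ->]]] := components_decomposes a.
by rewrite big1 // => i _; have := congr1 val (h i).
Qed.

Lemma Bpart_finite a : exists s : seq I, forall i, Bpart i a != 0 -> i \in s.
Proof.
have [_ [s [_ hs _]]] := components_decomposes a; exists s => i ai.
by apply: hs; apply: contraNneq ai => e; apply/eqP/val_inj.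
Qed.

Lemma Bpart_scal i c : Bpart i (Bscal i c) = Bscal i c.
Proof. by apply/Bpart_Hset/HsetZ/Hset_wQ. Qed.

Lemma BscalD i : {morph Bscal i : c e / c + e}.
Proof. by move=> c e; apply: val_inj; rewrite /= scalerDl. Qed.

Lemma BscalM i : {morph Bscal i : c e / c * e}.
Proof.
move=> c e; apply: val_inj; rewrite val_mulB /= CFM_scalel CFM_scaler wQ_idem.
by rewrite scalerA.
Qed.

Lemma val_Bscal1 i : val (Bscal i 1) = wQ i.
Proof. by rewrite /= scale1r. Qed.

Lemma Bscal1_neq0 i : Bscal i 1 != 0.
Proof.
apply: contraNneq (wQ_neq0 aleph K i) => /(congr1 val).
by rewrite val_Bscal1 => ->.
Qed.

(** Products are reversed in the converse ring: right inverses in B(I) provide [part_left_inverse],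
    and detection from the left provides [part_faithful]. *)
Definition Balg_stratification : stratification B^c K I.
Proof.
apply: (@Stratification B^c K d I Bpart Bscal).
- exact: BpartB.
- exact: Bpart_part.
- exact: Bpart_ext.
- exact: Bpart_finite.
- move=> i j a b ij /Bpart_Hset ha /Bpart_Hset hb.
  have [h1 h2] := Hset_mul_le ij ha hb.
  by split; apply/Bpart_Hset; [exact: h2|exact: h1].
- move=> i j a b ij ji /Bpart_Hset ha /Bpart_Hset hb; apply: val_inj.
  exact: Hset_mul_incomparable ji ij hb ha.
- exact: Bpart_scal.
- exact: BscalD.
- by move=> i c e; rewrite mulrC; exact: BscalM.
- exact: Bscal1_neq0.
- move=> i a /Bpart_Hset ha; have [c cE] := Hset_corner ha; exists c.
  apply: val_inj.
  rewrite -[LHS]/(val (Bscal i 1) * (val a * val (Bscal i 1)) : Q).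
  by rewrite val_Bscal1 mulrA cE.
- move=> i a /Bpart_Hset ha; have [r [b [c [hb hc aE]]]] := Hset_factor ha.
  exists r, (fun l => inB (proj1 (hc l))), (fun l => inB (proj1 (hb l))); split.
  + move=> l; split; first by apply/Bpart_Hset; case: (hc l).
    apply: val_inj; rewrite -[LHS]/(val (Bscal i 1) * c l : Q) val_Bscal1.
    by case: (hc l).
  + move=> l; split; first by apply/Bpart_Hset; case: (hb l).
    apply: val_inj; rewrite -[LHS]/(b l * val (Bscal i 1) : Q) val_Bscal1.
    by case: (hb l).
  + apply: val_inj; rewrite aE.
    by rewrite (big_morph (fun b : B => val b : Q) (id1 := 0) (op1 := +%R)).
- move=> i a /Bpart_Hset ha wa a0.
  have wa' : wQ i * val a = val a.
    by have := congr1 val wa; rewrite -{1}(val_Bscal1 i).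
  have a0' : val a != 0 by apply: contraNneq a0 => e; apply/eqP/val_inj.
  have [b [hb bw ab]] := Hset_right_inverse ha wa' a0'.
  exists (inB hb); split; first exact/Bpart_Hset.
    by apply: val_inj; rewrite -[LHS]/(b * val (Bscal i 1) : Q) val_Bscal1.
  by apply: val_inj; rewrite val_Bscal1.
- move=> i k a ki ai aj.
  have [||x [y [xk _ axy]]] :=
    decomposes_faithful aleph_infinite (components_decomposes a) ki.
  + by apply: contraNneq ai => e; apply/eqP/val_inj.
  + by move=> j ij; have := congr1 val (aj j ij).
  have [b hb ba] := Hset_detect xk axy.
  exists (inB hb); first exact/Bpart_Hset.
  by apply: contraNneq ba => /(congr1 val) e; apply/eqP.
Defined.

End BalgStratification.

(** * Hahn powers *)

Section FreeLiftTransport.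
Variables (P : choiceType) (V : zmodType) (c : P -> V).

Lemma free_lift_sum (T : Type) (r : seq T) (F : T -> P) (e : T -> int) :
  free_lift c (\sum_(t <- r) << F t >> *~ e t) = \sum_(t <- r) c (F t) *~ e t.
Proof.
pose L : {additive {freeg P / int} -> V} := HB.pack (free_lift c)
  (GRing.isAdditive.Build _ _ _ (free_lift_is_additive c)).
rewrite -[LHS]/(L _) raddf_sum; apply: eq_bigr => t _.
by rewrite raddfMz; congr (_ *~ _); exact: free_liftU.
Qed.

End FreeLiftTransport.

Lemma free_lift_id (P : choiceType) (x : {freeg P / int}) :
  free_lift (fun i => << i >>) x = x.
Proof.
rewrite -[RHS]freeg_sumE; apply: eq_bigr => i _.
rewrite -scaler_int intz; apply/eqP/freeg_eqP => j.
by rewrite coeffZ !coeffU mul1r.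
Qed.

Section Push.
Variables (P P' : choiceType) (f : P -> P').

Definition freeg_push (x : {freeg P / int}) : {freeg P' / int} :=
  free_lift (fun i => << f i >>) x.

Lemma free_lift_push (V : zmodType) (c : P' -> V) x :
  free_lift c (freeg_push x) = free_lift (c \o f) x.
Proof. exact: free_lift_sum. Qed.

End Push.

Lemma freeg_pushK (P P' : choiceType) (f : P -> P') (g : P' -> P) :
  cancel f g -> cancel (freeg_push f) (freeg_push g).
Proof.
move=> fK x; rewrite /freeg_push free_lift_push -[RHS]free_lift_id.
by apply: eq_bigr => i _; rewrite /= fK.
Qed.

(** Coefficients become homomorphisms out of the free group, to which [free_lift_push] applies. *)
Lemma free_lift_delta (P : choiceType) (i : P) (x : {freeg P / int}) :
  free_lift (fun j => (j == i)%:R : int) x = coeff i x.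
Proof.
rewrite -[in RHS](freeg_sumE x).
rewrite (big_morph (coeff i) (coeffD i) (coeff0 _ i)).
by apply: eq_bigr => j _; rewrite coeffU -mulrzr intz mulrC.
Qed.

Lemma coeff_push (P P' : choiceType) (f : P -> P') i x : injective f ->
  coeff (f i) (freeg_push f x) = coeff i x.
Proof.
move=> fI; rewrite -!free_lift_delta free_lift_push.
by apply: eq_bigr => j _; rewrite /= (inj_eq fI).
Qed.

Lemma hahn_cone_push (P P' : choiceType) (f : P -> P') (g : P' -> P)
    (le : P -> P -> Prop) (le' : P' -> P' -> Prop) x :
  cancel f g -> cancel g f -> (forall i j, le' (f i) (f j) <-> le i j) ->
  hahn_cone le' (freeg_push f x) <-> hahn_cone le x.
Proof.
move=> fK gK le'E.
have domE i : (f i \in dom (freeg_push f x)) = (i \in dom x).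
  by rewrite !mem_dom coeff_push //; exact: can_inj fK.
split=> hx i.
  move=> idom imax; rewrite -(coeff_push _ _ (can_inj fK)); apply: hx.
    by rewrite domE.
  move=> j; rewrite -(gK j) domE => jdom /le'E ij.
  by rewrite (imax _ jdom ij).
rewrite -(gK i) domE => idom imax; rewrite coeff_push; last exact: can_inj fK.
apply: hx => // j jdom ij; apply: (can_inj fK); apply: imax.
  by rewrite domE.
exact/le'E.
Qed.

(** For distinct [i] and [j], the index [i], with coefficient -1, is maximal in the support unless
    it lies below [j]. So the cone determines the order of [I]. *)
Lemma hahn_cone_sub (d : Order.disp_t) (I : porderType d) (i j : I) :
  hahn_cone (fun k l : I => (k <= l)%O)
    (<< j >> - << i >> : {freeg I / int}) <-> (i <= j)%O.
Proof.
have [->|ij] := eqVneq i j.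
  by rewrite subrr lexx; split=> // _ k; rewrite mem_dom coeff0 eqxx.
have cE k : coeff k (<< j >> - << i >> : {freeg I / int}) =
    (j == k)%:R - (i == k)%:R by rewrite coeffB !coeffU !mul1r.
split=> [hc|lij k].
  apply: contraT => nij.
  have : 0 < coeff i (<< j >> - << i >> : {freeg I / int}).
    apply: hc => [|k].
      by rewrite mem_dom cE eqxx [j == i]eq_sym (negbTE ij).
    rewrite mem_dom cE; case: (eqVneq j k) => [<- _|_].
      by rewrite (negbTE nij).
    by case: (eqVneq i k) => // _; rewrite subrr eqxx.
  by rewrite cE eqxx [j == i]eq_sym (negbTE ij).
rewrite mem_dom !cE; case: (eqVneq j k) => [<- _|jk].
  by rewrite (negbTE ij).
case: (eqVneq i k) => [<- _|_]; last by rewrite subrr eqxx.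
move=> /(_ j); rewrite mem_dom cE eqxx (negbTE ij) => /(_ isT lij) e.
by rewrite e eqxx in ij.
Qed.

(** * Classes of the primitive idempotents of the layers *)

Section PrimitiveClass.
Variables (d0 : Order.disp_t) (aleph : bOrderType d0) (K : fieldType).
Variables (d : Order.disp_t) (I : porderType d).
Hypothesis aleph_infinite : infinite_set [set: aleph].
Hypothesis cof : has_finite_cofinal_subset I.

(** [primitive_layer_idem] makes [u] equivalent to [w i], so its class does not depend on the choice
    of [u]. *)
Lemma primitive_class i (u : Balg aleph K cof)
    (hu : primitive_idempotent_in (Hset aleph K i) (val u)) :
  K0class (fgproj_right_ideal (primitive_idempotent_Balg hu)) =
  wclass (Balg_stratification K aleph_infinite cof) i.
Proof.
have uu := primitive_idempotent_Balg hu.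
have [Hu _ u0 prim] := hu.
have [||||x [y [xy yx]]] := @primitive_layer_idem _ _ _ _
  (Balg_stratification K aleph_infinite cof) i (u : (Balg aleph K cof)^c).
- exact/Bpart_Hset.
- exact: uu.
- by apply: contraNneq u0 => ->.
- move=> [f [g [[lf lg] [ff gg] [f0 g0] [fg gf] ufg]]]; apply: prim.
  exists (val f), (val g); split.
  + by split; apply/Bpart_Hset.
  + by split; [have := congr1 val ff|have := congr1 val gg].
  + split; [apply: contraNneq f0 => e|apply: contraNneq g0 => e];
      by apply/eqP/val_inj.
  + by split; [have := congr1 val gf|have := congr1 val fg].
  + by have := congr1 val ufg.
have EE : ((u : (Balg aleph K cof)^c)%:M : 'M_1) *m
    (u : (Balg aleph K cof)^c)%:M = (u : (Balg aleph K cof)^c)%:M.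
  by rewrite -scalar_mxM; congr (_%:M).
rewrite (mxproj_right_ideal _ EE) /wclass.
apply: (@mxproj_equiv _ _ _ _ _ _ _ (x : (Balg aleph K cof)^c)%:M
  (y : (Balg aleph K cof)^c)%:M).
- by rewrite -scalar_mxM xy.
- by rewrite -scalar_mxM yx.
Qed.

End PrimitiveClass.

Unset Implicit Arguments.

Theorem theorem5p7
    (d0 : Order.disp_t) (aleph : bOrderType d0)
    (haleph : infinite_cardinal aleph)
    (K : fieldType)
    (d : Order.disp_t) (I : porderType d)
    (hI : aleph_poset aleph I)
    (hcof : has_finite_cofinal_subset I)
    (u : I -> Balg aleph K hcof)
    (hu : forall i : I,
       primitive_idempotent_in (Hset aleph K i) (val (u i))) :
  let K0B : zmodType := K0 (Balg aleph K hcof) in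
  (* [u_i B(I)] *)
  let cls (i : I) : K0B :=
    K0class (fgproj_right_ideal (primitive_idempotent_Balg (hu i))) in
  let U : set K0B := range cls in
  let rho : {freeg I / int} -> K0B := free_lift cls in
  [/\ is_basis U,
      K0pos (Balg aleph K hcof) =
        [set free_lift (val : U -> K0B) x
           | x in hahn_cone (fun s t : U => K0le (val s) (val t))],
      zmod_morphism rho,
      bijective rho &
      forall x y : {freeg I / int},
        hahn_le (fun i j : I => (i <= j)%O) x y <-> K0le (rho x) (rho y)].
Proof.
move=> K0B cls U rho.
pose str := Balg_stratification K haleph.1 hcof.
have clsE i : cls i = wclass str i by exact: primitive_class.
have rhoE : rho = wlift str.
  by rewrite /rho /wlift (_ : cls = wclass str) //; apply/funext.
have rho_bij : bijective rho.
  have /choice[g gP] y : exists x, y = rho x.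
    by rewrite rhoE; exact: wlift_surj.
  exists g => [x|y]; last by rewrite -gP.
  by apply: (@wlift_inj _ _ _ _ str); rewrite -rhoE -gP.
have posP x : K0pos _ (rho x) <-> hahn_cone (fun i j : I => (i <= j)%O) x.
  by rewrite rhoE; exact: wlift_posP.
have rhoB : {morph rho : x y / x - y} by exact: free_lift_is_additive.
have rhoU i : rho << i >> = cls i by exact: free_liftU.
have clsI : injective cls.
  move=> i j e; have := bij_inj rho_bij; rewrite -!rhoU in e => /(_ _ _ e).
  move=> /(congr1 (coeff i)); rewrite !coeffU !mul1r eqxx.
  by case: (j =P i) => // _ /eqP; rewrite oner_eq0.
have UP i : cls i \in U by apply/mem_set; exists i.
pose f i : U := exist _ (cls i) (UP i).
have /choice[g gP] (y : U) : exists i, cls i = val y.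
  by have /set_mem[i _ e] := valP y; exists i.
have fK : cancel f g by move=> i; apply: clsI; rewrite gP.
have gK : cancel g f by move=> y; apply: val_inj; rewrite /= gP.
have liftE x : free_lift (val : U -> K0B) (freeg_push f x) = rho x.
  exact: free_lift_push.
(* The order that [U] inherits from K_0 is that of [I]: positivity of [cls j - cls i] is read in the
   Hahn cone. *)
have leE i j : K0le (val (f i)) (val (f j)) <-> (i <= j)%O.
  have e : rho (<< j >> - << i >>) = cls j - cls i by rewrite rhoB !rhoU.
  rewrite /K0le /= -e.
  exact: (iff_trans (posP (<< j >> - << i >>)) (hahn_cone_sub i j)).
have coneE x : hahn_cone (fun s t : U => K0le (val s) (val t)) (freeg_push f x)
    <-> hahn_cone (fun i j : I => (i <= j)%O) x.
  exact: hahn_cone_push fK gK leE.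
split; last 2 first.
- exact: rho_bij.
- move=> x y; have := posP (y - x); rewrite rhoB /hahn_le /K0le => e.
  exact: iff_sym.
(* Up to the relabelling [g] of [U] by [I], the homomorphism extending the inclusion of [U] is
   [rho]. *)
- apply: (@eq_bij _ _ (rho \o freeg_push g)).
    by apply: bij_comp rho_bij _; exists (freeg_push f); exact: freeg_pushK.
  by move=> x; rewrite -[in RHS](freeg_pushK gK x) liftE.
- apply/seteqP; split=> y.
    have [h _ hK] := rho_bij; rewrite -(hK y) => /posP/coneE hy.
    by exists (freeg_push f (h y)); rewrite ?liftE.
  move=> [x]; rewrite -[x](freeg_pushK gK) => /coneE/posP + <-.
  by rewrite liftE.
- exact: free_lift_is_additive.
Qed.
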